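(* Let $G$ be a group with a fixed finite presentation $\langle X\mid R\rangle$ and let $M(G)$ be its Miller Machine. The conjugacy problem for $M(G)$ is decidable if and only if there is an algorithm deciding iso-computational list conjugacy in $G$, i.e. an algorithm which, on input $k\ge 1$, two $k$-tuples $\mathbf u,\mathbf v$ of elements of the free group $F(X)$ and a $k$-tuple $\sigma\in\{\pm1\}^k$ such that $\sigma_i=-\sigma_{i+1}$ implies that $u_i,v_i$ are not both the identity of $F(X)$, decides whether $\mathbf u\overset{\sigma}{\sim}\mathbf v$.
   Context: Standing assumptions: $X,R$ are finite, $R\neq\emptyset$ is a set of words on $X^{\pm1}$, and $X\cap R=\emptyset$. The Miller Machine $M(G)$ (which depends on the presentation) is the group generated by $X\cup\Theta\cup\{q\}$, where $\Theta=\{\theta_\alpha:\alpha\in X\cup R\}$ and $q$ are new letters, with defining relations: $\theta_\alpha x=x\theta_\alpha$ ($x\in X$, $\alpha\in X\cup R$); $\theta_x xq=qx\theta_x$ ($x\in X$); $\theta_r q=qr\theta_r$ ($r\in R$). The conjugacy problem for $M(G)$: given two words in the generators of $M(G)$, decide whether they represent conjugate elements. Iso-computational list conjugacy: let $\mathbf u=(u_1,\dots,u_k)$, $\mathbf v=(v_1,\dots,v_k)$ be tuples of elements of $F(X)$ and $\sigma=(\sigma_1,\dots,\sigma_k)\in\{\pm1\}^k$, with the convention $\sigma_{k+1}=\sigma_1$, and assume that for each $i=1,\dots,k$, $\sigma_i=-\sigma_{i+1}$ implies that $u_i$ and $v_i$ are not both trivial in $F(X)$. Write $\mathbf u\overset{\sigma}{\sim}\mathbf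 v$ if there exist $w,\varepsilon\in F(X)$ such that $\varepsilon$ represents the identity of $G$ and for every $i=1,\dots,k$ the following equalities hold in $F(X)$: - if $\sigma_i=\sigma_{i+1}=1$, then $w\varepsilon u_iw^{-1}=v_i$; - if $\sigma_i=1,\sigma_{i+1}=-1$, then $w\varepsilon u_i\varepsilon^{-1}w^{-1}=v_i$; - if $\sigma_i=-1,\sigma_{i+1}=1$, then $wu_iw^{-1}=v_i$; - if $\sigma_i=\sigma_{i+1}=-1$, then $wu_i\varepsilon^{-1}w^{-1}=v_i$. *)

(* Defs.v *)
From mathcomp Require Import all_boot finmap.

Set Implicit Arguments.
Unset Strict Implicit.
Unset Printing Implicit Defensive.

(* Model of computation: the WHILE language over binary trees (N. D. Jones,
   Computability and Complexity from a Programming Perspective, 1997), in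
   variable-free form.  A program transforms one tree, in which the values of
   several variables can be stored by nesting; its partial input/output
   relation is [eval].  The language simulates counter machines directly, so
   it is Turing-complete. *)
Inductive tree : Type := Leaf | Node (l r : tree).

Definition tree_hd (t : tree) : tree := if t is Node l _ then l else Leaf.
Definition tree_tl (t : tree) : tree := if t is Node _ r then r else Leaf.

Inductive prog : Type :=
| PId
| PLeaf
| PHd
| PTl
| PNode (p1 p2 : prog)
| PSeq (p1 p2 : prog)
| PIf (c p1 p2 : prog)
| PWhile (c p : prog).

(* In tests, [Leaf] counts as false and every other tree as true. *)
Inductive eval : prog -> tree -> tree -> Prop :=
| EId t : eval PId t t
| ELeaf t : eval PLeaf t Leaf
| EHd t : eval PHd t (tree_hd t)
| ETl t : eval PTl t (tree_tl t)
| ENode p1 p2 t t1 t2 :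
    eval p1 t t1 -> eval p2 t t2 -> eval (PNode p1 p2) t (Node t1 t2)
| ESeq p1 p2 t t1 t2 :
    eval p1 t t1 -> eval p2 t1 t2 -> eval (PSeq p1 p2) t t2
| EIfTrue c p1 p2 t l r t' :
    eval c t (Node l r) -> eval p1 t t' -> eval (PIf c p1 p2) t t'
| EIfFalse c p1 p2 t t' :
    eval c t Leaf -> eval p2 t t' -> eval (PIf c p1 p2) t t'
| EWhileTrue c p t l r t1 t2 :
    eval c t (Node l r) -> eval p t t1 -> eval (PWhile c p) t1 t2 ->
    eval (PWhile c p) t t2
| EWhileFalse c p t :
    eval c t Leaf -> eval (PWhile c p) t t.

Definition enc_bool (b : bool) : tree := if b then Node Leaf Leaf else Leaf.
Definition enc_nat (n : nat) : tree := iter n (Node Leaf) Leaf.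
Definition enc_seq (T : Type) (enc : T -> tree) (s : seq T) : tree :=
  foldr (fun x => Node (enc x)) Leaf s.

(* [I] is the type of instances, read by programs through [enc]; [valid] is
   the set of admissible inputs (nothing is required of the program on the
   other ones) and [yes] the property to decide. *)
Definition algorithmically_decidable (I : Type) (enc : I -> tree)
    (valid yes : I -> Prop) : Prop :=
  exists p : prog, forall i : I, valid i ->
    exists b : bool, eval p (enc i) (enc_bool b) /\ (b <-> yes i).

(* The letter [(a, true)] is the generator a, and [(a, false)] its inverse. *)
Definition word (A : Type) : Type := seq (A * bool).

Definition gen (A : Type) (a : A) : A * bool := (a, true).

Definition winv (A : Type) (w : word A) : word A :=
  [seq (l.1, ~~ l.2) | l <- rev w].

(* Equality, in the group with generators [A] and defining relations l = r
   for [rel l r], of the elements represented by two words. *)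
Inductive pres_eq (A : Type) (rel : word A -> word A -> Prop) :
    word A -> word A -> Prop :=
| PresRefl u : pres_eq rel u u
| PresSym u v : pres_eq rel u v -> pres_eq rel v u
| PresTrans u v w : pres_eq rel u v -> pres_eq rel v w -> pres_eq rel u w
| PresCancel u v a b : pres_eq rel (u ++ [:: (a, b); (a, ~~ b)] ++ v) (u ++ v)
| PresRel u v l r : rel l r -> pres_eq rel (u ++ l ++ v) (u ++ r ++ v).

Definition pres_conj (A : Type) (rel : word A -> word A -> Prop)
    (u v : word A) : Prop :=
  exists w : word A, pres_eq rel (w ++ u ++ winv w) v.

(* Elements of the free group are represented by arbitrary, not necessarily
   reduced, words. *)
Definition free_eq (A : Type) : word A -> word A -> Prop :=
  pres_eq (fun _ _ => False).

Definition group_rel (X : finType) (R : {fset word X}) (l r : word X) : Prop :=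
  l \in R /\ r = [::].

Definition enc_word (A : finType) : word A -> tree :=
  enc_seq (fun l => Node (enc_nat (enum_rank l.1)) (enc_bool l.2)).

Definition conjugacy_problem_decidable (A : finType)
    (rel : word A -> word A -> Prop) : Prop :=
  algorithmically_decidable
    (fun uv : word A * word A => Node (enc_word uv.1) (enc_word uv.2))
    (fun _ => True)
    (fun uv => pres_conj rel uv.1 uv.2).

(* The generators of the Miller machine: X, then Theta indexed by the union of
   X and R (disjoint by assumption, hence a sum type), then q. *)
Definition miller_gen (X : finType) (R : {fset word X}) : finType :=
  (X + (X + R) + unit)%type.

Section MillerMachine.
Variables (X : finType) (R : {fset word X}).

Definition mx (x : X) : miller_gen R := inl (inl x).
Definition mtheta (alpha : X + R) : miller_gen R := inl (inr alpha).
Definition mq : miller_gen R := inr tt.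

Definition miller_word (w : word X) : word (miller_gen R) :=
  [seq (mx l.1, l.2) | l <- w].

Inductive miller_rel : word (miller_gen R) -> word (miller_gen R) -> Prop :=
| MillerComm (alpha : X + R) (x : X) :
    miller_rel [:: gen (mtheta alpha); gen (mx x)]
               [:: gen (mx x); gen (mtheta alpha)]
| MillerGen (x : X) :
    miller_rel [:: gen (mtheta (inl x)); gen (mx x); gen mq]
               [:: gen mq; gen (mx x); gen (mtheta (inl x))]
| MillerRel (r : R) :
    miller_rel [:: gen (mtheta (inr r)); gen mq]
               (gen mq :: miller_word (val r) ++ [:: gen (mtheta (inr r))]).

End MillerMachine.

(* Signs are booleans: [true] is +1, [false] is -1.  [ordS] is the cyclic
   successor of 'I_k, which implements the convention on the index k+1. *)
Record list_instance (X : Type) := ListInstance {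
  li_k : nat;
  li_u : li_k.-tuple (word X);
  li_v : li_k.-tuple (word X);
  li_sigma : li_k.-tuple bool
}.

Definition enc_list_instance (X : finType) (L : list_instance X) : tree :=
  Node (enc_seq (@enc_word X) (li_u L))
    (Node (enc_seq (@enc_word X) (li_v L)) (enc_seq enc_bool (li_sigma L))).

Definition list_admissible (X : Type) (L : list_instance X) : Prop :=
  0 < li_k L /\
  forall i : 'I_(li_k L),
    tnth (li_sigma L) i = ~~ tnth (li_sigma L) (ordS i) ->
    ~ (free_eq (tnth (li_u L) i) [::] /\ free_eq (tnth (li_v L) i) [::]).

Definition iso_list_conj (X : finType) (R : {fset word X})
    (L : list_instance X) : Prop :=
  exists w e : word X, pres_eq (group_rel R) e [::] /\
    forall i : 'I_(li_k L),
      let u := tnth (li_u L) i in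
      let v := tnth (li_v L) i in
      match tnth (li_sigma L) i, tnth (li_sigma L) (ordS i) with
      | true, true => free_eq (w ++ e ++ u ++ winv w) v
      | true, false => free_eq (w ++ e ++ u ++ winv e ++ winv w) v
      | false, true => free_eq (w ++ u ++ winv w) v
      | false, false => free_eq (w ++ u ++ winv e ++ winv w) v
      end.

Definition iso_list_conj_decidable (X : finType) (R : {fset word X}) : Prop :=
  algorithmically_decidable (@enc_list_instance X) (@list_admissible X)
    (@iso_list_conj X R).

(* Main.v *)
(** The relations of M(G) say that each theta fixes X and that conjugation by it sends q
    to [x^-1 q x] or [q r].  Hence M(G) is the semidirect product of K = F(X + q) by F(Theta),
    where t acts by [q -> a(t)^-1 q b(t)], and the pairs [(a(t), b(t))] are exactly the pairs
    [(w, w e)] of elements of F(X) with [e = 1] in G.  The group M(G) acts on the Bass-Serre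
    tree of K = F(X) * <q>, and the usual argument on axes (Collins' lemma) shows that two
    q-cyclically reduced elements are conjugate if and only if, up to a rotation of their
    q-syllables, they are conjugate by some [(a(t), t)] or [(b(t), t)].  For elements of K
    this is list conjugacy.

    From list conjugacy to M(G): the rotation is excluded by appending a copy of the list in
    which one coefficient between opposite signs is raised to a large power; a list of
    constant sign is first extended by products of two of its coefficients.

    From M(G) to list conjugacy: elements of K are cyclically reduced by conjugators of
    bounded length and the oracle is queried.  If the F(Theta)-component T is not trivial,
    then t is determined up to a power of T, and the coefficients along the powers of T stay
    in a bounded ball by convexity of the distance between axes; by the pigeonhole principle
    conjugate elements have a conjugator of computably bounded length. *)

From Stdlib Require Import ClassicalEpsilon.
From HB Require Import structures.
Require Import Defs.
From mathcomp Require Import all_boot finmap.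
From mathcomp Require Import zify.

Set Implicit Arguments.
Unset Strict Implicit.
Unset Printing Implicit Defensive.

Local Open Scope group_scope.

(** No tree is constructed: only the displacement of a base vertex is kept, and the four-point
    condition turns each picture into linear arithmetic. Since F(Theta) preserves the number of
    letters q, the length on K extends to M(G).

    Powers are taken between opposite signs because only there is the effect of s on a coefficient a
    conjugation; elsewhere it is multiplied by a(s) on one side and by the inverse of b(s) on the
    other, or conversely. Conjugation commutes with powers, and a conjugate of the N-th power of a
    nontrivial element has length at least N, so the large power can be recognized among short
    coefficients.

    In the other direction the oracle serves only when both F(Theta)-components are trivial: nothing
    then constrains t, and its length measures how hard it is to derive e = 1 in G, which has no
    computable bound in general. Elements fixing a vertex are treated apart: a conjugator follows a
    segment of fixed edges, along which the coefficient takes only two values up to conjugacy, so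
    that one letter q suffices. *)

Ltac gsimp := rewrite ?(invgM, invgK, mulgA, mulg1, mul1g, invg1, mulVg, mulgV, mulgK, mulgVK).

(** * Free groups as reduced words *)

Section FreeGroup.
Variable A : choiceType.
Implicit Types (l : A * bool) (u v w : word A).

Definition linv l : A * bool := (l.1, ~~ l.2).

Lemma linvK : involutive linv.
Proof. by case=> a b; rewrite /linv /= negbK. Qed.

Lemma winvE w : winv w = map linv (rev w).
Proof. by []. Qed.

Lemma winv_cat u v : winv (u ++ v) = winv v ++ winv u.
Proof. by rewrite !winvE rev_cat map_cat. Qed.

Lemma winv_cons l w : winv (l :: w) = winv w ++ [:: linv l].
Proof. by rewrite -cat1s winv_cat. Qed.

Lemma winvK : involutive (@winv A).
Proof.
by move=> w; rewrite !winvE -map_rev revK -map_comp map_id_in // => l _ /=; exact: linvK.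
Qed.

Definition reduced w := sorted (fun l k => k != linv l) w.

(** Left multiplication by a letter. Folding it lets words act on reduced words, as in van der
    Waerden's proof that normal forms are unique. *)
Definition push l w : word A :=
  if w is k :: w' then if k == linv l then w' else l :: w else [:: l].

Definition red w : word A := foldr push [::] w.

Lemma reduced_cons l w : reduced (l :: w) -> reduced w.
Proof. by case: w => //= k w /andP[]. Qed.

Lemma push_reduced l w : reduced w -> reduced (push l w).
Proof.
case: w => //= k w; case: eqP => [_|/eqP ne] /= pw; last by rewrite ne.
exact: (@reduced_cons k).
Qed.

Lemma push_red_cons l w : reduced (l :: w) -> push l w = l :: w.
Proof. by case: w => //= k w /andP[/negbTE->]. Qed.

Lemma foldr_push_reduced u w : reduced w -> reduced (foldr push w u).
Proof. by move=> rw; elim: u => //= l u; exact: push_reduced. Qed.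

Lemma red_reduced w : reduced (red w).
Proof. exact: foldr_push_reduced. Qed.

Lemma red_id w : reduced w -> red w = w.
Proof.
by elim: w => //= l w IH rw; rewrite IH ?push_red_cons //; exact: reduced_cons rw.
Qed.

Lemma pushK l w : reduced w -> push l (push (linv l) w) = w.
Proof.
case: w => [|k w] /=; first by rewrite eqxx.
rewrite linvK; case: eqP => [->|/eqP ne] rw /=; last by rewrite eqxx.
by rewrite push_red_cons.
Qed.

Lemma foldr_push l u w : reduced w ->
  foldr push w (push l u) = push l (foldr push w u).
Proof.
case: u => //= k u rw; case: eqP => [->|//].
by rewrite pushK // foldr_push_reduced.
Qed.

(** A letter and its inverse act by mutually inverse maps ([pushK]), so the action of a word depends
    only on its reduction; associativity of [fg_mul] rests on this. *)
Lemma foldr_push_red u w : reduced w -> foldr push w (red u) = foldr push w u.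
Proof. by move=> rw; elim: u => //= l u <-; rewrite foldr_push. Qed.

Lemma red_cat u v : red (u ++ v) = foldr push (red v) u.
Proof. by rewrite /red foldr_cat. Qed.

Lemma red_winv_l w : red (winv w ++ w) = [::].
Proof.
elim: w => //= l w IH; rewrite winv_cons -catA red_cat.
have -> : red ([:: linv l] ++ l :: w) = red w.
  by rewrite /= -{2}(linvK l) pushK ?red_reduced.
by rewrite -red_cat.
Qed.

Record fg := Fg { fgw :> seq (A * bool); _ : reduced fgw }.
HB.instance Definition _ := [isSub for fgw].
HB.instance Definition _ := [Choice of fg by <:].

Lemma fgP (u : fg) : reduced u.
Proof. by case: u. Qed.

Definition of_word w : fg := Fg (red_reduced w).

Lemma of_wordK (u : fg) : of_word u = u.
Proof. by apply: val_inj; rewrite /= red_id // fgP. Qed.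

Definition fg_mul (u v : fg) := of_word (u ++ v).
Definition fg_inv (u : fg) := of_word (winv u).
Definition fg_one := of_word [::].

Lemma red_cat_red u v : red (red u ++ red v) = red (u ++ v).
Proof. by rewrite !red_cat (red_id (red_reduced v)) foldr_push_red ?red_reduced. Qed.

Lemma of_word_fg_mul u v : of_word (u ++ v) = fg_mul (of_word u) (of_word v).
Proof. by apply: val_inj; rewrite /= red_cat_red. Qed.

Fact fg_mulA : associative fg_mul.
Proof.
move=> u v w; rewrite -[u]of_wordK -[v]of_wordK -[w]of_wordK.
by rewrite -!of_word_fg_mul catA.
Qed.
Fact fg_mul1 : left_id fg_one fg_mul.
Proof. by move=> u; rewrite -{1}[u]of_wordK -of_word_fg_mul of_wordK. Qed.
Fact fg_mulr1 : right_id fg_one fg_mul.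
Proof. by move=> u; rewrite -{1}[u]of_wordK -of_word_fg_mul cats0 of_wordK. Qed.
Fact fg_mulV : left_inverse fg_one fg_inv fg_mul.
Proof.
move=> u; rewrite -{2}[u]of_wordK -of_word_fg_mul.
by apply: val_inj; rewrite /= red_winv_l.
Qed.
Fact fg_mulrV : right_inverse fg_one fg_inv fg_mul.
Proof.
move=> u; rewrite -{1}[u]of_wordK -of_word_fg_mul.
by apply: val_inj; rewrite /= -{1}[fgw u]winvK red_winv_l.
Qed.

HB.instance Definition _ := isGroup.Build fg fg_mulA fg_mul1 fg_mulr1 fg_mulV fg_mulrV.

Lemma of_word_cat u v : of_word (u ++ v) = of_word u * of_word v.
Proof. exact: of_word_fg_mul. Qed.

Lemma of_word_nil : of_word [::] = 1.
Proof. by []. Qed.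

Lemma of_word_winv w : of_word (winv w) = (of_word w)^-1.
Proof.
apply: (mulIg (of_word w)); rewrite mulVg -of_word_cat.
by apply: val_inj; rewrite /= red_winv_l.
Qed.

Definition fgen (a : A) : fg := of_word [:: (a, true)].

Section Evaluation.
Variables (G : groupType) (f : A -> G).

Definition lev l : G := if l.2 then f l.1 else (f l.1)^-1.
Definition fev w : G := foldr (fun l g => lev l * g) 1 w.

Lemma lev_linv l : lev (linv l) = (lev l)^-1.
Proof. by case: l => a []; rewrite /lev /= ?invgK. Qed.

Lemma fev_cat u v : fev (u ++ v) = fev u * fev v.
Proof. by elim: u => [|l u /= ->]; rewrite ?mul1g ?mulgA. Qed.

Lemma fev_winv w : fev (winv w) = (fev w)^-1.
Proof.
elim: w => [|l w IH]; first by rewrite invg1.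
by rewrite winv_cons fev_cat /= mulg1 lev_linv IH invgM.
Qed.

Lemma fev_push l w : fev (push l w) = lev l * fev w.
Proof. by case: w => //= k w; case: eqP => //= ->; rewrite lev_linv mulVKg. Qed.

Lemma fev_red w : fev (red w) = fev w.
Proof. by elim: w => //= l w IH; rewrite fev_push IH. Qed.

(** Von Dyck's principle, the soundness half of both [free_eqP] and [miller_eqP]. *)
Lemma fev_pres_eq rel u v :
  (forall s t : word A, rel s t -> fev s = fev t) -> pres_eq rel u v -> fev u = fev v.
Proof.
move=> relP; elim=> {u v} // [u v w _ -> _ -> //|u v a b|u v s t /relP]; rewrite !fev_cat.
  by rewrite /= -[(a, ~~ b)]/(linv (a, b)) lev_linv mulg1 mulgV mul1g.
by move=> ->.
Qed.

Definition ext (u : fg) : G := fev u.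

Lemma ext_of_word w : ext (of_word w) = fev w.
Proof. exact: fev_red. Qed.

Lemma extM (u v : fg) : ext (u * v) = ext u * ext v.
Proof. by rewrite -{1}[u]of_wordK -{1}[v]of_wordK -of_word_cat ext_of_word fev_cat. Qed.

Lemma ext1 : ext 1 = 1.
Proof. by []. Qed.

Lemma extV (u : fg) : ext u^-1 = (ext u)^-1.
Proof. by apply: (mulIg (ext u)); rewrite -extM !mulVg. Qed.

Lemma extX (u : fg) n : ext (u ^+ n) = ext u ^+ n.
Proof. by elim: n => // n IH; rewrite !expgS extM IH. Qed.

Lemma ext_gen a : ext (fgen a) = f a.
Proof. by rewrite ext_of_word /= mulg1. Qed.

End Evaluation.

Lemma of_word_fev w : of_word w = fev fgen w.
Proof.
elim: w => // l w IH; rewrite -cat1s of_word_cat IH /=; congr (_ * _).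
by case: l => a []; rewrite /lev //= -of_word_winv.
Qed.

Lemma fg_ext_id (u : fg) : ext fgen u = u.
Proof. by rewrite /ext -of_word_fev of_wordK. Qed.

Lemma hom_ext (G : groupType) (h1 h2 : fg -> G) :
  {morph h1 : u v / u * v} -> {morph h2 : u v / u * v} ->
  (forall a, h1 (fgen a) = h2 (fgen a)) -> h1 =1 h2.
Proof.
move=> m1 m2 e.
have one (h : fg -> G) : {morph h : u v / u * v} -> h 1 = 1.
  by move=> m; apply: (mulgI (h 1)); rewrite -m !mulg1.
have inv (h : fg -> G) : {morph h : u v / u * v} -> forall u : fg, h u^-1 = (h u)^-1.
  by move=> m u; apply: (mulIg (h u)); rewrite -m !mulVg one.
move=> u; rewrite -[u]fg_ext_id /ext; elim: (fgw u) => [|[a b] w IH] /=.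
  by rewrite !one.
by rewrite m1 m2 IH; congr (_ * _); case: b; rewrite /lev /= ?inv ?e.
Qed.

Lemma pres_eq_push rel l w : pres_eq rel (l :: w) (push l w).
Proof.
case: w => [|k w] /=; first exact: PresRefl.
case: eqP => [->|_]; last exact: PresRefl.
by case: l => a b; apply: (PresCancel _ [::]).
Qed.

Lemma pres_eq_ctx rel p s u v : pres_eq rel u v -> pres_eq rel (p ++ u ++ s) (p ++ v ++ s).
Proof.
elim=> {u v} [u|u v _|u v w _ IH1 _|u v a b|u v s' t h]; first exact: PresRefl.
- exact: PresSym.
- exact: PresTrans.
- rewrite -!catA; rewrite !(catA p u).
  exact: (PresCancel rel (p ++ u) (v ++ s) a b).
- by rewrite -!catA !(catA p u); exact: PresRel.
Qed.

Lemma pres_eq_cat rel u u' v v' :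
  pres_eq rel u u' -> pres_eq rel v v' -> pres_eq rel (u ++ v) (u' ++ v').
Proof.
move=> hu hv; apply: PresTrans (pres_eq_ctx [::] v hu) _.
by have := pres_eq_ctx u' [::] hv; rewrite !cats0.
Qed.

Lemma pres_eq_red rel w : pres_eq rel w (red w).
Proof.
elim: w => [|l w IH] /=; first exact: PresRefl.
apply: PresTrans (pres_eq_push rel l _).
exact: (pres_eq_cat (PresRefl rel [:: l]) IH).
Qed.

Lemma pres_eq_of_word rel u v : of_word u = of_word v -> pres_eq rel u v.
Proof.
move=> /(congr1 fgw) /= e; apply: PresTrans (pres_eq_red rel u) _.
by rewrite e; apply: PresSym; exact: pres_eq_red.
Qed.

Lemma free_eqP u v : free_eq u v <-> of_word u = of_word v.
Proof.
split=> [|/pres_eq_of_word]; last exact.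
by rewrite !of_word_fev; apply: fev_pres_eq.
Qed.

End FreeGroup.

Arguments fgen {A}.

(** * Groups acting on trees, through length functions *)

Definition gdist (G : groupType) (len : G -> nat) (g h : G) := len (g^-1 * h).

(* [len g] is the distance in a tree from a base vertex to its image by g, for an
   action without inversions that respects a bipartition up to exchange:
   [tlen4] is 0-hyperbolicity, [tlenN] excludes inversions. *)
Record tree_length (G : groupType) (len : G -> nat) : Prop := TreeLength {
  tlen1 : len 1 = 0%N;
  tlenV : forall g, len g^-1 = len g;
  tlen4 : forall a b c d : G,
    gdist len a b + gdist len c d <=
    maxn (gdist len a c + gdist len b d) (gdist len a d + gdist len b c);
  tlen_odd : forall g h, odd (len (g * h)) = odd (len g) (+) odd (len h);
  tlenN : forall g, odd (len g) -> 1 < len (g * g)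
}.

(** * Weighted word lengths are tree lengths *)

Section WeightedLength.
Variables (A : choiceType) (wt : A -> nat).
Implicit Types (l : A * bool) (u v w : word A).

(** Weight one on all letters gives the distance in the Cayley tree; weight one on q alone gives the
    distance between cosets of F(X) in the tree of K. *)
Definition wlenw w := sumn [seq wt l.1 | l <- w].
Definition wlen (u : fg A) := wlenw u.

Lemma wlenw_cat u v : wlenw (u ++ v) = (wlenw u + wlenw v)%N.
Proof. by rewrite /wlenw map_cat sumn_cat. Qed.

Lemma wlenw_winv w : wlenw (winv w) = wlenw w.
Proof. by rewrite /wlenw /winv -map_comp map_rev sumn_rev. Qed.

Fixpoint lcp u v : word A :=
  match u, v with
  | l :: u', k :: v' => if l == k then l :: lcp u' v' else [::]
  | _, _ => [::]
  end.

(** The shorter of the common prefixes of u, v and of v, w is a prefix of all three words. This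
    ultrametric inequality is the four-point condition in terms of Gromov products. *)
Lemma wlenw_lcp_ultra u v w :
  minn (wlenw (lcp u v)) (wlenw (lcp v w)) <= wlenw (lcp u w).
Proof.
elim: u v w => [|l u IH] [|k v] [|m w] //=; rewrite ?minn0 ?min0n //.
case: eqP => [->|_]; last by rewrite min0n.
case: eqP => [->|_]; last by rewrite minn0.
by rewrite /wlenw /= -addn_minr leq_add2l IH.
Qed.

Lemma wlenw_lcpC u v : wlenw (lcp u v) = wlenw (lcp v u).
Proof.
elim: u v => [|l u IH] [|k v] //=; rewrite eq_sym; case: eqP => //= ->.
by congr (_ + _)%N; exact: IH.
Qed.

Lemma reduced_winv w : reduced w -> reduced (winv w).
Proof.
rewrite /reduced winvE map_rev rev_sorted sorted_map; apply: sub_sorted => l k /=.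
by rewrite linvK eq_sym.
Qed.

Lemma push_cons_size l w : reduced w -> (size (push l w) <= (size w).+1)%N.
Proof. by case: w => //= k w; case: eqP => //= _; lia. Qed.

(** Once the common prefix is cancelled the next letters differ and nothing more cancels; thus the
    weight of [lcp u v] is the Gromov product of u and v. *)
Lemma wlenw_push_lcp u v : reduced u -> reduced v ->
  (wlenw (red (winv u ++ v)) + (wlenw (lcp u v)).*2 = wlenw u + wlenw v)%N.
Proof.
elim: u v => [|l u IH] [|k v] ru rv.
- by [].
- by rewrite /= (push_red_cons (l := k)) ?red_id ?addn0 //; exact: reduced_cons rv.
- by rewrite cats0 /= red_id ?reduced_winv // wlenw_winv !addn0.
rewrite [lcp _ _]/=; case: eqP => [<-|ne].
  have -> : red (winv (l :: u) ++ l :: v) = red (winv u ++ v).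
    rewrite winv_cons -catA red_cat [RHS]red_cat; congr (foldr _ _ _).
    by rewrite /= -{2}(linvK l) pushK ?red_reduced.
  have {IH} := IH v (reduced_cons ru); rewrite -/(reduced v) => /(_ (reduced_cons rv)).
  by rewrite /wlenw /=; lia.
rewrite addn0 red_id ?wlenw_cat ?wlenw_winv //.
have := reduced_winv ru; rewrite winv_cons /reduced.
have rv' : path (fun l' k' => k' != linv l') (linv l) (k :: v).
  by rewrite /= linvK; apply/andP; split=> //; apply/eqP => e; apply: ne.
by rewrite -catA; case: (winv u) => // m t; rewrite /= !cat_path /= => /andP[-> /andP[-> _]].
Qed.

Fixpoint wsum b w : nat := if w is l :: w' then ((l.2 == b) * wt l.1 + wsum b w')%N else 0%N.

Lemma wlenw_wsum w : wlenw w = (wsum true w + wsum false w)%N.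
Proof. by elim: w => //= -[a []] w; rewrite /wlenw /= => ->; lia. Qed.

Lemma wsum_cat b u v : wsum b (u ++ v) = (wsum b u + wsum b v)%N.
Proof. by elim: u => //= l u ->; lia. Qed.

(** A cancellation removes equal weights of both signs, so the signed weight is a homomorphism to
    the integers. It yields the parity axiom, and excludes inversions because an odd value is
    nonzero and doubles on squares. *)
Lemma wsum_red w :
  (wsum true (red w) + wsum false w = wsum true w + wsum false (red w))%N.
Proof.
elim: w => //= l w; case: (red w) => [|k t] /=; first by lia.
case: (k =P linv l) => [->|_] /=; case: l => a [] /=; try (case: k => c [] /=); lia.
Qed.

Lemma gdist_lcp (u v : fg A) :
  (gdist wlen u v + (wlenw (lcp u v)).*2 = wlen u + wlen v)%N.
Proof.
rewrite /gdist -{1}[v]of_wordK -{1}[u]of_wordK -of_word_winv -of_word_cat.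
by rewrite /wlen /= wlenw_push_lcp ?fgP.
Qed.

Lemma wlen_odd (u v : fg A) : odd (wlen (u * v)) = odd (wlen u) (+) odd (wlen v).
Proof.
rewrite -{1}[u]of_wordK -{1}[v]of_wordK -of_word_cat /wlen /=.
have := wsum_red (u ++ v); rewrite !wlenw_wsum !wsum_cat; lia.
Qed.

Lemma tree_length_wlen : tree_length wlen.
Proof.
split=> //.
- by move=> u; rewrite /wlen -{1}[u]of_wordK -of_word_winv /= red_id ?wlenw_winv ?reduced_winv ?fgP.
- move=> a b c d.
  have := (gdist_lcp a b, gdist_lcp c d, gdist_lcp a c, gdist_lcp b d, gdist_lcp a d,
    gdist_lcp b c).
  have U x y z : minn (wlenw (lcp x y)) (wlenw (lcp z y)) <= wlenw (lcp x z).
    by rewrite (wlenw_lcpC z); exact: wlenw_lcp_ultra.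
  have := (U a b c, U a b d, U a c d, U b c d).
  have := (U a c b, U a d b, U a d c, U b d c).
  have := (U b a c, U b a d, U c a d, U c b d).
  rewrite (wlenw_lcpC b a) (wlenw_lcpC c a) (wlenw_lcpC d a) (wlenw_lcpC c b).
  rewrite (wlenw_lcpC d b) (wlenw_lcpC d c).
  move: (wlenw (lcp a b)) (wlenw (lcp c d)) (wlenw (lcp a c)) (wlenw (lcp b d)).
  move: (wlenw (lcp a d)) (wlenw (lcp b c)) => x1 x2 x3 x4 x5 x6.
  by do 3 (move=> [[[? ?] ?] ?]); move=> [[[[[? ?] ?] ?] ?] ?]; lia.
- exact: wlen_odd.
- move=> u; have -> : u * u = of_word (u ++ u) by rewrite of_word_cat of_wordK.
  rewrite /wlen /=.
  have := wsum_red (u ++ u); rewrite !wlenw_wsum !wsum_cat; lia.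
Qed.

End WeightedLength.

Section TreeLength.
Variables (G : groupType) (len : G -> nat).
Hypothesis lenP : tree_length len.
Implicit Types (g h u v p s t x y : G).

Local Notation d := (gdist len).

Lemma gdistC g h : d g h = d h g.
Proof. by rewrite /gdist -(tlenV lenP) invgM invgK. Qed.

Lemma gdist1 g : d 1 g = len g.
Proof. by rewrite /gdist invg1 mul1g. Qed.

Lemma gdist_1 g : d g 1 = len g.
Proof. by rewrite gdistC gdist1. Qed.

(** In a tree the two largest of these three sums coincide. The geometric arguments below apply this
    to well-chosen points and conclude by arithmetic. *)
Lemma four_point a b c e :
  [/\ d a b + d c e <= maxn (d a c + d b e) (d a e + d b c),
      d a c + d b e <= maxn (d a b + d c e) (d a e + d b c) &
      d a e + d b c <= maxn (d a b + d c e) (d a c + d b e)].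
Proof.
split; first exact: (tlen4 lenP).
  by have := tlen4 lenP a c b e; rewrite (gdistC c b).
by have := tlen4 lenP a e b c; rewrite (gdistC e c) (gdistC e b) maxnC.
Qed.

Lemma gdist_triangle a b c : d a c <= d a b + d b c.
Proof.
by have := tlen4 lenP a c b b; rewrite {2}/gdist mulVg (tlen1 lenP) (gdistC c b); lia.
Qed.

Lemma lenM g h : len (g * h) <= len g + len h.
Proof. by have := gdist_triangle g^-1 1 h; rewrite /gdist; gsimp. Qed.

Lemma lenM3 g h u : len (g * h * u) <= len g + len h + len u.
Proof. by apply: leq_trans (lenM _ _) _; rewrite leq_add2r lenM. Qed.

Lemma lenX g n : len (g ^+ n) <= n * len g.
Proof.
elim: n => [|n IH]; first by rewrite expg0 (tlen1 lenP).
by rewrite expgS mulSn; apply: leq_trans (lenM _ _) _; rewrite leq_add2l.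
Qed.

(** The segments from 1 to u and to u^-1 meet only at 1: the base vertex is on the axis of u, or is
    fixed by u. *)
Definition cyc_len u := len (u * u) = (len u).*2.

(** The translates of the segment from 1 to u by powers of u form a local geodesic, which in a tree
    is a geodesic. *)
Lemma cyc_lenX u n : cyc_len u -> len (u ^+ n) = (n * len u)%N.
Proof.
rewrite /cyc_len => cu.
have [-> // |n0] := posnP n; first by rewrite expg0 (tlen1 lenP).
elim/ltn_ind: n n0 => -[//|[|[|n]]] IH _; first by rewrite expg1 mul1n.
  by rewrite expg2 cu; lia.
have [w ew] : exists w, w = u ^+ n.+1 by eexists.
have e1 : len w = (n.+1 * len u)%N by rewrite ew IH.
have e2 : len (u * w) = (n.+2 * len u)%N by rewrite ew -expgS IH.
have uw : u * w = w * u by rewrite ew -expgS -expgSr.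
have -> : u ^+ n.+3 = u * w * u by rewrite ew -expgS -expgSr.
have := four_point 1 (u * w * u) u (u * w).
have -> : d 1 (u * w * u) = len (u * w * u) by rewrite gdist1.
have -> : d u (u * w) = len w by rewrite /gdist mulKg.
have -> : d 1 u = len u by rewrite gdist1.
have -> : d (u * w * u) (u * w) = len u by rewrite gdistC /gdist mulKg.
have -> : d 1 (u * w) = len (u * w) by rewrite gdist1.
have -> : d (u * w * u) u = len (u * w) by rewrite gdistC /gdist -mulgA mulKg uw.
by rewrite e1 e2; case; lia.
Qed.


Lemma conj_expg g u n : (g * u * g^-1) ^+ n = g * u ^+ n * g^-1.
Proof.
elim: n => [|n IH]; first by rewrite !expg0 mulg1 mulgV.
by rewrite !expgS IH; gsimp.
Qed.

(** The lengths of the powers grow linearly with slope the translation length, and conjugation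
    changes them only by a constant. *)
Lemma cyc_len_conj g u : cyc_len u -> cyc_len (g * u * g^-1) -> len (g * u * g^-1) = len u.
Proof.
move=> cu cv.
have bound h x : cyc_len x -> cyc_len (h * x * h^-1) -> len x <= len (h * x * h^-1).
  move=> cx cy; rewrite leqNgt; apply/negP => lt.
  (* The conjugation by h costs at most [2 * len h], which a gap of one per power overtakes at this
     exponent. *)
  pose n := (len h).*2.+1.
  have : len (x ^+ n) <= len h + len ((h * x * h^-1) ^+ n) + len h.
    rewrite conj_expg; have {1}-> : x ^+ n = h^-1 * (h * x ^+ n * h^-1) * h by gsimp.
    apply: leq_trans (lenM _ _) _; rewrite leq_add2r.
    by apply: leq_trans (lenM _ _) _; rewrite (tlenV lenP).
  rewrite !cyc_lenX // /n; move: lt; set p := len x; set q := len _ => lt.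
  have : n * q.+1 <= n * p by rewrite leq_mul2l lt orbT.
  by rewrite /n; nia.
apply/eqP; rewrite eqn_leq bound // andbT.
have := bound g^-1 (g * u * g^-1) cv; rewrite invgK.
have -> : g^-1 * (g * u * g^-1) * g = u by gsimp.
exact.
Qed.

(** The inequality on [len (u * u)] says that the segments from 1 to u and to u^-1 share at least
    their first [len p] edges. The vertex p lies on this common part, so u displaces it by
    [2 * len p] less than the base vertex. *)
Lemma conj_midpoint u p :
  (len p + len (p^-1 * u) = len u)%N -> len (u * u) + (len p).*2 <= (len u).*2 ->
  (len p).*2 <= len u ->
  len (p^-1 * u * p) = (len u - (len p).*2)%N /\ len (u * p) = (len u - len p)%N.
Proof.
move=> pu cp pu2.
have e1 : d p u = (len u - len p)%N by rewrite /gdist; lia.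
have e2 : d u (u * p) = len p by rewrite /gdist mulKg.
have e3 : d u^-1 u = len (u * u) by rewrite /gdist invgK.
have e4 : d u^-1 p = len (u * p) by rewrite /gdist invgK.
have e5 : d p (u * p) = len (p^-1 * u * p) by rewrite /gdist mulgA.
have e6 : len (u * p) = (len u - len p)%N.
  have [] := four_point 1 u^-1 p u.
  have := gdist_triangle u^-1 p u; have := gdist_triangle 1 (u * p) u.
  by rewrite !gdist1 (tlenV lenP u) (gdistC (u * p)) e1 e2 e3 e4; lia.
split=> //.
have [] := four_point 1 u p (u * p).
by rewrite !gdist1 (gdistC u p) e1 e2 e5 e6; lia.
Qed.

Lemma conj_midpoint_cyc u p :
  (len p + len (p^-1 * u) = len u)%N -> (len (u * u) + (len p).*2 = (len u).*2)%N ->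
  (len p).*2 <= len u -> cyc_len (p^-1 * u * p).
Proof.
move=> pu cp pu2; have [|l1 _] := conj_midpoint pu _ pu2; first by rewrite cp.
rewrite /cyc_len; apply/eqP; rewrite eqn_leq; apply/andP; split.
  by have := lenM (p^-1 * u * p) (p^-1 * u * p); rewrite addnn.
have -> : p^-1 * u * p * (p^-1 * u * p) = p^-1 * (u * u) * p by gsimp.
have : len (u * u) <= len p + len (p^-1 * (u * u) * p) + len p.
  have {1}-> : u * u = p * (p^-1 * (u * u) * p) * p^-1 by gsimp.
  apply: leq_trans (lenM _ _) _; rewrite (tlenV lenP) leq_add2r; exact: lenM.
by rewrite l1; lia.
Qed.

(** The midpoint of the segment from 1 to u is fixed by u. For odd length it would be the middle of
    an edge, which u would invert, against [tlenN]. The hypothesis supplies the vertices of the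
    segment as points of the orbit, and [good] records how they arise. *)
Lemma elliptic_midpoint (good : G -> Prop) u :
  (forall i, i <= len u -> exists2 p, good p &
     len p = i /\ (len p + len (p^-1 * u) = len u)%N) ->
  len (u * u) <= len u -> exists2 p, good p & len (p^-1 * u * p) = 0%N.
Proof.
move=> pre cu.
have [|p gp [pi pu]] := pre (len u)./2; first by rewrite -divn2 leq_div.
exists p => //; have eu := odd_double_half (len u).
have pu2 : (len p).*2 <= len u by rewrite pi; lia.
have [|l1 l2] := conj_midpoint pu _ pu2; first by lia.
case odu: (odd (len u)) eu => /= eu; last by rewrite l1 pi; lia.
set v := p^-1 * u * p; have lv : len v = 1%N by rewrite /v l1 pi; lia.
have := tlenN lenP (g := v); rewrite lv => /(_ isT).
have -> : len (v * v) = d (u^-1 * p) (u * p) by rewrite /v /gdist; gsimp.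
have lup : len (p^-1 * u) = (len u)./2.+1 by lia.
have f1 : d u^-1 u = len (u * u) by rewrite /gdist invgK.
have f2 : d 1 u^-1 = len u by rewrite gdist1 (tlenV lenP).
have f3 : d 1 (u^-1 * p) = (len u)./2.+1.
  by rewrite gdist1 -(tlenV lenP) invgM invgK.
have f4 : d u^-1 (u^-1 * p) = (len u)./2 by rewrite /gdist mulKg.
have f5 : d 1 (u * p) = (len u)./2.+1 by rewrite gdist1 l2; lia.
have f6 : d u (u * p) = (len u)./2 by rewrite /gdist mulKg.
have [] := four_point 1 (u^-1 * p) u^-1 u; have [] := four_point 1 (u^-1 * p) u (u * p).
rewrite (gdistC (u^-1 * p) u^-1) (gdistC (u^-1 * p) u) f1 f2 f3 f4 f5 f6 gdist1.
lia.
Qed.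

Lemma cyc_reduction (good : G -> Prop) u :
  (forall i, i <= len u -> exists2 p, good p &
     len p = i /\ (len p + len (p^-1 * u) = len u)%N) ->
  exists2 p, good p & cyc_len (p^-1 * u * p).
Proof.
move=> pre; have [cu|cu] := leqP (len (u * u)) (len u).
  have [p gp l] := elliptic_midpoint pre cu; exists p => //.
  by have := lenM (p^-1 * u * p) (p^-1 * u * p); rewrite /cyc_len l; lia.
have ev : odd (len (u * u)) = false by rewrite (tlen_odd lenP) addbb.
have uu := lenM u u; have eu := odd_double_half (len (u * u)); rewrite ev in eu.
(* This depth is the Gromov product of u and u^-1, that is, the distance from the base vertex to the
   axis. *)
have [|p gp [pi pu]] := pre (len u - (len (u * u))./2)%N; first exact: leq_subr.
by exists p => //; apply: conj_midpoint_cyc; lia.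
Qed.

(** Among t^-1, 1 and t, the vertex nearest to s^-1 is 1, so the projections of 1 and s^-1 to the
    axis of t are at most half a period apart, and the displacements of both vertices by t bound
    their distance. The second alternative is the case where t has no axis. *)
Lemma short_conjugator s t :
  len s <= len (s * t) -> len s <= len (s * t^-1) ->
  (len s).*2 <= len t + len (s * t * s^-1) \/ len (t * t) <= len t.
Proof.
move=> h1 h2.
have f1 : d 1 s^-1 = len s by rewrite gdist1 (tlenV lenP).
have f2 : d t s^-1 = len (s * t) by rewrite gdistC /gdist invgK.
have f3 : d t^-1 s^-1 = len (s * t^-1) by rewrite gdistC /gdist invgK.
have f4 : d 1 (t * s^-1) = len (s * t^-1) by rewrite gdist1 -(tlenV lenP); gsimp.
have f5 : d t (t * s^-1) = len s by rewrite /gdist mulKg (tlenV lenP).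
have f6 : d s^-1 (t * s^-1) = len (s * t * s^-1) by rewrite /gdist; gsimp.
have f7 : d t^-1 t = len (t * t) by rewrite /gdist invgK.
have f8 : d 1 t^-1 = len t by rewrite gdist1 (tlenV lenP).
have [] := four_point 1 t s^-1 (t * s^-1); have [] := four_point 1 t^-1 t s^-1.
by rewrite f1 f2 f3 f4 f5 f6 f7 f8 gdist1; lia.
Qed.

(** The points [a^-k] and [g b^-k] move along two axes; their distance is convex in k. *)
Lemma gdist_convex a b g : cyc_len a -> cyc_len b ->
  (len g).*2 <= len (a * g * b^-1) + len (a^-1 * g * b).
Proof.
move=> ca cb.
have grow x h : cyc_len x -> len h + len x <= maxn (len (x * h)) (len (x^-1 * h)).
  move=> cx; have [+ _ _] := four_point h 1 x x^-1.
  have -> : d x x^-1 = (len x).*2 by rewrite gdistC /gdist invgK.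
  rewrite gdist_1 !gdist1 (tlenV lenP) !(gdistC h) /gdist invgK.
  by move: (len (x * h)) (len (x^-1 * h)) (len x) (len h) => *; lia.
have h1 := grow _ g ca.
have grow' h : len h + len b <= maxn (len (h * b)) (len (h * b^-1)).
  have := grow b h^-1 cb; rewrite -(tlenV lenP (b * _)) -(tlenV lenP (b^-1 * _)).
  by rewrite (tlenV lenP) !invgM !invgK maxnC.
have := grow' (a * g); have := grow' (a^-1 * g).
have t1 : len (a * g * b) <= len a + len a + len (a^-1 * g * b).
  have -> : a * g * b = a * a * (a^-1 * g * b) by gsimp.
  by apply: leq_trans (lenM _ _) _; rewrite leq_add2r; exact: lenM.
have t2 : len (a * g * b) <= len (a * g * b^-1) + (len b + len b).
  have -> : a * g * b = (a * g * b^-1) * (b * b) by gsimp.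
  by apply: leq_trans (lenM _ _) _; rewrite leq_add2l; exact: lenM.
have t3 : len (a^-1 * g * b^-1) <= len (a^-1 * g * b) + (len b + len b).
  have -> : a^-1 * g * b^-1 = (a^-1 * g * b) * (b^-1 * b^-1) by gsimp.
  apply: leq_trans (lenM _ _) _; rewrite leq_add2l -{1 2}(tlenV lenP b); exact: lenM.
have t4 : len (a^-1 * g * b^-1) <= len a + len a + len (a * g * b^-1).
  have -> : a^-1 * g * b^-1 = a^-1 * a^-1 * (a * g * b^-1) by gsimp.
  apply: leq_trans (lenM _ _) _; rewrite leq_add2r -{1 2}(tlenV lenP a); exact: lenM.
have t5 : len (a * g * b^-1) <= len (a^-1 * g * b^-1) + (len a + len a).
  have -> : a * g * b^-1 = a * a * (a^-1 * g * b^-1) by gsimp.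
  by rewrite addnC; apply: leq_trans (lenM _ _) _; rewrite leq_add2r; exact: lenM.
have t6 : len (a^-1 * g * b) <= len (a * g * b) + (len a + len a).
  have -> : a^-1 * g * b = a^-1 * a^-1 * (a * g * b) by gsimp.
  rewrite addnC; apply: leq_trans (lenM _ _) _; rewrite leq_add2r -{1 2}(tlenV lenP a).
  exact: lenM.
move: h1 t1 t2 t3 t4 t5 t6.
move: (len (a * g * b)) (len (a * g * b^-1)) (len (a^-1 * g * b)) (len (a^-1 * g * b^-1)).
by move: (len (a * g)) (len (a^-1 * g)) (len a) (len b) (len g) => *; lia.
Qed.

(** The first step x from 1 towards w leads away from g^-1, so the path from g^-1 through 1 to w
    does not backtrack. *)
Lemma no_cancel g x w :
  len x = 1%N -> (len (x^-1 * w)).+1 = len w -> len (g * x) = (len g).+1 ->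
  len (g * w) = (len g + len w)%N.
Proof.
move=> x1 xw gx.
have f1 : d g^-1 x = len (g * x) by rewrite /gdist invgK.
have f2 : d g^-1 w = len (g * w) by rewrite /gdist invgK.
have f3 : d g^-1 1 = len g by rewrite gdist_1 (tlenV lenP).
have f4 : d x w = len (x^-1 * w) by [].
have [] := four_point g^-1 x 1 w.
by rewrite f1 f2 f3 f4 !gdist1 (gdistC x 1) gdist1; lia.
Qed.

End TreeLength.

(** After one strict increase a convex sequence keeps increasing up to the end. *)
Lemma convex_bound (f : nat -> nat) m k :
  (forall i, (f i.+1).*2 <= f i + f i.+2) -> k <= m -> f k <= maxn (f 0%N) (f m).
Proof.
move=> cf km; rewrite leq_max; case: leqP => //= lt0.
have up i j : f i < f i.+1 -> f (i + j)%N < f (i + j).+1.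
  by move=> lt; elim: j => [|j IH]; rewrite ?addn0 // addnS; have := cf (i + j)%N; lia.
have [i ik lti] : exists2 i, i < k & f i < f i.+1.
  elim: k lt0 {km} => [|k IH lt]; first by rewrite ltnn.
  have [lk|lk] := ltnP (f 0%N) (f k); last by exists k => //; lia.
  by have [i ik lti] := IH lk; exists i => //; lia.
rewrite -(subnKC km); elim: (m - k) => [|j IH]; first by rewrite addn0.
by rewrite addnS; apply: leq_trans IH _; have := up i (k - i + j)%N lti;
  rewrite addnA subnKC ?(ltnW ik) //; lia.
Qed.

Definition prodl (G : groupType) (s : seq G) : G := foldr (fun x y => x * y) 1 s.

Lemma prodl_cat (G : groupType) (s t : seq G) : prodl (s ++ t) = prodl s * prodl t.
Proof. by elim: s => [|x s IH] /=; rewrite ?mul1g // IH mulgA. Qed.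

Lemma prodl_rot (G : groupType) j (s : seq G) :
  prodl (rot j s) = (prodl (take j s))^-1 * prodl s * prodl (take j s).
Proof. by rewrite -{3}(cat_take_drop j s) /rot !prodl_cat; gsimp. Qed.

(** * Products of unit steps along an axis *)

Section TightProducts.
Variables (G : groupType) (len : G -> nat).
Hypothesis lenP : tree_length len.
Implicit Types (g h u v p x y : G) (gs : seq G).

(** Conjugators of length at most [len a] and [len b] put the base vertex on both axes, where
    [gdist_convex] makes the length convex in the exponent. This change of base vertex is paid once
    at k and once at an endpoint. *)
Lemma pow_conj_bound a b w m k :
  (forall u i, i <= len u -> exists2 p, len p <= len u &
     len p = i /\ (len p + len (p^-1 * u) = len u)%N) ->
  k <= m ->
  len (a ^+ k * w * b ^- k) <=
    maxn (len w) (len (a ^+ m * w * b ^- m)) + (len a + len b).*2.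
Proof.
move=> pre km.
have [p lp ca] := cyc_reduction lenP (pre a); have [q lq cb] := cyc_reduction lenP (pre b).
set a0 := p^-1 * a * p in ca; set b0 := q^-1 * b * q in cb.
have ea j : a ^+ j = p * a0 ^+ j * p^-1 by rewrite -conj_expg /a0; gsimp.
have eb j : b ^+ j = q * b0 ^+ j * q^-1 by rewrite -conj_expg /b0; gsimp.
pose f j := len (a0 ^+ j * (p^-1 * w * q) * b0 ^- j).
have cf j : (f j.+1).*2 <= f j + f j.+2.
  have := gdist_convex lenP (a0 ^+ j.+1 * (p^-1 * w * q) * b0 ^- j.+1) ca cb.
  set g := p^-1 * w * q; rewrite /f -/g.
  have -> : a0 * (a0 ^+ j.+1 * g * b0 ^- j.+1) * b0^-1 = a0 ^+ j.+2 * g * b0 ^- j.+2.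
    by rewrite (expgS a0 j.+1) (expgS b0 j.+1); gsimp.
  have -> : a0^-1 * (a0 ^+ j.+1 * g * b0 ^- j.+1) * b0 = a0 ^+ j * g * b0 ^- j.
    by rewrite (expgS a0 j) (expgS b0 j); gsimp.
  by rewrite addnC.
have eq1 j : a ^+ j * w * b ^- j = p * (a0 ^+ j * (p^-1 * w * q) * b0 ^- j) * q^-1.
  by rewrite ea eb; gsimp.
have eq2 j : a0 ^+ j * (p^-1 * w * q) * b0 ^- j = p^-1 * (a ^+ j * w * b ^- j) * q.
  by rewrite eq1; gsimp.
have up j : len (a ^+ j * w * b ^- j) <= f j + len a + len b.
  by rewrite eq1; apply: leq_trans (lenM3 lenP _ _ _) _; rewrite (tlenV lenP) -/(f j); lia.
have dn j : f j <= len (a ^+ j * w * b ^- j) + len a + len b.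
  by rewrite /f eq2; apply: leq_trans (lenM3 lenP _ _ _) _; rewrite (tlenV lenP); lia.
have := convex_bound cf km; have := up k; have := dn m; have := dn 0%N.
by rewrite !expg0 invg1 mul1g mulg1; lia.
Qed.

(** The partial products are consecutive vertices on the axis of the product; a rotation moves the
    base vertex along this axis. *)
Definition tight gs := all (fun x => len x == 1%N) gs /\ cyc_len len (prodl gs) /\
  len (prodl gs) = size gs.

Lemma tight_prefix_len gs : all (fun x => len x == 1%N) gs -> len (prodl gs) <= size gs.
Proof.
elim: gs => [|x gs IH] /=; first by rewrite (tlen1 lenP).
case/andP=> /eqP l1 /IH le; apply: leq_trans (lenM lenP _ _) _; lia.
Qed.

Lemma tight_rot1 gs : tight gs -> tight (rot 1 gs).
Proof.
case: gs => // x gs [/= /andP[x1 all1] [cyc lgs]].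
rewrite /tight rot1_cons -cats1 all_cat all1 /= x1 prodl_cat /= mulg1 size_cat addn1.
split=> //; have lx : len x = 1%N by apply/eqP.
set w := prodl gs in cyc lgs *; have lw : len w <= size gs by apply: tight_prefix_len.
(* The cube of [x * w] is the square of [w * x] with x in front and w behind; its known length
   forces this square to have full length. *)
have e2 : len (w * x * (w * x) ) = (size gs).+1.*2.
  have := cyc_lenX lenP 3 cyc; rewrite lgs /=.
  have -> : (x * w) ^+ 3 = x * (w * x * (w * x)) * w.
    by rewrite !expgS expg0; gsimp.
  have := lenM lenP (x * (w * x * (w * x))) w; have := lenM lenP x (w * x * (w * x)).
  have := lenM lenP (w * x) (w * x); have := lenM lenP w x; lia.
have := lenM lenP (w * x) (w * x); have := lenM lenP w x; rewrite /cyc_len; lia.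
Qed.

Lemma tight_rot j gs : tight gs -> tight (rot j gs).
Proof.
move=> tg; have [le|lt] := leqP j (size gs); last by rewrite rot_oversize // ltnW.
elim: j le => [|j IH] lt; first by rewrite rot0.
rewrite -add1n rotD; last by lia.
exact/tight_rot1/IH/ltnW.
Qed.

Lemma tight_head gs x t : tight gs -> gs = x :: t -> (len (x^-1 * prodl gs)).+1 = len (prodl gs).
Proof.
move=> [al [_ l]] e; move: al l; rewrite e /= => /andP[/eqP x1 al] l.
have := tight_prefix_len al; have := lenM lenP x (prodl t).
by rewrite mulKg l; lia.
Qed.

Lemma tight_last gs x t :
  tight gs -> gs = rcons t x -> (len (prodl gs * x^-1)).+1 = len (prodl gs).
Proof.
move=> [al [_ l]] e; move: al l; rewrite e all_rcons /= -cats1 prodl_cat /= mulg1 size_cat.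
case/andP=> /eqP x1 al l; have := tight_prefix_len al; have := lenM lenP (prodl t) x.
by rewrite mulgK l /=; lia.
Qed.

(** A conjugator of a tight product, not fixing the base vertex, moves toward the
    axis: its last edge can be absorbed by a rotation. *)
Lemma collins gs g : gs != [::] -> tight gs -> cyc_len len (g * prodl gs * g^-1) ->
  exists j h, [/\ j <= size gs, len h = 0%N & g * prodl gs * g^-1 = h * prodl (rot j gs) * h^-1].
Proof.
move=> + tg cv; have [n] := ubnP (len g); elim: n => // n IH in g gs tg cv *.
move=> lg gs0; have [g0|g0] := posnP (len g).
  by exists 0%N, g; rewrite rot0.
case/lastP E: gs => [|t y] // in gs0.
have rr j : j <= size gs -> forall i, i <= size gs -> exists2 k, k <= size gs & rot i (rot j gs) =
  rot k gs.
  move=> js i is_; rewrite (rot_add_mod js is_).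
  by exists (if i + j <= size gs then i + j else i + j - size gs)%N => //; case: ifP; lia.
have step j x : j <= size gs -> len (g * x) < len g ->
    prodl (rot j gs) = x^-1 * prodl gs * x ->
    exists k h, [/\ k <= size gs, len h = 0%N &
      g * prodl gs * g^-1 = h * prodl (rot k gs) * h^-1].
  move=> js lt e.
  have ee : g * prodl gs * g^-1 = (g * x) * prodl (rot j gs) * (g * x)^-1.
    by rewrite e; gsimp.
  have [||||i [h [iS lh eh]]] := IH (g * x) (rot j gs).
  - exact: tight_rot.
  - by rewrite -ee.
  - by lia.
  - by rewrite -size_eq0 size_rot E size_rcons.
  rewrite size_rot in iS; have [k kS ek] := rr j js i iS.
  by exists k, h; rewrite ee eh ek.
have [x [t' E0]] : exists x, exists t', gs = x :: t'.
  by rewrite E; case: (t) => [|x t']; [exists y, [::] | exists x, (rcons t' y)].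
have allP z : z \in gs -> len z = 1%N by case: tg => al _ /(allP al)/eqP.
have x1 : len x = 1%N by apply: allP; rewrite E0 mem_head.
have y1 : len y = 1%N by apply: allP; rewrite E mem_rcons mem_head.
(* If the first factor, or the inverse of the last one, shortens g, the rotation by one step in that
   direction has a shorter conjugator. *)
have [lt|ge1] := ltnP (len (g * x)) (len g).
  apply: (step 1%N x) => //; first by rewrite E0.
  by rewrite prodl_rot E0 /= take0 /= mulg1.
have [lt|ge2] := ltnP (len (g * y^-1)) (len g).
  apply: (step (size gs).-1 y^-1) => //; first exact: leq_pred.
  rewrite prodl_rot E size_rcons /= -cats1 take_size_cat // prodl_cat /= mulg1.
  by rewrite invgK; gsimp.
(* By parity, a unit step that does not shorten g lengthens it by exactly one. *)
have odd1 z : len z = 1%N -> len g <= len (g * z) -> len (g * z) = (len g).+1.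
  move=> z1 ge; have := lenM lenP g z; have := tlen_odd lenP g z; rewrite z1 /=.
  lia.
have y1' : len y^-1 = 1%N by rewrite (tlenV lenP).
have two w : (len (x^-1 * w)).+1 = len w -> (len (w * y^-1)).+1 = len w -> 0 < len w ->
   len (g * w * g^-1) = ((len g).*2 + len w)%N.
  move=> hx hy h3.
  have h1 := no_cancel lenP x1 hx (odd1 _ x1 ge1).
  have h2 : len (g * w^-1) = (len g + len w)%N.
    rewrite -(tlenV lenP w); apply: (no_cancel lenP y1') (odd1 _ y1' ge2).
    by rewrite invgK -(tlenV lenP (y * _)) invgM invgK (tlenV lenP).
  have [] := four_point lenP g^-1 (w * g^-1) w 1.
  have -> : gdist len g^-1 (w * g^-1) = len (g * w * g^-1) by rewrite /gdist; gsimp.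
  have -> : gdist len g^-1 w = len (g * w) by rewrite /gdist invgK.
  have -> : gdist len (w * g^-1) 1 = len (g * w^-1).
    by rewrite (gdist_1 lenP) -(tlenV lenP); gsimp.
  have -> : gdist len g^-1 1 = len g by rewrite (gdist_1 lenP) (tlenV lenP).
  have -> : gdist len (w * g^-1) w = len g.
    by rewrite /gdist; gsimp.
  by rewrite (gdist_1 lenP) h1 h2; lia.
have lx := tight_head tg E0; have ly := tight_last tg E.
have n0 : 0 < len (prodl gs) by case: tg => _ [_ ->]; rewrite E size_rcons.
have cu : cyc_len len (prodl gs) by case: tg => _ [].
have v1 := two _ lx ly n0.
(* With no cancellation at either end, conjugation adds [2 * len g] to the length of the product and
   also to that of its square, whereas [cyc_len] of the conjugate would make the second length twice
   the first. *)
have v2 : len (g * (prodl gs * prodl gs) * g^-1) = ((len g).*2 + (len (prodl gs)).*2)%N.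
  rewrite -[in RHS]cu; apply: two; rewrite cu; last by lia.
  - have a1 : len (x^-1 * (prodl gs * prodl gs)) <= len (x^-1 * prodl gs) + len (prodl gs).
      by rewrite mulgA; exact: lenM.
    have a2 : len (prodl gs * prodl gs) <= len x + len (x^-1 * (prodl gs * prodl gs)).
      by rewrite -{1}(mulVKg x (prodl gs * prodl gs)); exact: lenM.
    by rewrite cu in a2; lia.
  - have a1 : len (prodl gs * prodl gs * y^-1) <= len (prodl gs) + len (prodl gs * y^-1).
      by rewrite -mulgA; exact: lenM.
    have a2 : len (prodl gs * prodl gs) <= len (prodl gs * prodl gs * y^-1) + len y.
      by rewrite -{1}(mulgVK y (prodl gs * prodl gs)); exact: lenM.
    move: a1 a2 ly; rewrite cu y1.
    by move: (len (prodl gs * prodl gs * y^-1)) (len (prodl gs * y^-1)) (len (prodl gs)) => *; lia.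
move: cv; rewrite /cyc_len v1.
have -> : g * prodl gs * g^-1 * (g * prodl gs * g^-1) = g * (prodl gs * prodl gs) * g^-1.
  by gsimp.
by rewrite v2; lia.
Qed.

End TightProducts.

Lemma wsum_fgM (A : choiceType) (wt : A -> nat) (u v : fg A) :
  (wsum wt true (fgw (u * v)%g) + (wsum wt false u + wsum wt false v) =
   wsum wt true u + wsum wt true v + wsum wt false (fgw (u * v)%g))%N.
Proof. by have := wsum_red wt (u ++ v); rewrite !wsum_cat. Qed.

(** * The free product of F(X) and an infinite cyclic group *)

Section Blocks.
Variable X : choiceType.
Implicit Types (w : fg X) (e : bool) (bs : seq (bool * fg X)).

Notation K := (fg (option X)).

Definition sword (w : word X) : word (option X) := [seq (Some l.1, l.2) | l <- w].

Lemma sword_inj : injective sword.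
Proof. by apply: inj_map => -[a b] [c d] [-> ->]. Qed.

Lemma reduced_sword (w : word X) : reduced w -> reduced (sword w).
Proof.
rewrite /reduced sorted_map; apply: sub_sorted => -[a b] [c d] /=.
by rewrite /linv /= !xpair_eqE (inj_eq Some_inj).
Qed.

Definition iX : fg X -> K := ext (fun x => fgen (Some x)).

Lemma iX_of_word (u : word X) : iX (of_word u) = of_word (sword u).
Proof.
rewrite /iX ext_of_word of_word_fev; elim: u => //= -[a b] u ->.
by case: b.
Qed.

Lemma fgw_iX w : fgw (iX w) = sword w.
Proof. by rewrite -{1}[w]of_wordK iX_of_word /= red_id // reduced_sword ?fgP. Qed.

Lemma iX_inj : injective iX.
Proof. by move=> u v /(congr1 (@fgw _)); rewrite !fgw_iX => /sword_inj e; apply: val_inj. Qed.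

Lemma iXM : {morph iX : u v / u * v}.
Proof. exact: extM. Qed.
Lemma iX1 : iX 1 = 1. Proof. exact: ext1. Qed.
Lemma iXV w : iX w^-1 = (iX w)^-1. Proof. exact: extV. Qed.
Definition qe e : K := lev fgen (None, e).

Lemma qeN e : qe (~~ e) = (qe e)^-1.
Proof. exact: (lev_linv fgen (None, e)). Qed.

Lemma qe_of_word e : qe e = of_word [:: (None, e)].
Proof. by rewrite of_word_fev /= mulg1. Qed.

Definition wtq (o : option X) : nat := o == None.
Definition qlen : K -> nat := wlen wtq.

Lemma qlenP : tree_length qlen. Proof. exact: tree_length_wlen. Qed.

Lemma wlenw_sword (u : word X) : wlenw wtq (sword u) = 0%N.
Proof. by rewrite /wlenw; elim: u => //= l u ->. Qed.

Lemma qlen_iX w : qlen (iX w) = 0%N.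
Proof. by rewrite /qlen /wlen fgw_iX wlenw_sword. Qed.

Lemma qlen_qe e : qlen (qe e) = 1%N.
Proof. by rewrite qe_of_word. Qed.

Definition bval (b : bool * fg X) : K := qe b.1 * iX b.2.
Definition kval bs : K := prodl (map bval bs).

Lemma kval_cat bs bs' : kval (bs ++ bs') = kval bs * kval bs'.
Proof. by rewrite /kval map_cat prodl_cat. Qed.

Definition bword bs : word (option X) :=
  foldr (fun b acc => (None, b.1) :: sword (fgw b.2) ++ acc) [::] bs.

Lemma kval_bword bs : kval bs = of_word (bword bs).
Proof.
elim: bs => //= -[e w] bs IH; rewrite /kval /= -/(kval bs) IH /bval.
by rewrite -cat1s !of_word_cat -qe_of_word -iX_of_word of_wordK mulgA.
Qed.

Definition no_pinch bs := sorted (fun b b' => ~~ ((b'.1 == ~~ b.1) && (b.2 == 1))) bs.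

Lemma fg_eq1 (A : choiceType) (u : fg A) : (u == 1) = (fgw u == [::]).
Proof. by rewrite -(inj_eq val_inj). Qed.

Lemma reduced_bword bs : no_pinch bs -> reduced (bword bs).
Proof.
elim: bs => //= -[e w] bs IH np; have {IH} IH := IH (path_sorted np).
have pw : path (fun l k : option X * bool => k != linv l) (None, e) (sword w).
  by have := reduced_sword (fgP w); case: (fgw w) => //= -[a b] u.
rewrite /reduced /= cat_path pw /=.
case: bs np IH => //= -[e' w'] bs /andP[np _] IH; apply/andP; split; last exact: IH.
move: np; rewrite fg_eq1; case/lastP: (fgw w) => [|u [a b]] /=.
  by rewrite andbT /linv xpair_eqE.
by rewrite /sword map_rcons last_rcons.
Qed.

Lemma fgw_kval bs : no_pinch bs -> fgw (kval bs) = bword bs.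
Proof. by move=> np; rewrite kval_bword /= red_id // reduced_bword. Qed.

Lemma wlenw_bword bs : wlenw wtq (bword bs) = size bs.
Proof.
elim: bs => //= -[e w] bs IH; rewrite -cat1s !wlenw_cat IH wlenw_sword.
by rewrite /wlenw.
Qed.

Lemma qlen_kval bs : no_pinch bs -> qlen (kval bs) = size bs.
Proof. by move=> np; rewrite /qlen /wlen fgw_kval // wlenw_bword. Qed.

Lemma qlen_kval_le bs : qlen (kval bs) <= size bs.
Proof.
elim: bs => //= -[e w] bs IH; rewrite /kval /=.
apply: leq_trans (lenM3 qlenP _ _ _) _.
by rewrite qlen_qe qlen_iX addn0 add1n ltnS.
Qed.

(** A pinch would lose two letters q, so the maximal q-length certifies that there is none. *)
Lemma qlen_no_pinch bs : qlen (kval bs) = size bs -> no_pinch bs.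
Proof.
elim: bs => //= -[e w] bs IH; rewrite /kval /= -/(kval bs) => l.
have lb : qlen (kval bs) = size bs.
  have := lenM3 qlenP (qe e) (iX w) (kval bs); rewrite l qlen_qe qlen_iX.
  by have := qlen_kval_le bs; lia.
have {IH} := IH lb; case: bs l {lb} => //= -[e' w'] bs l ->; rewrite andbT.
apply/andP => /= -[/eqP e'E /eqP w1]; move: l.
rewrite e'E w1 /kval /bval /= iX1 mulg1 qeN mulgA mulgA mulgV mul1g => l.
by have := lenM qlenP (iX w') (kval bs); rewrite l qlen_iX; have := qlen_kval_le bs; lia.
Qed.

Lemma sword_split (u v : word X) s t :
  (if s is l :: _ then l.1 == None else true) ->
  (if t is l :: _ then l.1 == None else true) ->
  sword u ++ s = sword v ++ t -> u = v /\ s = t.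
Proof.
elim: u v => [|[a b] u IH] [|[c d] v] /= hs ht.
- by [].
- by move=> e; rewrite e in hs.
- by move=> e; rewrite -e in ht.
- by case=> -> -> /(IH _ hs ht) [-> ->].
Qed.

Lemma bword_hd bs : if bword bs is l :: _ then l.1 == None else true.
Proof. by case: bs => //= -[]. Qed.

Lemma bword_inj : injective bword.
Proof.
elim=> [|[e w] bs IH] [|[e' w'] bs'] //= [-> /sword_split].
by case=> [||/val_inj -> /IH -> //]; exact: bword_hd.
Qed.

Lemma kval_inj bs bs' : no_pinch bs -> no_pinch bs' -> kval bs = kval bs' -> bs = bs'.
Proof. by move=> n1 n2 /(congr1 (@fgw _)); rewrite !fgw_kval // => /bword_inj. Qed.

Lemma parse_reduced (u : word (option X)) : reduced u ->
  exists w bs, [/\ u = sword (fgw w) ++ bword bs & no_pinch bs].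
Proof.
elim: u => [|[[x|] b] u IH] ru; first by exists 1, [::].
  have [w [bs [e np]]] := IH (reduced_cons ru).
  have rw : reduced ((x, b) :: fgw w).
    move: ru (fgP w); rewrite e; case: (fgw w) => //= -[y c] v.
    rewrite /reduced /= => /andP[+ _] ->; rewrite /linv /= !xpair_eqE (inj_eq Some_inj).
    by rewrite andbT.
  exists (Fg rw), bs; split=> //.
  by rewrite e.
have [w [bs [e np]]] := IH (reduced_cons ru).
exists 1, ((b, w) :: bs); split; first by rewrite /= e.
move: np; case: bs e => //= -[c w'] bs e np; apply/andP; split=> //.
apply/andP => /= -[/eqP cE /eqP w1]; move: ru; rewrite e w1 /= /reduced /=.
by rewrite /linv /= cE eqxx.
Qed.

Lemma kvalP (k : K) : exists w bs, [/\ k = iX w * kval bs, no_pinch bs,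
  qlen k = size bs & fgw k = sword (fgw w) ++ bword bs].
Proof.
have [w [bs [e np]]] := parse_reduced (fgP k).
exists w, bs; split=> //; last by rewrite /qlen /wlen e wlenw_cat wlenw_bword wlenw_sword.
by rewrite -[k]of_wordK e of_word_cat -kval_bword -iX_of_word of_wordK.
Qed.

Lemma qlen0P k : qlen k = 0%N -> exists w, k = iX w.
Proof.
have [w [bs [-> _ -> _]]] := kvalP k; case: bs => // _.
by exists w; rewrite /kval /= mulg1.
Qed.

Lemma qlen_pinch e w e' : qlen (qe e * iX w * qe e') = if (e' == ~~ e) && (w == 1) then 0%N else 2.
Proof.
case: ifP => [/andP[/eqP -> /eqP ->]|np].
  by rewrite iX1 mulg1 qeN mulgV (tlen1 qlenP).
have -> : qe e * iX w * qe e' = kval [:: (e, w); (e', 1)].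
  by rewrite /kval /= /bval /= iX1 !mulg1.
by rewrite qlen_kval //= np.
Qed.

End Blocks.

Arguments wtq {X}.
Arguments qe {X}.

(** * The Miller machine as a semidirect product *)

Section Model.
Variables (X : finType) (R : {fset word X}).

Local Notation Th := (X + R)%type.
Local Notation FX := (fg X).
Local Notation FT := (fg Th).
Local Notation K := (fg (option X)).
Implicit Types (s t : FT) (e : bool) (k : K) (w : FX) (bs : seq (bool * FX)).

Definition aX : FT -> FX := ext (fun al : Th => if al is inl x then fgen x else 1).
Definition bX : FT -> FX :=
  ext (fun al : Th => match al with inl x => fgen x | inr r => of_word (val r) end).

(* [phi s] multiplies [q^e] by [sd e s] on the right and by the inverse of
   [sd (~~ e) s] on the left. *)
Definition sd e : FT -> FX := if e then bX else aX.

Lemma sdM e s t : sd e (s * t) = sd e s * sd e t.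
Proof. by case: e; exact: extM. Qed.
Lemma sd1 e : sd e 1 = 1.
Proof. by case: e; exact: ext1. Qed.
Lemma sdV e s : sd e s^-1 = (sd e s)^-1.
Proof. by case: e; exact: extV. Qed.
Lemma sdX e s n : sd e (s ^+ n) = sd e s ^+ n.
Proof. by case: e; exact: extX. Qed.

Definition phi s : K -> K :=
  ext (fun o => if o is Some x then fgen (Some x) else (iX (aX s))^-1 * qe true * iX (bX s)).

Lemma phiM s k k' : phi s (k * k') = phi s k * phi s k'. Proof. exact: extM. Qed.
Lemma phi1 s : phi s 1 = 1. Proof. exact: ext1. Qed.
Lemma phiV s k : phi s k^-1 = (phi s k)^-1. Proof. exact: extV. Qed.

Lemma phi_iX s w : phi s (iX w) = iX w.
Proof.
apply: (hom_ext (h1 := phi s \o @iX X)) => [u v|u v|x] /=.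
- by rewrite iXM phiM.
- exact: iXM.
- by rewrite /iX ext_gen /phi ext_gen.
Qed.

Lemma phi_qe s e : phi s (qe e) = (iX (sd (~~ e) s))^-1 * qe e * iX (sd e s).
Proof.
have h : phi s (qe true) = (iX (aX s))^-1 * qe true * iX (bX s) by rewrite /phi ext_gen.
case: e => //; have -> : qe false = (qe true)^-1 :> fg (option X) by rewrite -qeN.
by rewrite phiV h; gsimp.
Qed.

Lemma phi_mul s t k : phi (s * t) k = phi s (phi t k).
Proof.
apply: (hom_ext (h2 := phi s \o phi t)) => [u v|u v|[x|]] /=.
- exact: phiM.
- by rewrite !phiM.
- by rewrite /phi !ext_gen.
- have := phi_qe (s * t) true; have := phi_qe t true; rewrite /qe /lev /= => -> ->.
  rewrite !phiM phiV !phi_iX; have := phi_qe s true; rewrite /qe /lev /= => ->.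
  by rewrite -[aX]/(sd false) -[bX]/(sd true) !sdM !iXM; gsimp.
Qed.

Lemma phi_1 k : phi 1 k = k.
Proof.
apply: (hom_ext (h2 := id)) => [u v|u v|[x|]] //=.
exact: phiM.
Qed.

Record mil := Mil { mk : K; mt : FT }.
Definition mil_pair (g : mil) := (mk g, mt g).
Definition pair_mil (p : K * FT) := Mil p.1 p.2.
Fact mil_pairK : cancel mil_pair pair_mil. Proof. by case. Qed.
HB.instance Definition _ := Choice.copy mil (can_type mil_pairK).

Definition mil_mul (g h : mil) := Mil (mk g * phi (mt g) (mk h)) (mt g * mt h).
Definition mil_inv (g : mil) := Mil (phi (mt g)^-1 (mk g)^-1) (mt g)^-1.
Definition mil_one := Mil 1 1.

Fact mil_mulA : associative mil_mul.
Proof. by move=> g h l; rewrite /mil_mul /= phiM phi_mul !mulgA. Qed.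
Fact mil_mul1 : left_id mil_one mil_mul.
Proof. by case=> k t; rewrite /mil_mul /= phi_1 !mul1g. Qed.
Fact mil_mulr1 : right_id mil_one mil_mul.
Proof. by case=> k t; rewrite /mil_mul /= phi1 !mulg1. Qed.
Fact mil_mulV : left_inverse mil_one mil_inv mil_mul.
Proof. by case=> k t; rewrite /mil_mul /= -phiM !mulVg phi1. Qed.
Fact mil_mulrV : right_inverse mil_one mil_inv mil_mul.
Proof. by case=> k t; rewrite /mil_mul /= -phi_mul !mulgV phi_1 mulgV. Qed.
HB.instance Definition _ := isGroup.Build mil mil_mulA mil_mul1 mil_mulr1 mil_mulV mil_mulrV.

Lemma milM (g h : mil) : g * h = Mil (mk g * phi (mt g) (mk h)) (mt g * mt h).
Proof. by []. Qed.
Lemma milV (g : mil) : g^-1 = Mil (phi (mt g)^-1 (mk g)^-1) (mt g)^-1.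
Proof. by []. Qed.
Lemma mkM (g h : mil) : mk (g * h) = mk g * phi (mt g) (mk h). Proof. by []. Qed.
Lemma mtM (g h : mil) : mt (g * h) = mt g * mt h. Proof. by []. Qed.
Lemma mtV (g : mil) : mt g^-1 = (mt g)^-1. Proof. by []. Qed.

(** The displacement of a vertex with stabilizer F(X) x F(Theta). By [qlen_phi] the action of
    F(Theta) does not change it, so only the K-component counts. *)
Definition mlen (g : mil) := qlen (mk g).

Lemma lev_Some (x : X) b : lev fgen (Some x, b) = iX (lev fgen (x, b)).
Proof. by case: b; rewrite /lev /= ?iXV /iX ext_gen. Qed.

Lemma qlen_phi s k : qlen (phi s k) = qlen k.
Proof.
have le t u : qlen (phi t u) <= qlen u.
  rewrite -{1}[u]fg_ext_id /ext /qlen /wlen.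
  elim: (fgw u) => [|[o b] v IH]; first by rewrite phi1.
  rewrite /= phiM; apply: leq_trans (lenM (@qlenP X) _ _) _; apply: leq_add IH.
  case: o => [x|] /=.
    by rewrite lev_Some phi_iX qlen_iX.
  rewrite -[lev _ _]/(qe b) phi_qe -iXV.
  by apply: leq_trans (lenM3 (@qlenP X) _ _ _) _; rewrite !qlen_iX qlen_qe.
apply/eqP; rewrite eqn_leq le /=.
by have := le s^-1 (phi s k); rewrite -phi_mul mulVg phi_1.
Qed.

Definition qsum b k : nat := wsum wtq b (fgw k).

Lemma qlenE k : qlen k = (qsum true k + qsum false k)%N.
Proof. exact: wlenw_wsum. Qed.

Lemma qsumM k k' : (qsum true (k * k')%g + (qsum false k + qsum false k') =
  qsum true k + qsum true k' + qsum false (k * k')%g)%N.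
Proof. exact: wsum_fgM. Qed.

Lemma qsum_iX b w : qsum b (iX w) = 0%N.
Proof. by rewrite /qsum fgw_iX; elim: (fgw w) => //= l u ->; rewrite muln0. Qed.

(** Each letter q is sent to a product with one q of the same sign, so the exponent sum of q is
    preserved. The absence of inversions in M(G) needs this, since [g * g] contains the factor
    [phi (mt g) (mk g)]. *)
Lemma qsum_phi s k : (qsum true (phi s k) + qsum false k = qsum true k + qsum false (phi s k))%N.
Proof.
have step u v : (qsum true (phi s u) + qsum false u = qsum true u + qsum false (phi s u))%N ->
    (qsum true (phi s v) + qsum false v = qsum true v + qsum false (phi s v))%N ->
    (qsum true (phi s (u * v)%g) + qsum false (u * v)%g =
     qsum true (u * v)%g + qsum false (phi s (u * v)%g))%N.
  have := qsumM u v; have := qsumM (phi s u) (phi s v); rewrite -phiM.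
  by move: (qsum _ (phi s (u * v)%g)) (qsum _ (phi s (u * v)%g)) (qsum _ (u * v)%g) (qsum _ (u * v)%g)
    => *; lia.
rewrite -[k]fg_ext_id /ext; elim: (fgw k) => [|[o b] v IH]; first by rewrite phi1.
apply: step IH; case: o => [x|]; first by rewrite lev_Some phi_iX.
rewrite -[lev _ _]/(qe b) phi_qe -iXV.
have := qsumM (iX (sd (~~ b) s)^-1 * qe b) (iX (sd b s)).
have := qsumM (iX (sd (~~ b) s)^-1) (qe b).
rewrite !qsum_iX !addn0 !add0n.
move: (qsum _ (_ * _)%g) (qsum _ (_ * _)%g) (qsum _ (_ * _)%g) (qsum _ (_ * _)%g) => *.
by lia.
Qed.

Lemma gdist_mlen (g h : mil) : gdist mlen g h = gdist (@qlen X) (mk g) (mk h).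
Proof. by rewrite /gdist /mlen milV mkM /= -phiM qlen_phi. Qed.

Lemma mlenP : tree_length mlen.
Proof.
split.
- by rewrite /mlen (tlen1 (@qlenP X)).
- by move=> g; rewrite /mlen milV /= qlen_phi (tlenV (@qlenP X)).
- by move=> a b c d; rewrite !gdist_mlen; exact: (tlen4 (@qlenP X)).
- by move=> g h; rewrite /mlen mkM (tlen_odd (@qlenP X)) qlen_phi.
- move=> g; rewrite /mlen mkM => og.
  have := qsumM (mk g) (phi (mt g) (mk g)); have := qsum_phi (mt g) (mk g).
  have := qlen_phi (mt g) (mk g); move: og; rewrite !qlenE.
  by move: (qsum _ (_ * _)%g) (qsum _ (_ * _)%g) => *; lia.
Qed.

Lemma mlen0P (g : mil) : mlen g = 0%N -> exists w t, g = Mil (iX w) t.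
Proof. by case: g => k t /qlen0P [w /= ->]; exists w, t. Qed.

(* The elements [(sd e s, s)] form the two associated subgroups of the HNN
   extension with base F(X) x F(Theta) and stable letter q. *)
Definition csd e s : mil := Mil (iX (sd e s)) s.

Lemma csdM e s t : csd e (s * t) = csd e s * csd e t.
Proof. by rewrite milM /= phi_iX -iXM -sdM. Qed.
Lemma csdV e s : csd e s^-1 = (csd e s)^-1.
Proof. by rewrite milV /= -iXV phi_iX -sdV. Qed.
Lemma csd1 e : csd e 1 = 1.
Proof. by rewrite /csd sd1 iX1. Qed.
Lemma csdX e s n : csd e (s ^+ n) = csd e s ^+ n.
Proof. by elim: n => [|n IH]; rewrite ?csd1 // !expgS csdM IH. Qed.

Definition stab e : mil := Mil (qe e) 1.

Lemma stabN e : stab (~~ e) = (stab e)^-1.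
Proof. by rewrite /stab milV /= qeN invg1 phi_1. Qed.

Lemma csd_q e s : csd (~~ e) s * stab e = stab e * csd e s.
Proof. by rewrite !milM /= phi_qe phi_1 mulg1 mul1g; gsimp. Qed.

(** Britton's lemma for one pinch: once s is moved to the right past q, the letters q enclose a
    coefficient in F(X) and cancel only if it is trivial. *)
Lemma q_pinch e e' w s : mlen (stab (~~ e) * Mil (iX w) s * stab e') = 0%N ->
  e = e' /\ w = sd (~~ e) s.
Proof.
rewrite /mlen !mkM /= mul1g phi_1 phi_qe !mulgA -(mulgA (qe (~~ e))) -iXV -iXM => h.
have : qlen (qe (~~ e) * iX (w * (sd (~~ e') s)^-1) * qe e') <= 0.
  rewrite -h -[X in qlen X <= _](mulgK (iX (sd e' s))) -iXV.
  by apply: leq_trans (lenM (@qlenP X) _ _) _; rewrite qlen_iX addn0.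
rewrite qlen_pinch negbK; case: ifP => // /andP[/eqP -> /eqP] + _.
by move=> /divg1_eq.
Qed.

End Model.

(** * The presentation of M(G) and its identification with the semidirect product *)

Lemma pres_eq_map (A B : Type) (f : A -> B) rel (u v : word A) :
  free_eq u v -> pres_eq rel [seq (f l.1, l.2) | l <- u] [seq (f l.1, l.2) | l <- v].
Proof.
elim=> {u v} [u|u v _|u v w _ h1 _ h2|u v a b|//]; first exact: PresRefl.
- exact: PresSym.
- exact: PresTrans h1 h2.
- by rewrite !map_cat; exact: PresCancel.
Qed.

Section PresEq.
Variables (A : choiceType) (rel : word A -> word A -> Prop).
Local Notation "u ~ v" := (pres_eq rel u v) (at level 70).
Implicit Types u v w : word A.

Lemma pres_eq_ctxl p u v : u ~ v -> p ++ u ~ p ++ v.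
Proof. exact/pres_eq_cat/PresRefl. Qed.
Lemma pres_eq_ctxr s u v : u ~ v -> u ++ s ~ v ++ s.
Proof. by move=> h; apply: pres_eq_cat h (PresRefl _ _). Qed.

Lemma winv_l w : winv w ++ w ~ [::].
Proof. by apply: pres_eq_of_word; rewrite of_word_cat of_word_winv mulVg. Qed.
Lemma winv_r w : w ++ winv w ~ [::].
Proof. by apply: pres_eq_of_word; rewrite of_word_cat of_word_winv mulgV. Qed.

Lemma comm_inv_r u v w : u ++ v ~ w ++ u -> u ++ winv v ~ winv w ++ u.
Proof.
move=> h.
apply: (@PresTrans _ _ _ (winv w ++ (w ++ u) ++ winv v)).
  rewrite -catA (catA (winv w)) -{1}[u ++ winv v]cat0s; apply: pres_eq_ctxr.
  exact/PresSym/winv_l.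
apply: (@PresTrans _ _ _ (winv w ++ (u ++ v) ++ winv v)).
  exact/pres_eq_ctxl/pres_eq_ctxr/PresSym.
by rewrite -catA; apply: pres_eq_ctxl; rewrite -{2}[u]cats0; exact/pres_eq_ctxl/winv_r.
Qed.

Lemma comm_inv_l u v w : u ++ v ~ w ++ u -> winv u ++ w ~ v ++ winv u.
Proof.
move=> h.
apply: (@PresTrans _ _ _ (winv u ++ (w ++ u) ++ winv u)).
  rewrite -catA; apply: pres_eq_ctxl; rewrite -{1}[w]cats0; apply: pres_eq_ctxl.
  exact/PresSym/winv_r.
apply: (@PresTrans _ _ _ (winv u ++ (u ++ v) ++ winv u)).
  exact/pres_eq_ctxl/pres_eq_ctxr/PresSym.
by rewrite -catA catA -[X in _ ~ X]cat0s; exact/pres_eq_ctxr/winv_l.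
Qed.

Lemma comm_cat u v v' w w' : u ++ v ~ w ++ u -> u ++ v' ~ w' ++ u ->
  u ++ v ++ v' ~ (w ++ w') ++ u.
Proof.
move=> h h'; rewrite catA; apply: PresTrans (pres_eq_ctxr _ h) _.
by rewrite -!catA; exact: pres_eq_ctxl.
Qed.

End PresEq.

Section Presentation.
Variables (X : finType) (R : {fset word X}).

Local Notation Th := (X + R)%type.
Local Notation FX := (fg X).
Local Notation FT := (fg Th).
Local Notation K := (fg (option X)).
Local Notation M := (miller_gen R).

Definition gm (g : M) : mil R :=
  match g with
  | inl (inl x) => Mil (fgen (Some x)) 1
  | inl (inr al) => Mil 1 (fgen al)
  | inr _ => Mil (qe true) 1
  end.

Definition mu (w : word M) : mil R := fev gm w.

Definition kgen (o : option X) : M := if o is Some x then mx R x else mq R.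
Definition kword (w : word (option X)) : word M := [seq (kgen l.1, l.2) | l <- w].
Definition tword (w : word Th) : word M := [seq (mtheta l.1, l.2) | l <- w].

Lemma kword_cat u v : kword (u ++ v) = kword u ++ kword v. Proof. exact: map_cat. Qed.
Lemma kword_winv u : kword (winv u) = winv (kword u).
Proof. by rewrite /kword /winv -map_comp -map_rev -map_comp. Qed.

Lemma mil_homK k k' : Mil k 1 * Mil k' 1 = Mil (k * k') 1 :> mil R.
Proof. by rewrite milM /= phi_1 mul1g. Qed.
Lemma mil_invK k : (Mil k 1)^-1 = Mil k^-1 1 :> mil R.
Proof. by rewrite milV /= invg1 phi_1. Qed.
Lemma mil_homT t t' : Mil 1 t * Mil 1 t' = Mil 1 (t * t') :> mil R.
Proof. by rewrite milM /= phi1 mul1g. Qed.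
Lemma mil_invT t : (Mil 1 t)^-1 = Mil 1 t^-1 :> mil R.
Proof. by rewrite milV /= invg1 phi1. Qed.
Lemma mil_split k t : Mil k t = Mil k 1 * Mil 1 t :> mil R.
Proof. by rewrite milM /= phi_1 mulg1 mul1g. Qed.

Lemma lev_gmK o b : lev gm (kgen o, b) = Mil (lev fgen (o, b)) 1.
Proof. by case: o => [x|]; case: b; rewrite /lev /= ?mil_invK. Qed.
Lemma lev_gmT al b : lev gm (mtheta al, b) = Mil 1 (lev fgen (al, b)).
Proof. by case: b; rewrite /lev //= mil_invT. Qed.

Lemma mu_cat u v : mu (u ++ v) = mu u * mu v. Proof. exact: fev_cat. Qed.
Lemma mu_winv u : mu (winv u) = (mu u)^-1. Proof. exact: fev_winv. Qed.

Lemma mu_kword u : mu (kword u) = Mil (of_word u) 1.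
Proof.
rewrite of_word_fev /mu; elim: u => //= -[o b] u IH.
by rewrite lev_gmK IH mil_homK.
Qed.

Lemma mu_tword u : mu (tword u) = Mil 1 (of_word u).
Proof.
rewrite of_word_fev /mu; elim: u => //= -[o b] u IH.
by rewrite lev_gmT IH mil_homT.
Qed.

Lemma miller_wordE (w : word X) : miller_word R w = kword (sword w).
Proof. by rewrite /kword /sword -map_comp. Qed.

Lemma mu_rel l r : miller_rel l r -> mu l = mu r.
Proof.
have fS x : fgen (Some x) = iX (fgen x) by rewrite /iX ext_gen.
case=> [al x|x|r']; rewrite /mu /=.
- by rewrite /lev /= !mulg1 fS !milM /= phi_iX phi_1 !mulg1 !mul1g.
- rewrite /lev /= !mulg1 fS !milM /= !phi_1 !mulg1 !mul1g phiM phi_iX phi_qe /=.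
  by rewrite /aX /bX !ext_gen; gsimp.
- rewrite /lev /= -/(mu (_ ++ _)) mu_cat miller_wordE mu_kword -iX_of_word /mu /=.
  rewrite /lev /= !mulg1 !milM /= !phi_1 !mulg1 !mul1g phi_qe /=.
  by rewrite /aX /bX !ext_gen iX1 invg1 mul1g.
Qed.

Definition sdw e (l : Th * bool) : word X :=
  match l with
  | (inl x, b) => [:: (x, b)]
  | (inr r, b) => if e then (if b then val r else winv (val r)) else [::]
  end.

Lemma of_word_sdw e l : of_word (sdw e l) = sd e (lev fgen l).
Proof.
rewrite /sd /aX /bX; case: l => [[x|r] []] /=; rewrite /lev /=; case: e => /=;
  by rewrite ?extV ext_gen ?of_word_winv ?invg1 // of_word_fev /= mulg1.
Qed.

(** The action of one letter of Theta, performed on words; it serves the rewriting by the relations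
    and later the program that computes K-components. *)
Definition psub (l : Th * bool) (m : option X * bool) : word (option X) :=
  if m.1 is Some _ then [:: m]
  else winv (sword (sdw (~~ m.2) l)) ++ m :: sword (sdw m.2 l).

Definition psubst l (v : word (option X)) : word (option X) := flatten (map (psub l) v).

Lemma of_word_psubst l v : of_word (psubst l v) = phi (lev fgen l) (of_word v).
Proof.
elim: v => [|[o b] v IH]; first by rewrite phi1.
rewrite /psubst /= -/(psubst l v) of_word_cat IH -[in RHS]cat1s of_word_cat phiM.
congr (_ * _); case: o => [x|].
  by rewrite [in RHS]of_word_fev /= mulg1 lev_Some phi_iX -lev_Some of_word_fev /= mulg1.
rewrite /psub /= -qe_of_word phi_qe of_word_cat of_word_winv -iX_of_word of_word_sdw.
by rewrite -[_ :: _]cat1s of_word_cat -qe_of_word -iX_of_word of_word_sdw mulgA.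
Qed.

Local Notation "u ~ v" := (pres_eq (@miller_rel X R) u v) (at level 70).

Lemma theta_x al x b : [:: gen (mtheta al)] ++ kword [:: (Some x, b)] ~
  kword [:: (Some x, b)] ++ [:: gen (mtheta al)].
Proof.
have h : [:: gen (mtheta al)] ++ kword [:: (Some x, true)] ~
  kword [:: (Some x, true)] ++ [:: gen (mtheta al)].
  by have := PresRel [::] [::] (MillerComm al x); rewrite !cats0.
by case: b => //; exact: comm_inv_r h.
Qed.

Lemma theta_xw al b (w : word X) : [:: (mtheta al, b)] ++ kword (sword w) ~
  kword (sword w) ++ [:: (mtheta al, b)].
Proof.
elim: w => [|[x c] w IH]; first exact: PresRefl.
rewrite -[sword _]/([:: (Some x, c)] ++ sword w) kword_cat; apply: comm_cat IH.
case: b; first exact: theta_x.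
exact: comm_inv_l (theta_x al x c).
Qed.

Lemma theta_q al : [:: (mtheta al, true)] ++ kword [:: (None, true)] ~
  kword (psub (al, true) (None, true)) ++ [:: (mtheta al, true)].
Proof.
case: al => [x|r]; last first.
  by have := PresRel [::] [::] (MillerRel r); rewrite /= !cats0 miller_wordE.
(* Inserting x^-1 x in front and commuting theta with x exposes the left side of the relation after
   x^-1. *)
apply: (@PresTrans _ _ _ [:: (mx R x, false); gen (mx R x); gen (mtheta (inl x)); gen (mq R)]).
  exact: PresSym (PresCancel _ [::] _ _ _).
apply: (@PresTrans _ _ _ [:: (mx R x, false); gen (mtheta (inl x)); gen (mx R x); gen (mq R)]).
  exact: (pres_eq_ctx [:: (mx R x, false)] [:: gen (mq R)] (PresSym (theta_x (inl x) x true))).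
exact: (PresRel [:: (mx R x, false)] [::] (MillerGen R x)).
Qed.

Lemma winv_psub l b : winv (psub l (None, b)) = psub l (None, ~~ b).
Proof. by rewrite /psub /= -cat1s !winv_cat winvK negbK -catA. Qed.

Lemma sdw_inv e al : sdw e (al, false) = winv (sdw e (al, true)).
Proof. by case: al => [x|r] //=; case: e. Qed.

Lemma theta_letter l m : [:: (mtheta l.1, l.2)] ++ kword [:: m] ~
  kword (psub l m) ++ [:: (mtheta l.1, l.2)].
Proof.
case: l => al b; case: m => -[x|] c.
  by have := theta_xw al b [:: (x, c)].
have base b' : [:: (mtheta al, b')] ++ kword [:: (None, true)] ~
    kword (psub (al, b') (None, true)) ++ [:: (mtheta al, b')]; last first.
  case: c; first exact: base.
  by rewrite -(winv_psub _ true) kword_winv; exact: comm_inv_r (base b).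
case: b'; first exact: theta_q.
(* As theta sends q to A^-1 q B, it sends A q B^-1 to q; the claim for the inverse letter is this
   fact read backwards. *)
apply: (@comm_inv_l _ _ [:: (mtheta al, true)]).
set A := sdw false (al, true); set B := sdw true (al, true).
have sw u : sword (winv u) = winv (sword u) by rewrite /sword /winv -map_comp -map_rev -map_comp.
have -> : psub (al, false) (None, true) = sword A ++ [:: (None, true)] ++ winv (sword B).
  by rewrite /psub [(None, true).1]/= !(sdw_inv, sw) winvK.
rewrite !kword_cat kword_winv.
apply: (@PresTrans _ _ _ ((kword (sword A) ++ kword (psub (al, true) (None,
  true)) ++ winv (kword (sword B))) ++ [:: (mtheta al, true)])).
  apply: comm_cat; first exact: theta_xw.
  apply: comm_cat; first exact: theta_q.
  exact/comm_inv_r/theta_xw.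
apply: pres_eq_ctxr.
have -> : psub (al, true) (None, true) = winv (sword A) ++ [:: (None, true)] ++ sword B by [].
rewrite !kword_cat kword_winv -!catA.
apply: (@PresTrans _ _ _ ([::] ++ [:: (kgen None, true)] ++ [::])); last exact: PresRefl.
rewrite catA; apply: pres_eq_cat; first exact: winv_r.
apply: pres_eq_ctxl; exact: winv_r.
Qed.

Lemma theta_kword l v : [:: (mtheta l.1, l.2)] ++ kword v ~
  kword (psubst l v) ++ [:: (mtheta l.1, l.2)].
Proof.
elim: v => [|m v IH]; first exact: PresRefl.
rewrite [psubst _ _]/(psub l m ++ psubst l v) -[m :: v]cat1s !kword_cat.
by apply: comm_cat; [exact: theta_letter | exact: IH].
Qed.

Lemma pres_eq_kword u v : of_word u = of_word v -> kword u ~ kword v.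
Proof. by move=> /free_eqP; exact: pres_eq_map. Qed.
Lemma pres_eq_tword u v : of_word u = of_word v -> tword u ~ tword v.
Proof. by move=> /free_eqP; exact: pres_eq_map. Qed.

(** Letters of Theta are pushed to the right by [theta_kword], so modulo the relations a word is
    determined by its image in the model. *)
Lemma mil_normal_form u : u ~ kword (fgw (mk (mu u))) ++ tword (fgw (mt (mu u))).
Proof.
elim: u => [|[g b] u IH]; first exact: PresRefl.
apply: PresTrans (pres_eq_ctxl [:: (g, b)] IH) _.
rewrite [mu (_ :: _)]/(lev gm (g, b) * mu u) mkM mtM.
move: (mk (mu u)) (mt (mu u)) => k t; case: g => [[x|al]|[]].
- rewrite -[lev _ _]/(lev gm (kgen (Some x), b)) lev_gmK [mk _]/= [mt _]/= phi_1 mul1g.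
  rewrite catA; apply: pres_eq_ctxr; rewrite -[[:: _]]/(kword [:: (Some x, b)]) -kword_cat.
  by apply: pres_eq_kword; rewrite of_wordK of_word_cat of_wordK of_word_fev /= mulg1.
- rewrite -[lev _ _]/(lev gm (mtheta al, b)) lev_gmT [mk _]/= [mt _]/= mul1g.
  rewrite catA; apply: PresTrans (pres_eq_ctxr _ (theta_kword (al, b) _)) _.
  rewrite -catA; apply: pres_eq_cat.
    by apply: pres_eq_kword; rewrite of_word_psubst !of_wordK.
  apply: (@pres_eq_tword ([:: (al, b)] ++ fgw t)).
  by rewrite of_wordK of_word_cat of_wordK of_word_fev /= mulg1.
- rewrite -[lev _ _]/(lev gm (kgen None, b)) lev_gmK [mk _]/= [mt _]/= phi_1 mul1g.
  rewrite catA; apply: pres_eq_ctxr; rewrite -[[:: _]]/(kword [:: (None, b)]) -kword_cat.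
  by apply: pres_eq_kword; rewrite of_wordK of_word_cat of_wordK of_word_fev /= mulg1.
Qed.

Lemma miller_eqP u v : u ~ v <-> mu u = mu v.
Proof.
split=> [|e]; first by apply: fev_pres_eq; exact: mu_rel.
by apply: PresTrans (mil_normal_form u) _; rewrite e; exact/PresSym/mil_normal_form.
Qed.

Lemma miller_conjP u v :
  pres_conj (@miller_rel X R) u v <-> exists g : mil R, g * mu u * g^-1 = mu v.
Proof.
split=> [[w /miller_eqP e]|[g e]].
  by exists (mu w); rewrite -e !mu_cat mu_winv mulgA.
exists (kword (fgw (mk g)) ++ tword (fgw (mt g))); apply/miller_eqP.
rewrite !mu_cat mu_winv mu_cat mu_kword mu_tword !of_wordK -mil_split mulgA -e.
by case: g {e}.
Qed.

(** The pairs [(aX s, bX s)] are the pairs of elements of F(X) with equal images in G. *)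
Lemma sd_group_eq s : pres_eq (group_rel R) (fgw (aX s)) (fgw (bX (R := R) s)).
Proof.
pose W e (w : word Th) := flatten (map (sdw e) w).
have WE e w : of_word (W e w) = sd e (of_word w).
  elim: w => [|l w IH]; first by rewrite sd1.
  rewrite /W /= -/(W e w) of_word_cat IH of_word_sdw -[in RHS]cat1s of_word_cat sdM.
  by congr (_ * _); rewrite of_word_fev /= mulg1.
have e1 e : pres_eq (group_rel R) (fgw (sd e s)) (W e (fgw s)).
  by apply: pres_eq_of_word; rewrite WE !of_wordK.
apply: PresTrans (e1 false) _; apply: PresTrans (PresSym (e1 true)).
elim: (fgw s) => [|[al b] w IH]; first exact: PresRefl.
apply: (@pres_eq_cat X); last exact: IH.
have rel1 (r : R) : pres_eq (group_rel R) (val r) [::].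
  have := PresRel (rel := group_rel R) [::] [::] (l := val r) (r := [::]).
  by rewrite /= !cats0; apply; split=> //; exact: valP.
case: al => [x|r] /=; first exact: PresRefl.
apply: PresSym; case: b; first exact: rel1.
apply: PresTrans (winv_r (group_rel R) (val r)).
by apply: PresSym; rewrite -[X in pres_eq _ _ X]cat0s; apply: pres_eq_ctxr; exact: rel1.
Qed.

Lemma sd_diag (w : FX) : exists t : FT, aX t = w /\ bX t = w.
Proof.
pose th := ext (fun x => fgen (inl x : Th)); exists (th w); split.
  apply: (hom_ext (h1 := @aX X R \o th) (h2 := id)) => [s t|//|x] /=;
    first by rewrite /th /aX !extM.
  by rewrite /th ext_gen /aX ext_gen.
apply: (hom_ext (h1 := @bX X R \o th) (h2 := id)) => [s t|//|x] /=; first by rewrite /th /bX !extM.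
by rewrite /th ext_gen /bX ext_gen.
Qed.

Lemma group_eq_sd u v : pres_eq (group_rel R) u v ->
  exists s : FT, aX s = 1 /\ bX s = of_word u * (of_word v)^-1.
Proof.
have aM : {morph @aX X R : s t / s * t} by exact: extM.
have bM : {morph @bX X R : s t / s * t} by exact: extM.
have aV s : aX (R := R) s^-1 = (aX s)^-1 by exact: extV.
have bV s : bX (R := R) s^-1 = (bX s)^-1 by exact: extV.
elim=> {u v} [u|u v _ [s [sa sb]]|u v w _ [s [sa sb]] _ [t [ta tb]]|u v a b|u v l r [lR ->]].
- by exists 1; rewrite mulgV.
- by exists s^-1; rewrite aV bV sa sb invg1 invgM invgK.
- by exists (s * t); rewrite aM bM sa sb ta tb; gsimp.
- exists 1; split=> //; rewrite -/(linv (a, b)).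
  have -> : of_word (u ++ [:: (a, b); linv (a, b)] ++ v) = of_word (u ++ v).
    by rewrite !of_word_cat [of_word [:: _; _]]of_word_fev /= lev_linv mulg1 mulgV mul1g.
  by rewrite mulgV.
have [t [ta tb]] := sd_diag (of_word u).
(* With t diagonal over u, the conjugate of theta_r by t has trivial a-part and has the conjugate of
   r by u as its b-part. *)
exists (t * fgen (inr [` lR ]%fset) * t^-1).
rewrite !aM !bM aV bV ta tb /aX /bX !ext_gen mulg1 mulgV; split=> //.
by rewrite !of_word_cat /= of_word_nil; gsimp.
Qed.

Lemma sd_surj u v : pres_eq (group_rel R) u v ->
  exists s : FT, aX s = of_word u /\ bX s = of_word v.
Proof.
move=> /PresSym/group_eq_sd [s [sa sb]]; have [t [ta tb]] := sd_diag (of_word u).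
by exists (s * t); rewrite /aX /bX !extM -/(@aX X R) -/(@bX X R) sa sb ta tb; gsimp.
Qed.

End Presentation.

(** With z = x'^-1 h x, the vertices 1 and z^-1 are both the next vertex from x^-1 towards y. A tree
    has only one such vertex, so z fixes the base vertex. *)
Lemma pinch_len (G : groupType) (len : G -> nat) (x x' h y : G) :
  tree_length len -> len x = 1%N -> len x' = 1%N -> len h = 0%N ->
  len (x * y) = (len y).+1 -> len (x'^-1 * h * x * y) = len y -> len (x'^-1 * h * x) = 0%N.
Proof.
move=> lenP x1 x'1 h0 lxy lzy; set z := x'^-1 * h * x in lzy *.
have lz : len z <= 2.
  by apply: leq_trans (lenM3 lenP _ _ _) _; rewrite (tlenV lenP) x1 x'1 h0.
have oz : odd (len z) = false.
  by rewrite /z !(tlen_odd lenP) (tlenV lenP) x1 x'1 h0.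
have f1 : gdist len z^-1 1 = len z by rewrite (gdist_1 lenP) (tlenV lenP).
have f2 : gdist len x^-1 y = (len y).+1 by rewrite /gdist invgK.
have f3 : gdist len z^-1 x^-1 <= 1.
  rewrite /gdist invgK mulgK; apply: leq_trans (lenM lenP _ _) _.
  by rewrite (tlenV lenP) x'1 h0.
have f4 : gdist len z^-1 y = len y by rewrite /gdist invgK.
have f5 : gdist len 1 x^-1 = 1%N by rewrite (gdist1 _) (tlenV lenP).
have := four_point lenP z^-1 1 x^-1 y; rewrite f1 f2 f4 f5 (gdist1 _) => -[].
by move: f3 lz oz; move: (gdist _ _ _) (len z) => *; lia.
Qed.

(** * Conjugacy of block products *)

Section Twist.
Variables (X : finType) (R : {fset word X}).

Local Notation FX := (fg X).
Local Notation FT := (fg (X + R)%type).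
Implicit Types (s t : FT) (e : bool) (w : FX) (bs : seq (bool * FX)).

Definition hsign e bs := if bs is b :: _ then b.1 else e.

(* Conjugation by s multiplies the coefficient between [q^e] and [q^e'] by [sd e s] on the
   left and by the inverse of [sd (~~ e') s] on the right; e0 is the sign that follows the
   last coefficient. *)
Fixpoint twist s e0 bs :=
  if bs is (e, w) :: bs' then
    (e, sd e s * w * (sd (~~ hsign e0 bs') s)^-1) :: twist s e0 bs'
  else [::].

Lemma size_twist s e bs : size (twist s e bs) = size bs.
Proof. by elim: bs => //= -[e' w] bs /= ->. Qed.

Lemma hsign_twist s e e0 bs : hsign e0 (twist s e bs) = hsign e0 bs.
Proof. by case: bs => // -[]. Qed.

Lemma signs_twist s e bs : map fst (twist s e bs) = map fst bs.
Proof. by elim: bs => //= -[e' w] bs /= ->. Qed.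

Lemma twist_cat s e bs bs' :
  twist s e (bs ++ bs') = twist s (hsign e bs') bs ++ twist s e bs'.
Proof. by elim: bs => //= -[e' w] bs ->; case: bs. Qed.

Lemma twistM s t e bs : twist s e (twist t e bs) = twist (s * t) e bs.
Proof.
by elim: bs => //= -[e' w] bs /= ->; rewrite hsign_twist !sdM; gsimp.
Qed.

(** The factors that [phi s] puts around each q are absorbed by the adjacent coefficients; only the
    two outermost remain. *)
Lemma phi_kval s e0 bs : phi s (kval bs) =
  (iX (sd (~~ hsign e0 bs) s))^-1 * kval (twist s e0 bs) * iX (sd (~~ e0) s).
Proof.
elim: bs => [|[e w] bs IH]; first by rewrite /= phi1 mulg1 mulVg.
rewrite [kval _]/(qe e * iX w * kval bs) phiM IH phiM phi_qe phi_iX.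
rewrite [kval (twist _ _ (_ :: _))]/(qe e * iX _ * kval (twist s e0 bs)) !iXM iXV /=.
by gsimp.
Qed.

(** When the sign after the last block is the first sign, the two outer factors of [phi_kval] match
    and are removed by this conjugation, which leaves the cyclic twist. *)
Lemma csd_conj s t bs : csd (~~ hsign true bs) s * Mil (kval bs) t * (csd (~~ hsign true bs) s)^-1
  = Mil (kval (twist s (hsign true bs) bs)) (s * t * s^-1).
Proof.
set e := hsign true bs; rewrite -csdV /csd !milM /= phi_iX (phi_kval s e) sdV iXV.
have -> : hsign e bs = e by rewrite /e; case: (bs).
by gsimp.
Qed.

Definition iso_blocks bs bs' := exists s, twist s (hsign true bs) bs = bs'.

(** The component t sits on the last factor, so that proper prefixes lie in K. *)
Fixpoint blocks_mil t bs : seq (mil R) :=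
  match bs with
  | [::] => [::]
  | [:: b] => [:: Mil (bval b) t]
  | b :: bs' => Mil (bval b) 1 :: blocks_mil t bs'
  end.

Lemma blocks_mil_cons t b b' bs :
  blocks_mil t [:: b, b' & bs] = Mil (bval b) 1 :: blocks_mil t (b' :: bs).
Proof. by []. Qed.

Lemma size_blocks_mil t bs : size (blocks_mil t bs) = size bs.
Proof. by elim: bs => // b [|b' bs] //= ->. Qed.

Lemma prodl_blocks_mil t bs : bs != [::] -> prodl (blocks_mil t bs) = Mil (kval bs) t.
Proof.
elim: bs => // b [|b' bs] IH _; first by rewrite /= /kval /= !mulg1.
rewrite blocks_mil_cons [prodl _]/= -/(prodl _).
by rewrite IH // milM /= phi_1 mul1g.
Qed.

Lemma take_blocks_mil t bs j : j < size bs ->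
  prodl (take j (blocks_mil t bs)) = Mil (kval (take j bs)) 1.
Proof.
elim: bs j => // b bs IH [|j] lt; first by rewrite take0.
case: bs IH lt => // b' bs IH lt.
rewrite blocks_mil_cons take_cons [prodl _]/= -/(prodl _).
by rewrite IH // milM /= phi_1 mul1g.
Qed.

Lemma mlen_blocks_mil t bs : all (fun x => mlen x == 1%N) (blocks_mil t bs).
Proof.
have h b u : mlen (R := R) (Mil (bval b) u) = 1%N.
  have -> : bval b = kval [:: b] by rewrite /kval /= mulg1.
  by rewrite /mlen qlen_kval.
by elim: bs => // b [|b' bs] IH; rewrite /= h.
Qed.

Definition tight_blocks bs t :=
  qlen (kval bs) = size bs /\ cyc_len (@mlen X R) (Mil (kval bs) t).

Lemma tight_blocks_mil bs t : bs != [::] -> tight_blocks bs t ->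
  tight (@mlen X R) (blocks_mil t bs).
Proof.
move=> bs0 [l c]; rewrite /tight prodl_blocks_mil // size_blocks_mil.
by split; [exact: mlen_blocks_mil | split].
Qed.

(** The conjugator fixes the base vertex and carries the first edge towards one product to the first
    edge towards the other. By [pinch_len] and [q_pinch] it lies in an associated subgroup;
    [csd_conj] and uniqueness of normal forms give the twist. *)
Lemma conj_base_twist bs bs' t t' (h : mil R) :
  bs != [::] -> bs' != [::] -> qlen (kval bs) = size bs -> qlen (kval bs') = size bs' ->
  size bs = size bs' -> mlen h = 0%N ->
  h * Mil (kval bs) t * h^-1 = Mil (kval bs') t' ->
  exists s, [/\ h = csd (~~ hsign true bs) s, twist s (hsign true bs) bs = bs' & s * t * s^-1 = t'].
Proof.
case: bs => // -[e w] bs _; case: bs' => // -[e' w'] bs' _.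
set B := _ :: bs; set B' := _ :: bs' => lB lB' sz h0 eq.
have [v [s hE]] := mlen0P h0.
pose Y : mil R := Mil (iX w * kval bs) t; pose Y' : mil R := Mil (iX w' * kval bs') t'.
have UE : Mil (kval B) t = stab R e * Y.
  by rewrite milM /= phi_1 mul1g mulgA.
have VE : Mil (kval B') t' = stab R e' * Y'.
  by rewrite milM /= phi_1 mul1g mulgA.
have lY u (c : seq (bool * FX)) d f : qlen (kval ((d, u) :: c)) = (size c).+1 ->
    mlen (R := R) (Mil (iX u * kval c) f) = size c.
  move=> l; rewrite /mlen /=; apply/eqP; rewrite eqn_leq; apply/andP; split.
    apply: leq_trans (lenM (@qlenP X) _ _) _; rewrite qlen_iX; exact: qlen_kval_le.
  have := lenM (@qlenP X) (qe d) (iX u * kval c); rewrite mulgA.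
  by rewrite -[qe d * iX u * _]/(kval ((d, u) :: c)) l qlen_qe.
have h1 : stab R (~~ e') * h * stab R e * Y = Y' * h.
  rewrite stabN -(mulgA _ _ Y) -UE; apply: (mulgI (stab R e')).
  by rewrite !mulgA -VE -eq; gsimp.
have hY : mlen (Y' * h) = size bs.
  rewrite /mlen mkM; have := lY _ _ _ t' lB'; rewrite /Y' /= => lY'.
  have lh : qlen (phi t' (mk h)) = 0%N by rewrite qlen_phi.
  have := lenM (@qlenP X) (iX w' * kval bs') (phi t' (mk h)).
  have := lenM (@qlenP X) (iX w' * kval bs' * phi t' (mk h)) (phi t' (mk h))^-1.
  rewrite mulgK (tlenV (@qlenP X)) lh.
  by move: lY' sz; rewrite /mlen /= => ->; move: (qlen _) => *; lia.
have pz : mlen (stab R (~~ e') * h * stab R e) = 0%N.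
  rewrite stabN; apply: (pinch_len (y := Y) (mlenP R)) => //.
  - by rewrite /mlen qlen_qe.
  - by rewrite /mlen qlen_qe.
  - by rewrite -UE (lY _ _ _ _ lB) /mlen /= lB.
  - by rewrite -stabN h1 hY (lY _ _ _ _ lB).
move: pz; rewrite hE => /q_pinch[ee vE].
have {}hE : h = csd (~~ hsign true B) s by rewrite hE vE ee.
exists s; split; first by rewrite vE ee.
  apply: kval_inj; [|exact: qlen_no_pinch|].
    apply: qlen_no_pinch; rewrite size_twist sz -lB'.
    by have := congr1 (@mk _ _) eq; rewrite hE csd_conj /= => ->.
  by have := congr1 (@mk _ _) eq; rewrite hE csd_conj.
by have := congr1 (@mt _ _) eq; rewrite hE csd_conj.
Qed.

Lemma kval_mulr bs w : bs != [::] ->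
  exists bs', [/\ kval bs * iX w = kval bs' , size bs' = size bs & hsign true bs' = hsign true bs].
Proof.
elim: bs => // -[e v] [|b bs] IH _.
  by exists [:: (e, v * w)]; rewrite /kval /= /bval /= iXM; gsimp.
have [bs' [eq sz _]] := IH isT; exists ((e, v) :: bs'); split; [|by rewrite /= sz|by []].
  by rewrite [kval (_ :: b :: _)]/(bval (e, v) * kval (b :: bs)) -mulgA eq.
Qed.

(** After the rotation given by [collins], the conjugator fixes the base vertex and
    [conj_base_twist] applies. For nontrivial t the rotated prefix passes through [phi t], hence the
    separate list [bs1]. *)
Lemma hyperbolic_conj bs bs' t t' (g : mil R) :
  bs != [::] -> bs' != [::] -> tight_blocks bs t -> tight_blocks bs' t' ->
  g * Mil (kval bs) t * g^-1 = Mil (kval bs') t' ->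
  exists j s bs1, [/\ j < size bs,
    (Mil (kval (take j bs)) 1)^-1 * Mil (kval bs) t * Mil (kval (take j bs)) 1 = Mil (kval bs1) t,
    bs1 != [::] & t = 1 -> bs1 = rot j bs] /\
    twist s (hsign true bs1) bs1 = bs' /\ s * t * s^-1 = t'.
Proof.
move=> bs0 bs0' tb tb' eq.
have tg := tight_blocks_mil bs0 tb; have tg' := tight_blocks_mil bs0' tb'.
have gs0 : blocks_mil t bs != [::] by rewrite -size_eq0 size_blocks_mil size_eq0.
have cV : cyc_len (@mlen X R) (g * prodl (blocks_mil t bs) * g^-1).
  by rewrite prodl_blocks_mil // eq; case: tb'.
have [j [h [js lh]]] := collins (mlenP R) gs0 tg cV.
rewrite (prodl_blocks_mil t bs0) eq size_blocks_mil in js *.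
(* A full rotation is replaced by the trivial one, since [take_blocks_mil] needs a proper prefix. *)
pose j' := if j == size bs then 0%N else j.
have {js} [js rj] : j' < size bs /\ rot j (blocks_mil t bs) = rot j' (blocks_mil t bs).
  rewrite /j'; case: eqP js => [->|/eqP ne js].
    by rewrite lt0n size_eq0 bs0 rot_oversize ?size_blocks_mil // rot0.
  by rewrite ltn_neqAle ne.
rewrite {}rj; move: j' js => {}j js.
rewrite prodl_rot prodl_blocks_mil // take_blocks_mil //.
set P := Mil (kval (take j bs)) 1 => eqV.
have d0 : drop j bs != [::] by rewrite -size_eq0 size_drop subn_eq0 -ltnNge.
have [bs1 [eq1 sz1 r1]] : exists bs1, [/\ P^-1 * Mil (kval bs) t * P = Mil (kval bs1) t,
    size bs1 = size bs & t = 1 -> bs1 = rot j bs].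
  have PE : P^-1 * Mil (kval bs) t = Mil (kval (drop j bs)) t.
    rewrite -{1}(cat_take_drop j bs) kval_cat; apply: (mulgI P); rewrite mulVKg.
    by rewrite milM /= phi_1 mul1g.
  rewrite PE; have [t1|tn1] := eqVneq t 1.
    exists (rot j bs); split=> //; last exact: size_rot.
    by rewrite t1 milM /= phi_1 mulg1 -kval_cat.
  rewrite milM /= mulg1 (phi_kval t true) !mulgA -iXV.
  have [c1 [-> sc1 _]] := kval_mulr ((sd (~~ hsign true (take j bs)) t)^-1) d0.
  rewrite -kval_cat.
  have [|c2 [-> sc2 _]] := kval_mulr (sd (~~ true) t) (bs := c1 ++ twist t true (take j bs)).
    by rewrite -size_eq0 size_cat sc1 size_twist addnC -size_cat cat_take_drop size_eq0.
  exists c2; split=> // [|t1]; last by rewrite t1 eqxx in tn1.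
  by rewrite sc2 size_cat sc1 size_twist addnC -size_cat cat_take_drop.
have bs10 : bs1 != [::] by rewrite -size_eq0 sz1 size_eq0.
have tgr : tight (@mlen X R) (rot j (blocks_mil t bs)) by exact: (tight_rot (mlenP R)).
have l1 : qlen (kval bs1) = size bs1.
  case: tgr => _ [_]; rewrite prodl_rot prodl_blocks_mil // take_blocks_mil // -/P eq1.
  by rewrite size_rot size_blocks_mil -sz1.
(* Both sizes are translation lengths of conjugate elements. *)
have sz' : size bs1 = size bs'.
  have := cyc_len_conj (mlenP R) (g := h) (u := Mil (kval bs1) t).
  rewrite -eq1 -eqV => /(_ _ _); case: tb' => lb' cb' /(_ _ cb').
  rewrite /mlen /= lb' => ->; last first.
    by case: tgr => _ []; rewrite prodl_rot prodl_blocks_mil // take_blocks_mil.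
  by have := congr1 (@mlen X R) eq1; rewrite /mlen [mk (Mil _ _)]/= => ->.
rewrite eq1 in eqV.
have [s [_ e1 e2]] := conj_base_twist bs10 bs0' l1 (proj1 tb') sz' lh (esym eqV).
by exists j, s, bs1.
Qed.

End Twist.

(** * List conjugacy in terms of blocks *)

Lemma nth_rot (T : Type) (d : T) j s i : j <= size s -> i < size s ->
  nth d (rot j s) i = nth d s ((i + j) %% size s).
Proof.
move=> js is_; rewrite /rot nth_cat size_drop nth_drop ltn_subRL addnC.
case: ltnP => h; first by rewrite modn_small // addnC.
rewrite nth_take; last by lia.
have -> : i + j = (i + j - size s) + size s by lia.
by rewrite modnDr modn_small; [congr (nth _ _ _); lia | lia].
Qed.

Section MixedSigns.
Variables (X : finType) (R : {fset word X}).
Local Notation FX := (fg X).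
Local Notation FT := (fg (X + R)%type).
Implicit Types (s t : FT) (e : bool) (w : FX) (bs : seq (bool * FX)).

Lemma hsignE e bs : hsign e bs = nth e (map fst bs) 0.
Proof. by case: bs. Qed.

Lemma nth_twist s e0 bs d i : i < size bs ->
  nth d (twist s e0 bs) i = let: (e, w) := nth d bs i in
    (e, sd e s * w * (sd (~~ nth e0 (map fst bs) i.+1) s)^-1).
Proof.
elim: bs i => // -[e w] bs IH [_|i /IH] /=; first by rewrite hsignE.
by move=> ->.
Qed.

(** The cyclic form of [no_pinch], with e0 the sign that follows the last block. *)
Fixpoint mixok e0 bs := if bs is (e, w) :: bs' then
  ((hsign e0 bs' == e) || (w != 1)) && mixok e0 bs' else true.

Lemma mixok_cat e0 bs bs' : mixok e0 (bs ++ bs') = mixok (hsign e0 bs') bs && mixok e0 bs'.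
Proof. by elim: bs => //= -[e w] bs ->; rewrite andbA; case: bs. Qed.

Lemma mixok_no_pinch e0 bs : mixok e0 bs -> no_pinch bs.
Proof.
elim: bs => //= -[e w] bs IH /andP[h /IH]; case: bs h {IH} => //= -[e' w'] bs h ->.
by move: h => /=; case: e'; case: e; case: (w == 1).
Qed.

Lemma hsign_cat e bs bs' : hsign e (bs ++ bs') = hsign (hsign e bs') bs.
Proof. by case: bs. Qed.

Lemma hsign_hsign bs : hsign (hsign true bs) bs = hsign true bs.
Proof. by case: bs. Qed.

Lemma mixok_tight bs : mixok (hsign true bs) bs -> tight_blocks (R := R) bs 1.
Proof.
move=> ok; have np : no_pinch (bs ++ bs).
  by apply: (@mixok_no_pinch (hsign true bs)); rewrite mixok_cat hsign_hsign ok.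
have np1 := mixok_no_pinch ok.
split; first exact: qlen_kval.
rewrite /cyc_len milM /= phi_1 mulg1 -kval_cat /mlen /= !qlen_kval // size_cat; lia.
Qed.

Fixpoint pow_mixed N e0 bs := if bs is (e, w) :: bs' then
  if hsign e0 bs' != e then (e, w ^+ N) :: bs' else (e, w) :: pow_mixed N e0 bs'
  else [::].

Fixpoint first_mixed e0 (sg : seq bool) : nat := if sg is e :: sg' then
  if head e0 sg' != e then 0%N else (first_mixed e0 sg').+1 else 0%N.

(** A sequence that differs from e0 somewhere and is closed up by e0 must change sign; the default
    e0 of [nth] covers a change after the last entry. *)
Lemma first_mixedP e0 sg : ~~ all (pred1 e0) sg ->
  first_mixed e0 sg < size sg /\
  nth e0 sg (first_mixed e0 sg).+1 = ~~ nth e0 sg (first_mixed e0 sg).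
Proof.
elim: sg => //= e sg IH; case: (eqVneq (head e0 sg) e) => [he|ne] /=; last first.
  by move=> _; rewrite nth0; move: ne; case: e; case: (head _ _).
move=> h; apply: IH; apply: contra h => a; rewrite a andbT -he.
by move: a; case: (sg) => [|b l] /=; rewrite ?eqxx // => /andP[].
Qed.

Lemma signs_pow_mixed N e0 bs : map fst (pow_mixed N e0 bs) = map fst bs.
Proof. by elim: bs => //= -[e w] bs IH; case: ifP => //= _; rewrite IH. Qed.

Lemma size_pow_mixed N e0 bs : size (pow_mixed N e0 bs) = size bs.
Proof. by rewrite -(size_map fst) signs_pow_mixed size_map. Qed.

Lemma nth_pow_mixed N e0 bs d i : i < size bs ->
  nth d (pow_mixed N e0 bs) i = let: (e, w) := nth d bs i in
    (e, if i == first_mixed e0 (map fst bs) then w ^+ N else w).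
Proof.
elim: bs i => // -[e w] bs IH i lt /=; rewrite -nth0 -hsignE.
case: ifP => _; case: i lt => //= i lt.
by case: (nth _ _ _).
Qed.

Lemma hsign_pow_mixed N e0 e bs : hsign e0 (pow_mixed N e bs) = hsign e0 bs.
Proof. by rewrite !hsignE signs_pow_mixed. Qed.

(** Between opposite signs the two factors of [twist] are mutually inverse: the coefficient is
    conjugated, which commutes with powers. *)
Lemma twist_pow_mixed N s e0 bs :
  twist s e0 (pow_mixed N e0 bs) = pow_mixed N e0 (twist s e0 bs).
Proof.
elim: bs => // -[e w] bs IH; rewrite [pow_mixed _ _ _]/= [in RHS]/= hsign_twist.
case: ifP => [ne|_] /=; last by rewrite IH hsign_pow_mixed.
have -> : hsign e0 bs = ~~ e by move: ne; case: e; case: (hsign _ _).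
by rewrite negbK conj_expg.
Qed.

End MixedSigns.

Section LetterLength.
Variable A : choiceType.
Implicit Types u v p : fg A.

Lemma fg_split wt u i : let p := of_word (take i (fgw u)) in
  [/\ fgw p = take i (fgw u), fgw (p^-1 * u) = drop i (fgw u) &
      (wlen wt p + wlen wt (p^-1 * u)%g = wlen wt u)%N].
Proof.
move=> p; have pE : fgw p = take i (fgw u) by rewrite /= red_id //; apply: take_sorted; exact: fgP.
have -> : p^-1 * u = of_word (drop i (fgw u)).
  by rewrite -{1}[u]of_wordK -{1}(cat_take_drop i (fgw u)) of_word_cat mulKg.
have dE : fgw (of_word (drop i (fgw u))) = drop i (fgw u).
  by rewrite /= red_id //; apply: drop_sorted; exact: fgP.
by split=> //; rewrite /wlen pE dE -wlenw_cat cat_take_drop.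
Qed.

Definition llen u := size (fgw u).

Lemma wlen_llen u : wlen (fun=> 1%N) u = llen u.
Proof. by rewrite /wlen /wlenw /llen; elim: (fgw u) => //= l w ->. Qed.

Lemma llenP : tree_length llen.
Proof.
have h := tree_length_wlen (A := A) (fun=> 1%N).
have g x y : gdist llen x y = gdist (wlen (fun=> 1%N)) x y by rewrite /gdist wlen_llen.
split; first by [].
- by move=> u; rewrite -!wlen_llen (tlenV h).
- by move=> a b c d; rewrite !g (tlen4 h).
- by move=> u v; rewrite -!wlen_llen (tlen_odd h).
- by move=> u; rewrite -!wlen_llen; exact: (tlenN h).
Qed.

Lemma llen_prefix u i : i <= llen u -> exists2 p, llen p <= llen u &
  llen p = i /\ (llen p + llen (p^-1 * u)%g = llen u)%N.
Proof.
move=> iu; have [pE _ lE] := fg_split (fun=> 1%N) u i.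
have pi : llen (of_word (take i (fgw u))) = i by rewrite /llen pE size_takel.
by exists (of_word (take i (fgw u))); [rewrite pi | split; rewrite // -!wlen_llen].
Qed.

Lemma llen_eq0 u : llen u = 0%N -> u = 1.
Proof. by move=> /size0nil h; apply: val_inj. Qed.

Lemma llen_of_word (w : word A) : llen (of_word w) <= size w.
Proof.
rewrite /llen /=; elim: w => //= l w IH; apply: leq_trans (push_cons_size _ (red_reduced _)) _.
by rewrite ltnS.
Qed.

(** The translation length of the power is N times that of u, which is at least one, and it bounds
    the length of every conjugate from below. *)
Lemma pow_conj_len u v g N : u != 1 -> g * u ^+ N * g^-1 = v -> N <= llen v.
Proof.
move=> u1 eq; have [p _ cu] := cyc_reduction llenP (@llen_prefix u).
set u0 := p^-1 * u * p in cu.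
have l0 : 0 < llen u0.
  rewrite lt0n; apply: contraNneq u1 => /llen_eq0 e; rewrite -(mulVKg p u) -(mulgK p (p^-1 * u)).
  by rewrite -/u0 e mul1g mulgV.
rewrite leqNgt; apply/negP => lt; pose m := (llen (p^-1 * g^-1)).*2.+1.
have e : u0 ^+ (N * m) = p^-1 * g^-1 * v ^+ m * (p^-1 * g^-1)^-1.
  have -> : u0 = p^-1 * u * p^-1^-1 by rewrite invgK.
  by rewrite -eq !conj_expg -expgnA; gsimp.
have := cyc_lenX llenP (N * m) cu; rewrite e.
have := lenM3 llenP (p^-1 * g^-1) (v ^+ m) (p^-1 * g^-1)^-1.
have := lenX llenP v m; rewrite (tlenV llenP).
move: (llen (_ * _ * _)) (llen (v ^+ m)) => a b h1 h2 h3.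
have h4 : m * llen v <= m * N.-1 by rewrite leq_mul2l; apply/orP; right; lia.
have h5 : N * m <= N * m * llen u0 by rewrite leq_pmulr.
by move: h1 h2 h3 h4 h5; rewrite /m; move: (llen _) => x; nia.
Qed.

End LetterLength.

(** Reading past the end returns the default, here the first sign: this is the cyclic convention. *)
Lemma nth_next_sign k (sg : k.-tuple bool) (i : 'I_k) :
  nth (head true sg) sg i.+1 = tnth sg (ordS i).
Proof.
rewrite (tnth_nth (head true sg)) /=; have lt := ltn_ord i.
have [lt'|ge] := ltnP i.+1 k; first by rewrite modn_small.
have e : i.+1 = k by apply/eqP; rewrite eqn_leq ge lt.
by rewrite e modnn nth_default ?size_tuple //; case: (tval sg).
Qed.

(** * List instances as rows made of a sign and two words *)

Section Rows.
Variables (X : finType) (R : {fset word X}).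
Local Notation row := (bool * (word X * word X))%type.
Local Notation FX := (fg X).
Implicit Types rows : seq row.

Definition lrows rows : seq (bool * word X) := [seq (r.1, r.2.1) | r <- rows].
Definition rrows rows : seq (bool * word X) := [seq (r.1, r.2.2) | r <- rows].
Definition gblocks (bs : seq (bool * word X)) : seq (bool * FX) := [seq (b.1,
  of_word b.2) | b <- bs].

Lemma signs_gblocks bs : map fst (gblocks bs) = map fst bs.
Proof. by rewrite /gblocks -map_comp. Qed.
Lemma signs_lrows rows : map fst (lrows rows) = map fst rows.
Proof. by rewrite /lrows -map_comp. Qed.
Lemma signs_rrows rows : map fst (rrows rows) = map fst rows.
Proof. by rewrite /rrows -map_comp. Qed.

Definition iso_rows rows := iso_blocks R (gblocks (lrows rows)) (gblocks (rrows rows)).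

Definition rows_of (L : list_instance X) : seq row :=
  zip (li_sigma L) (zip (li_u L) (li_v L)).

Definition rsign rows : bool := head true (map fst rows).

Lemma hsign_gblocks bs : hsign true (gblocks bs) = head true (map fst bs).
Proof. by rewrite hsignE nth0 signs_gblocks. Qed.

Lemma size_rows_of L : size (rows_of L) = li_k L.
Proof. by rewrite !size_zip !size_tuple !minnn. Qed.

Lemma signs_rows_of L : map fst (rows_of L) = li_sigma L.
Proof. by rewrite -/(unzip1 _) unzip1_zip // !size_zip !size_tuple minnn. Qed.

Lemma nth_rows_of L d (i : 'I_(li_k L)) : nth d (rows_of L) i =
  (tnth (li_sigma L) i, (tnth (li_u L) i, tnth (li_v L) i)).
Proof.
case: d => d1 [d2 d3]; rewrite nth_zip; last by rewrite !size_zip !size_tuple minnn.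
by rewrite nth_zip ?size_tuple // -!tnth_nth.
Qed.

Lemma twist_rowsP rows (s : fg (X + R)%type) :
  twist s (rsign rows) (gblocks (lrows rows)) = gblocks (rrows rows) <->
  forall i, i < size rows ->
    let: (e, (u, v)) := nth (true, ([::], [::])) rows i in
    sd e s * of_word u * (sd (~~ nth (rsign rows) (map fst rows) i.+1) s)^-1 = of_word v.
Proof.
pose d : bool * FX := (true, 1).
have nl i : i < size rows -> nth d (gblocks (lrows rows)) i =
    let: (e, (u, v)) := nth (true, ([::], [::])) rows i in (e, of_word u).
  move=> lt; rewrite /gblocks /lrows -map_comp (nth_map (true, ([::], [::]))) //=.
  by case: (nth _ _ _) => e [u v].
have nr i : i < size rows -> nth d (gblocks (rrows rows)) i =
    let: (e, (u, v)) := nth (true, ([::], [::])) rows i in (e, of_word v).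
  move=> lt; rewrite /gblocks /rrows -map_comp (nth_map (true, ([::], [::]))) //=.
  by case: (nth _ _ _) => e [u v].
have szl : size (gblocks (lrows rows)) = size rows by rewrite !size_map.
have szr : size (gblocks (rrows rows)) = size rows by rewrite !size_map.
split=> h.
  move=> i lt; have := nr i lt; rewrite -h nth_twist ?szl // nl //.
  rewrite signs_gblocks signs_lrows.
  by case: (nth _ rows i) => e [u v] /(congr1 snd).
apply: (@eq_from_nth _ d); rewrite size_twist szl ?szr // => i lt.
rewrite nth_twist ?szl // signs_gblocks signs_lrows.
by rewrite nl // nr //; move: (h i lt); case: (nth _ rows i) => e [u v] ->.
Qed.

Lemma iso_rowsP rows : iso_rows rows <->
  exists s : fg (X + R)%type, forall i, i < size rows ->
    let: (e, (u, v)) := nth (true, ([::], [::])) rows i in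
    sd e s * of_word u * (sd (~~ nth (rsign rows) (map fst rows) i.+1) s)^-1 = of_word v.
Proof.
have sE : hsign true (gblocks (lrows rows)) = rsign rows by rewrite hsign_gblocks signs_lrows.
by rewrite /iso_rows /iso_blocks sE; split=> -[s /twist_rowsP h]; exists s.
Qed.

(** The dictionary is w = a(s) and w e = b(s). The signs on both sides of a coefficient then select
    exactly the four cases of the definition, and [sd_surj] and [sd_group_eq] identify the
    attainable pairs. *)
Lemma iso_list_conjP L : iso_list_conj R L <-> iso_rows (rows_of L).
Proof.
rewrite iso_rowsP size_rows_of; set d := (true, _).
have key (s : fg (X + R)%type) w e : aX s = of_word w -> bX s = of_word w * of_word e ->
    (forall i : 'I_(li_k L),
      let u := tnth (li_u L) i in
      let v := tnth (li_v L) i in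
      match tnth (li_sigma L) i, tnth (li_sigma L) (ordS i) with
      | true, true => free_eq (w ++ e ++ u ++ winv w) v
      | true, false => free_eq (w ++ e ++ u ++ winv e ++ winv w) v
      | false, true => free_eq (w ++ u ++ winv w) v
      | false, false => free_eq (w ++ u ++ winv e ++ winv w) v
      end) <->
   forall i, i < li_k L ->
    let: (e, (u, v)) := nth d (rows_of L) i in
    sd e s * of_word u * (sd (~~ nth (rsign (rows_of L)) (map fst (rows_of L)) i.+1) s)^-1 =
      of_word v.
  move=> sa sb; have main (i : 'I_(li_k L)) :
      (match tnth (li_sigma L) i, tnth (li_sigma L) (ordS i) with
      | true, true => free_eq (w ++ e ++ tnth (li_u L) i ++ winv w) (tnth (li_v L) i)
      | true, false => free_eq (w ++ e ++ tnth (li_u L) i ++ winv e ++ winv w) (tnth (li_v L) i)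
      | false, true => free_eq (w ++ tnth (li_u L) i ++ winv w) (tnth (li_v L) i)
      | false, false => free_eq (w ++ tnth (li_u L) i ++ winv e ++ winv w) (tnth (li_v L) i)
      end) <-> (let: (e, (u, v)) := nth d (rows_of L) i in
    sd e s * of_word u * (sd (~~ nth (rsign (rows_of L)) (map fst (rows_of L)) i.+1) s)^-1 =
      of_word v).
    rewrite nth_rows_of /rsign signs_rows_of nth_next_sign.
    by case: (tnth _ i); case: (tnth _ (ordS i)); rewrite free_eqP !of_word_cat !of_word_winv
      /sd /= ?sa ?sb ?invgM ?mulgA.
  split=> h i; last exact/main/h.
  by move=> lt; apply/(main (Ordinal lt))/h.
split=> [[w [e [/PresSym eG h]]]|[s h]].
  have [|s [sa sb]] := @sd_surj X R w (w ++ e).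
    by rewrite -{1}[w]cats0; apply: pres_eq_ctxl.
  by exists s; apply/(key s w e) => //; rewrite sb of_word_cat.
exists (fgw (aX s)), (winv (fgw (aX s)) ++ fgw (bX s)); split; last first.
  by apply/(key s) => //; rewrite ?of_word_cat ?of_word_winv ?of_wordK ?mulVKg.
apply: PresTrans (winv_l _ (fgw (aX s))); apply: pres_eq_ctxl.
exact/PresSym/sd_group_eq.
Qed.

Fixpoint adm e0 rows : bool := if rows is (e, (u, v)) :: rows' then
  [|| head e0 (map fst rows') == e, of_word u != 1 | of_word v != 1] && adm e0 rows' else true.

Definition adm_at e0 rows i : bool := let: (e, (u, v)) := nth (true, ([::], [::])) rows i in
  [|| nth e0 (map fst rows) i.+1 == e, of_word u != 1 | of_word v != 1].

Lemma admP e0 rows : reflect (forall i, i < size rows -> adm_at e0 rows i) (adm e0 rows).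
Proof.
apply: (iffP idP).
  elim: rows => // -[e [u v]] rows IH /= /andP[h a] [_|i lt]; last exact: IH.
  by rewrite /adm_at /= nth0.
elim: rows => // -[e [u v]] rows IH /= h; apply/andP; split.
  by have := h 0%N isT; rewrite /adm_at /= nth0.
by apply: IH => i; exact: (h i.+1).
Qed.

Lemma list_admissibleP L :
  list_admissible L <-> 0 < size (rows_of L) /\ adm (rsign (rows_of L)) (rows_of L).
Proof.
rewrite /list_admissible size_rows_of.
have main (i : 'I_(li_k L)) : (tnth (li_sigma L) i = ~~ tnth (li_sigma L) (ordS i) ->
     ~ (free_eq (tnth (li_u L) i) [::] /\ free_eq (tnth (li_v L) i) [::])) <->
   adm_at (rsign (rows_of L)) (rows_of L) i.
  rewrite /adm_at nth_rows_of /rsign signs_rows_of nth_next_sign !free_eqP !of_word_nil.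
  set a := tnth _ _; set b := tnth _ _; case: (eqVneq b a) => [->|ne] /=.
    by split=> // _; case: (a).
  have -> : a = ~~ b by move: ne; case: a; case: b.
  split=> [/(_ erefl) h|h _ [h1 h2]]; last by rewrite h1 h2 !eqxx in h.
  by rewrite -negb_and; apply/andP => -[/eqP h1 /eqP h2]; case: h.
split=> -[k0 h]; split=> //.
  by apply/admP; rewrite size_rows_of => i lt; apply: (main (Ordinal lt)).1; exact: h.
move: h => /admP; rewrite size_rows_of => h i; exact/main/h.
Qed.

Definition list_of rows : list_instance X :=
  @ListInstance X (size rows) (map_tuple (fun r : row => r.2.1) (in_tuple rows))
    (map_tuple (fun r : row => r.2.2) (in_tuple rows)) (map_tuple fst (in_tuple rows)).

Lemma list_ofK rows : rows_of (list_of rows) = rows.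
Proof. by rewrite /rows_of /=; elim: rows => //= -[e [u v]] rows ->. Qed.

End Rows.

(** * Exclusion of rotations by a large power *)

Lemma modn_add_id p j m : p < m -> j < m -> (p + j) %% m = p -> j = 0%N.
Proof.
move=> lp lj; have [lt|ge] := ltnP (p + j) m; first by rewrite modn_small // => e; lia.
have -> : p + j = (p + j - m) + m by lia.
by rewrite modnDr modn_small => [e|]; lia.
Qed.

Section Rigid.
Variables (X : finType) (R : {fset word X}).
Local Notation FX := (fg X).
Local Notation FT := (fg (X + R)%type).
Implicit Types (s t : FT) (e : bool) (w : FX) (gu gv : seq (bool * FX)).

Lemma mixokP e0 gu d i : mixok e0 gu -> i < size gu ->
  nth e0 (map fst gu) i.+1 = ~~ (nth d gu i).1 -> (nth d gu i).2 != 1.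
Proof.
elim: gu i => // -[e w] gu IH [|i] /= /andP[h ok] lt; last exact: IH.
by rewrite nth0 => hd; move: h; rewrite hsignE nth0 hd; case: (e).
Qed.

Lemma pow_neq1 w N : 0 < N -> w != 1 -> w ^+ N != 1.
Proof.
move=> N0 w1; apply/eqP => wN; have := @pow_conj_len _ w 1 1 N w1.
by rewrite wN mulg1 mulgV => /(_ erefl); rewrite leqNgt N0.
Qed.

Lemma mixok_pow N e0 gu : 0 < N -> mixok e0 gu -> mixok e0 (pow_mixed N e0 gu).
Proof.
move=> N0; elim: gu => //= -[e w] gu IH /andP[h /[dup] ok /IH IH']; case: ifP => he /=.
  by rewrite ok andbT; move: h; rewrite (negbTE he) /= => /(pow_neq1 N0) ->.
by rewrite hsign_pow_mixed h.
Qed.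

(* The large power at a single mixed position, conjugate to no other coefficient, excludes
   rotations in conjugacies between such blocks. *)
Definition rigid N gu := gu ++ pow_mixed N (hsign true gu) gu.

Lemma hsign_rigid N gu : hsign true (rigid N gu) = hsign true gu.
Proof. by case: gu. Qed.

Lemma twist_rigid s N gu : twist s (hsign true gu) (rigid N gu) =
  rigid N (twist s (hsign true gu) gu).
Proof.
rewrite /rigid twist_cat hsign_pow_mixed hsign_hsign twist_pow_mixed hsign_twist.
by [].
Qed.

Lemma rigid_inj N gu gv : size gu = size gv -> rigid N gu = rigid N gv -> gu = gv.
Proof.
by move=> sz /eqP; rewrite /rigid eqseq_cat // => /andP[/eqP].
Qed.

Lemma tight_rigid N gu : 0 < N -> mixok (hsign true gu) gu -> tight_blocks (R := R) (rigid N gu) 1.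
Proof.
move=> N0 ok; apply: mixok_tight; rewrite hsign_rigid mixok_cat hsign_pow_mixed hsign_hsign ok.
exact: mixok_pow.
Qed.

(** The right-hand list has its power at index n + m, between opposite signs, so the coefficient of
    the rotated left list at this index is conjugate to an N-th power and has length at least N. By
    [short] it comes from index n + m, hence j = 0. *)
Lemma rot_rigid N gu gv j s :
  map fst gu = map fst gv -> mixok (hsign true gv) gv ->
  (all (pred1 (hsign true gu)) (map fst gu) -> size gu = 1%N) ->
  (forall b, b \in gu -> llen b.2 < N) -> j < size (rigid N gu) ->
  twist s (hsign true (rot j (rigid N gu))) (rot j (rigid N gu)) = rigid N gv ->
  rot j (rigid N gu) = rigid N gu.
Proof.
move=> sg okv single short js eq; set h := hsign true gu in single *.
have hv : hsign true gv = h by rewrite /h !hsignE sg.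
(* A single block offers no place for a power, but its doubled list is invariant under rotation. *)
have [/single sz1|mx] := boolP (all (pred1 h) (map fst gu)).
  move: js; rewrite /rigid; move: sz1 => {eq short single}; rewrite /h.
  case: gu {sg hv h} => // -[e w] [] //= _; rewrite eqxx /=.
  by case: j => [|[|]].
have [ltm nxt] := first_mixedP mx; set m := first_mixed _ _ in ltm nxt.
set sgm := map fst gu in sg ltm nxt mx; set n := size gu.
have szs : size sgm = n by rewrite size_map.
have szv : size gv = n by rewrite /n -(size_map fst gu) -/sgm sg size_map.
have szB : size (rigid N gu) = n + n by rewrite size_cat size_pow_mixed.
have szB' : size (rigid N gv) = n + n by rewrite size_cat size_pow_mixed szv.
have sB : map fst (rot j (rigid N gu)) = sgm ++ sgm.
  rewrite -(signs_twist s (hsign true (rot j (rigid N gu)))) eq map_cat signs_pow_mixed.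
  by rewrite -sg.
have h1 : hsign true (rot j (rigid N gu)) = h.
  rewrite hsignE sB /h hsignE -/sgm; by case: (sgm) ltm.
pose d : bool * FX := (true, 1); pose p := n + m.
have mn : m < n by rewrite -szs.
have pB : p < size (rigid N gu) by rewrite szB ltn_add2l.
have := congr1 (fun c => nth d c p) eq; rewrite nth_twist ?size_rot // h1.
have -> : nth h (map fst (rot j (rigid N gu))) p.+1 = ~~ nth h sgm m.
  have -> : p.+1 = n + m.+1 by rewrite /p addnS.
  by rewrite sB nth_cat szs ltnNge leq_addr /= addKn.
have e1 : nth h (map fst (rot j (rigid N gu))) p = (nth d (rot j (rigid N gu)) p).1.
  by rewrite (nth_map d) ?size_rot.
rewrite sB nth_cat szs ltnNge leq_addr /= /p addKn in e1.
have -> : nth d (rigid N gv) (n + m) = ((nth d gv m).1, (nth d gv m).2 ^+ N).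
  rewrite nth_cat szv ltnNge leq_addr addKn nth_pow_mixed ?szv // -sg hv -/sgm -/m eqxx.
  by case: (nth d gv m).
have ev : (nth d gv m).1 = nth h sgm m by rewrite sg (nth_map d) ?szv.
case E: (nth d (rot j (rigid N gu)) p) e1 => [e x] /= e1.
case=> _ eqx.
have v1 : (nth d gv m).2 != 1.
  by apply: mixokP okv _ _; rewrite ?szv // hv -sg ev.
rewrite e1 negbK in eqx.
have := pow_conj_len (u := (nth d gv m).2) (v := x) (g := (sd e s)^-1) (N := N) v1.
rewrite -eqx; gsimp => /(_ erefl).
have xE : (nth d (rigid N gu) ((p + j) %% (n + n))) = (e, x).
  by rewrite -E nth_rot ?szB //; [apply: ltnW; rewrite -szB | rewrite -szB].
have short' i : i < n -> llen (nth d gu i).2 < N by move=> lt; apply: short; exact: mem_nth.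
set i := (p + j) %% (n + n) in xE.
have [ip|ip] := eqVneq i p.
  have j0 : j = 0%N.
    by apply: (modn_add_id (p := p) (m := n + n)) ip; rewrite -szB.
  by rewrite j0 rot0.
have iB : i < n + n by rewrite ltn_mod addn_gt0 (leq_ltn_trans _ mn).
clearbody i.
suff : llen x < N by rewrite ltnNge => /negbTE ->.
rewrite -[x]/((e, x).2) -xE nth_cat; case: (ltnP i (size gu)) => lt; first exact: short'.
have lt' : i - n < n by rewrite -(ltn_add2l n) subnKC.
rewrite nth_pow_mixed // -/h -/sgm -/m.
have -> : (i - n == m) = false by apply: contraNF ip => /eqP im; rewrite /p -im subnKC.
by have := short' (i - n) lt'; case: (nth d gu (i - n)).
Qed.

Lemma rigid_conjP N gu gv :
  gu != [::] -> map fst gu = map fst gv ->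
  mixok (hsign true gu) gu -> mixok (hsign true gv) gv ->
  (all (pred1 (hsign true gu)) (map fst gu) -> size gu = 1%N) ->
  (forall b, b \in gu -> llen b.2 < N) ->
  iso_blocks R gu gv <->
  exists g : mil R, g * Mil (kval (rigid N gu)) 1 * g^-1 = Mil (kval (rigid N gv)) 1.
Proof.
move=> gu0 sg oku okv single short.
have N0 : 0 < N.
  by move: short; case: (gu) gu0 => // b g _ /(_ b (mem_head _ _)); apply: leq_ltn_trans.
have szv : size gu = size gv by rewrite -(size_map fst) sg size_map.
have gv0 : gv != [::] by rewrite -size_eq0 -szv size_eq0.
have ne g : g != [::] -> rigid N g != [::] by case: g.
split=> [[s tE]|[g eq]].
  exists (csd (~~ hsign true (rigid N gu)) s).
  by rewrite csd_conj hsign_rigid twist_rigid tE mulg1 mulgV.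
have [j [s [bs1 [[js _ _ /(_ erefl) ->] [tE _]]]]] :=
  hyperbolic_conj (ne _ gu0) (ne _ gv0) (tight_rigid N0 oku) (tight_rigid N0 okv) eq.
exists s; have rE := rot_rigid sg okv single short js tE.
move: tE; rewrite rE hsign_rigid twist_rigid => /rigid_inj; apply.
by rewrite size_twist.
Qed.

(** When all signs are equal, products of coefficients at mixed positions are determined;
    they break the rotational symmetry. *)
Lemma iso_const_ext e gu gv u v u' v' :
  gu != [::] -> all (pred1 e) (map fst gu) -> map fst gu = map fst gv ->
  (forall s, twist s e gu = gv -> [/\ sd e s * u * (sd (~~ e) s)^-1 = v &
     sd e s * u' * (sd (~~ e) s)^-1 = v']) ->
  iso_blocks R gu gv <->
  iso_blocks R (gu ++ [:: (e, u * u'^-1); (~~ e, u^-1 * u')])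
             (gv ++ [:: (e, v * v'^-1); (~~ e, v^-1 * v')]).
Proof.
move=> gu0 al sg hv.
have he : hsign true gu = e by move: al; rewrite hsignE; case: (gu) gu0 => // b g _ /= /andP[/eqP].
have szv : size gv = size gu by rewrite -(size_map fst) -sg size_map.
rewrite /iso_blocks hsign_cat /= he; have -> : hsign e gu = e by rewrite hsignE; move: he;
  rewrite hsignE; case: (gu) gu0.
split=> -[s eq]; exists s; move: eq; rewrite twist_cat /=; last first.
  by move=> /eqP; rewrite eqseq_cat ?size_twist // => /andP[/eqP].
move=> eq; rewrite eq; have [<- <-] := hv s eq; congr (_ ++ [:: (_, _); (_, _)]).
  by rewrite negbK; gsimp.
by gsimp.
Qed.

End Rigid.

(** * The reduction from list conjugacy to conjugacy in M(G) *)

Section Query.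
Variables (X : finType) (R : {fset word X}).
Local Notation row := (bool * (word X * word X))%type.
Local Notation FX := (fg X).
Implicit Types (rows : seq row) (bs : seq (bool * word X)).

Definition eqw (u v : word X) : bool := red u == red v.

Lemma eqwE u v : eqw u v = (of_word u == of_word v).
Proof. by rewrite -(inj_eq val_inj). Qed.

(** For a constant sign, rows all equal to the first impose one condition only and are cut to one
    row. Otherwise a row different from the first gives the products of [iso_const_ext], and the
    difference makes the extended list admissible. *)
Definition ext_rows rows : seq row :=
  if rows is (e, (u, v)) :: _ then
    if all (pred1 e) (map fst rows) then
      match [seq r <- rows | ~~ (eqw r.2.1 u && eqw r.2.2 v)] with
      | [::] => [:: (e, (u, v))]
      | (_, (u', v')) :: _ =>
        rows ++ [:: (e, (u ++ winv u', v ++ winv v')); (~~ e, (winv u ++ u', winv v ++ v'))]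
      end
    else rows
  else [::].

(** Between opposite signs u and v must be conjugate, hence trivial together, and admissibility then
    makes both nontrivial. A failure therefore settles the instance negatively. *)
Fixpoint good_rows e0 rows : bool := if rows is (e, (u, v)) :: rows' then
  ((head e0 (map fst rows') == e) || ~~ eqw u [::] && ~~ eqw v [::]) && good_rows e0 rows'
  else true.

Definition wpow N (w : word X) : word X := iter N (cat w) [::].

Fixpoint wpow_mixed N e0 bs := if bs is (e, w) :: bs' then
  if head e0 (map fst bs') != e then (e, wpow N w) :: bs' else (e, w) :: wpow_mixed N e0 bs'
  else [::].

Definition block_word bs : word (miller_gen R) :=
  flatten [seq (mq R, b.1) :: miller_word R b.2 | b <- bs].

Definition query rows : word (miller_gen R) * word (miller_gen R) :=
  let rows2 := ext_rows rows in
  let h := rsign rows2 in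
  if good_rows h rows2 then
    (* Larger than the length of every left coefficient, as [rigid_conjP] asks. *)
    let N := (sumn [seq size r.2.1 | r <- rows2]).+1 in
    (block_word (lrows rows2 ++ wpow_mixed N h (lrows rows2)),
     block_word (rrows rows2 ++ wpow_mixed N h (rrows rows2)))
  (* A fixed negative instance: q has odd q-length, so it is not conjugate to 1. *)
  else ([:: gen (mq R)], [::]).

Lemma mu_block_word bs : mu (block_word bs) = Mil (kval (gblocks bs)) 1.
Proof.
elim: bs => // -[e w] bs IH.
transitivity (mu (kword R [:: (None, e)] ++ miller_word R w ++ block_word bs)) => //.
rewrite !mu_cat IH miller_wordE !mu_kword -iX_of_word -qe_of_word !mil_homK.
by rewrite [kval (gblocks (_ :: _))]/(qe e * iX (of_word w) * kval (gblocks bs)) mulgA.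
Qed.

Lemma of_word_wpow N w : of_word (wpow N w) = of_word w ^+ N.
Proof. by elim: N => // N IH; rewrite /wpow iterS -/(wpow N w) of_word_cat IH expgS. Qed.

Lemma gblocks_cat bs bs' : gblocks (bs ++ bs') = gblocks bs ++ gblocks bs'.
Proof. exact: map_cat. Qed.

Lemma gblocks_wpow_mixed N e0 bs : gblocks (wpow_mixed N e0 bs) = pow_mixed N e0 (gblocks bs).
Proof.
elim: bs => //= -[e w] bs IH /=; rewrite hsignE nth0 signs_gblocks.
by case: ifP => _ /=; rewrite ?of_word_wpow ?IH.
Qed.

Lemma good_rowsE e0 rows : good_rows e0 rows =
  mixok e0 (gblocks (lrows rows)) && mixok e0 (gblocks (rrows rows)).
Proof.
elim: rows => //= -[e [u v]] rows IH /=; rewrite IH !hsignE !nth0 !signs_gblocks.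
rewrite signs_lrows signs_rrows !eqwE !of_word_nil.
by case: (_ == e) => //=; rewrite !andbA; congr (_ && _); rewrite -!andbA; congr (_ && _);
  rewrite andbC.
Qed.

Lemma iso_good e0 rows (s : fg (X + R)%type) : adm e0 rows ->
  twist s e0 (gblocks (lrows rows)) = gblocks (rrows rows) -> good_rows e0 rows.
Proof.
elim: rows => //= -[e [u v]] rows IH /andP[h a] /= [+ /(IH a) ->]; rewrite andbT.
rewrite hsignE nth0 signs_gblocks signs_lrows !eqwE of_word_nil.
case: eqP h => //= he; have {he} -> : head e0 (map fst rows) = ~~ e.
  by move: he; case: e; case: (head _ _).
rewrite negbK => h eq; have : (of_word u == 1) = (of_word v == 1).
  have -> : of_word v = sd e s * of_word u * (sd e s)^-1 by apply: val_inj.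
  apply/eqP/eqP => [->|h']; first by gsimp.
  by apply: (mulgI (sd e s)); apply: (mulIg (sd e s)^-1); rewrite h'; gsimp.
by move=> e1; move: h; rewrite e1 orbb => ->.
Qed.

Lemma ext_rowsP rows : rows != [::] -> adm (rsign rows) rows ->
  [/\ ext_rows rows != [::], adm (rsign (ext_rows rows)) (ext_rows rows),
      all (pred1 (rsign (ext_rows rows))) (map fst (ext_rows rows)) -> size (ext_rows rows) = 1%N &
      iso_rows R rows <-> iso_rows R (ext_rows rows)].
Proof.
case E: rows => [//|[e [u v]] rows'] _; rewrite -E => ad.
have he : rsign rows = e by rewrite E.
have -> : ext_rows rows = if all (pred1 e) (map fst rows) then
      match [seq r <- rows | ~~ (eqw r.2.1 u && eqw r.2.2 v)] with
      | [::] => [:: (e, (u, v))]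
      | (_, (u', v')) :: _ =>
        rows ++ [:: (e, (u ++ winv u', v ++ winv v')); (~~ e, (winv u ++ u', winv v ++ v'))]
      end
    else rows by rewrite E.
case: ifP => al; last first.
  split=> //; first by rewrite E.
  by rewrite he al.
have nx i : nth e (map fst rows) i = e.
  have [lt|ge] := ltnP i (size (map fst rows)); last by rewrite nth_default.
  by move: al => /(all_nthP e)/(_ i lt)/eqP.
case F: (filter _ _) => [|[e' [u' v']] fs].
  split=> //=; first by rewrite eqxx.
  have same i : i < size rows -> let: (e', (u', v')) := nth (true, ([::], [::])) rows i in
      [/\ e' = e, of_word u' = of_word u & of_word v' = of_word v].
    move=> lt; set r := nth _ rows i; have rin : r \in rows by exact: mem_nth.
    have re : r.1 = e by rewrite -(nx i) (nth_map (true, ([::], [::]))).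
    have : r \notin [seq r <- rows | ~~ (eqw r.2.1 u && eqw r.2.2 v)] by rewrite F.
    rewrite mem_filter rin andbT negbK !eqwE; move: re; clearbody r.
    by case: r {rin} => e' [u' v'] /= -> /andP[/eqP -> /eqP ->].
  rewrite !iso_rowsP; split=> -[s h]; exists s.
    case=> // _ /=; have lt : 0 < size rows by rewrite E.
    by have := h 0%N lt; have := nx 1%N; rewrite {1 2 4}E /= he => ->.
  move=> i lt; have := h 0%N isT; have := same i lt; case: (nth _ _ _) => e' [u' v'] [-> -> ->].
  by rewrite he nx.
have rin : (e', (u', v')) \in rows /\ ~~ (eqw u' u && eqw v' v).
  have : (e', (u', v')) \in [seq r <- rows | ~~ (eqw r.2.1 u && eqw r.2.2 v)].
    by rewrite F mem_head.
  by rewrite mem_filter => /andP[].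
case: rin => rin neq.
have rs : rsign (rows ++ [:: (e, (u ++ winv u', v ++ winv v')); (~~ e, (winv u ++ u',
  winv v ++ v'))]) = e.
  by rewrite E.
split.
- by rewrite E.
- rewrite rs; move: neq; rewrite !eqwE negb_and => neq.
  have ad1 : adm e [:: (e, (u ++ winv u', v ++ winv v')); (~~ e, (winv u ++ u', winv v ++ v'))].
    rewrite /= !of_word_cat !of_word_winv andbT; apply/andP; split; apply/or3P.
      case/orP: neq => ne; [apply: Or32 | apply: Or33]; apply: contra ne => /eqP/divg1_eq ->;
        exact: eqxx.
    case/orP: neq => ne; [apply: Or32 | apply: Or33]; apply: contra ne => /eqP/mulg1_eq;
      rewrite invgK => ->; exact: eqxx.
  have adc r1 r2 : adm e (r1 ++ r2) = adm (head e (map fst r2)) r1 && adm e r2.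
    by elim: r1 => //= -[a [b c]] r1 ->; rewrite andbA map_cat; case: (r1).
  by rewrite adc ad1 /= -he ad.
- by rewrite rs map_cat all_cat /= eqxx; case: (e) => /=; rewrite andbF.
have sg : map fst (gblocks (lrows rows)) = map fst rows by rewrite signs_gblocks signs_lrows.
have := @iso_const_ext X R e (gblocks (lrows rows)) (gblocks (rrows rows)) (of_word u) (of_word v) (of_word
  u') (of_word v').
rewrite sg !signs_gblocks signs_rrows.
case=> //; first by rewrite E.
  move=> s tE; have h : forall r, r \in rows -> sd e s * of_word r.2.1 * (sd (~~ e) s)^-1 =
    of_word r.2.2.
    move=> r; rewrite -he in tE; move: tE => /twist_rowsP h /(nthP (true, ([::], [::])))[i lt <-].
    have := h i lt; have : (nth (true, ([::], [::])) rows i).1 =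
      e by rewrite -(nx i) (nth_map (true, ([::], [::]))).
    by rewrite he nx; case: (nth _ _ _) => a [b c] /= ->.
  split; last exact: (h _ rin).
  by apply: (h (e, (u, v))); rewrite E mem_head.
rewrite /iso_rows /lrows /rrows !map_cat !gblocks_cat /= !of_word_cat !of_word_winv.
by move=> h1 h2; split.
Qed.

Theorem queryP rows : rows != [::] -> adm (rsign rows) rows ->
  iso_rows R rows <-> pres_conj (@miller_rel X R) (query rows).1 (query rows).2.
Proof.
move=> r0 ad; have [r20 ad2 single ->] := ext_rowsP r0 ad.
rewrite /query; move: (ext_rows rows) r20 ad2 single => {r0 ad}rows r0 ad single.
have hl : hsign true (gblocks (lrows rows)) = rsign rows by rewrite hsign_gblocks signs_lrows.
have hr : hsign true (gblocks (rrows rows)) = rsign rows by rewrite hsign_gblocks signs_rrows.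
case: ifP => good; last first.
  split=> [[s]|/miller_conjP [g eq]]; first by rewrite hl => /(iso_good ad); rewrite good.
  have := congr1 (@mlen X R) eq; have := tlen_odd (@mlenP X R).
  have -> : mu ([::] : word (miller_gen R)) = 1 by [].
  have -> : mu [:: gen (mq R)] = Mil (qe true) 1 by rewrite /mu /= mulg1.
  move=> od /(congr1 odd); rewrite !od (tlenV (@mlenP X R)) (tlen1 (@mlenP X R)).
  by rewrite /mlen qlen_qe; case: (odd _).
move: good; rewrite good_rowsE => /andP[gl gr].
rewrite miller_conjP /= !mu_block_word !gblocks_cat !gblocks_wpow_mixed.
set N := _.+1; rewrite /iso_rows.
have := @rigid_conjP X R N (gblocks (lrows rows)) (gblocks (rrows rows)).
rewrite /rigid hl hr !signs_gblocks signs_lrows signs_rrows; apply=> //.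
- by case: (rows) r0.
- by move=> /single; rewrite !size_map.
move=> b /mapP[c /mapP[r rin ->] ->] /=; rewrite /N ltnS; apply: leq_trans (llen_of_word _) _.
move: rin; rewrite /=; elim: (rows) => //= r' rs IH; rewrite inE => /orP[/eqP ->|/IH le].
  exact: leq_addr.
by apply: leq_trans le _; exact: leq_addl.
Qed.

End Query.

(** * Bounded conjugators *)

Section FreeConjugators.
Variable A : choiceType.
Implicit Types s t u v p : fg A.

Lemma llen_conj0 t : llen (t * t) <= llen t -> t = 1.
Proof.
move=> h; have [p _ /llen_eq0 e] := elliptic_midpoint (@llenP A) (@llen_prefix A t) h.
by rewrite -(mulVKg p t) -(mulgK p (p^-1 * t)) e mul1g mulgV.
Qed.

Lemma commX t n : t ^+ n * t = t * t ^+ n. Proof. by rewrite -expgS expgSr. Qed.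

(** Descent on the length within the coset of s; the integer exponent of t is the difference of m1
    and m2. *)
Lemma coset_min t s : exists s0 m1 m2, [/\ s = s0 * t ^+ m1 * t ^- m2,
  llen s0 <= llen (s0 * t) & llen s0 <= llen (s0 * t^-1)].
Proof.
have [n] := ubnP (llen s); elim: n s => // n IH s lt.
have [h1|h1] := ltnP (llen (s * t)) (llen s).
  have [|s0 [m1 [m2 [e l1 l2]]]] := IH (s * t); first by lia.
  exists s0, m1, m2.+1; split=> //; rewrite -(mulgK t s) e.
  by rewrite (expgS t m2) invgM !mulgA.
have [h2|h2] := ltnP (llen (s * t^-1)) (llen s).
  have [|s0 [m1 [m2 [e l1 l2]]]] := IH (s * t^-1); first by lia.
  exists s0, m1.+1, m2; split=> //; rewrite -(mulgVK t s) e -!mulgA; congr (_ * _).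
  rewrite expgSr -!mulgA; congr (_ * _).
  by apply: (mulgI (t ^+ m2)); rewrite mulVKg mulgA -expgSr expgS -mulgA mulgV mulg1.
by exists s, 0%N, 0%N; rewrite !expg0; gsimp.
Qed.

(** Powers of t commute with t, so a locally shortest element of the coset still conjugates t to t',
    and [short_conjugator] bounds it. *)
Lemma conj_split s t t' : t != 1 -> s * t * s^-1 = t' ->
  exists s0 m1 m2, [/\ s = s0 * t ^+ m1 * t ^- m2, s0 * t * s0^-1 = t' &
    llen s0 <= llen t + llen t'].
Proof.
move=> t1 e; have [s0 [m1 [m2 [e0 l1 l2]]]] := coset_min t s.
have e' : s0 * t * s0^-1 = t'.
  have c2 : t * t ^- m2 = t ^- m2 * t := commuteV (commuteX m2 (commute_refl t)).
  rewrite -e e0; apply: (mulIg (s0 * t ^+ m1 * t ^- m2)); rewrite mulgVK.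
  by rewrite -!mulgA mulKg -c2 !mulgA -(mulgA s0 t) -commX mulgA.
exists s0, m1, m2; split=> //.
case: (short_conjugator (@llenP A) l1 l2) => [|/llen_conj0 h]; first by rewrite e'; lia.
by rewrite h eqxx in t1.
Qed.

Lemma short_conj s t t' : s * t * s^-1 = t' ->
  exists2 s0, llen s0 <= llen t + llen t' & s0 * t * s0^-1 = t'.
Proof.
have [->|t1] := eqVneq t 1; first by move=> <-; exists 1; gsimp.
by move=> /(conj_split t1)[s0 [m1 [m2 [_ e l]]]]; exists s0.
Qed.

End FreeConjugators.

(** * Lengths of words representing elements of the model *)

Section Bounds.
Variables (X : finType) (R : {fset word X}).
Local Notation FX := (fg X).
Local Notation FT := (fg (X + R)%type).
Local Notation M := (miller_gen R).
Implicit Types (s t : FT) (e : bool) (w : FX) (bs : seq (bool * FX)) (g h : mil R).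

(** Bounds the effect of one letter of Theta on either side of q; the successor covers the letters
    indexed by X. *)
Definition rho : nat := (\max_(r : R) size (val r)).+1.

Definition wb g n := exists2 w : word M, size w <= n & mu w = g.

Lemma wb_leq g m n : m <= n -> wb g m -> wb g n.
Proof. by move=> mn [w sw e]; exists w => //; exact: leq_trans mn. Qed.
Lemma wbM g h m n : wb g m -> wb h n -> wb (g * h) (m + n).
Proof.
move=> [w sw <-] [v sv <-]; exists (w ++ v); last exact: mu_cat.
by rewrite size_cat leq_add.
Qed.
Lemma wbV g n : wb g n -> wb g^-1 n.
Proof.
by move=> [w sw <-]; exists (winv w); [rewrite /winv size_map size_rev | rewrite mu_winv].
Qed.
Lemma wbX g n k : wb g n -> wb (g ^+ k) (k * n).
Proof.
move=> h; elim: k => [|k IH]; first by exists [::].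
by rewrite expgS mulSn; apply: wbM.
Qed.
Lemma wb_conj g h m n : wb g m -> wb h n -> wb (g * h * g^-1) (n + m.*2).
Proof.
move=> hg hh; apply: wb_leq (wbM (wbM hg hh) (wbV hg)); lia.
Qed.
Lemma wbK (k : fg (option X)) : wb (Mil k 1) (llen k).
Proof. by exists (kword R (fgw k)); rewrite ?size_map // mu_kword of_wordK. Qed.
Lemma wbT t : wb (Mil 1 t) (llen t).
Proof. by exists (tword (fgw t)); rewrite ?size_map // mu_tword of_wordK. Qed.
Lemma llen_iX w : llen (iX w) = llen w.
Proof. by rewrite /llen fgw_iX size_map. Qed.

Lemma llenM_gen (B : choiceType) (u v : fg B) : llen (u * v) <= llen u + llen v.
Proof. exact: (lenM (@llenP B)). Qed.

Lemma of_word_cons (B : choiceType) l (v : word B) : of_word (l :: v) = lev fgen l * of_word v.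
Proof. by rewrite !of_word_fev. Qed.

Lemma llen_sd e t : llen (sd e t) <= rho * llen t.
Proof.
rewrite -{1}[t]of_wordK {2}/llen.
elim: (fgw t) => [|l v IH]; first by rewrite sd1.
rewrite of_word_cons sdM mulnS; apply: leq_trans (llenM_gen _ _) _; apply: leq_add IH.
rewrite -of_word_sdw; apply: leq_trans (llen_of_word _) _.
case: l => [[x|r] b] //=; case: e => //.
have le : size (val r) <= rho by apply: leqW; exact: leq_bigmax.
by case: b => //; rewrite /winv size_map size_rev.
Qed.

Lemma llen_phi t k : llen (phi t k) <= llen k * (1 + (rho * llen t).*2).
Proof.
rewrite -{1}[k]of_wordK {2}/llen.
elim: (fgw k) => [|[o b] v IH]; first by rewrite phi1.
rewrite of_word_cons phiM mulSn; apply: leq_trans (llenM_gen _ _) _; apply: leq_add IH.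
case: o => [x|].
  by rewrite lev_Some phi_iX llen_iX; case: b => //; rewrite /lev /= -of_word_winv.
rewrite -[lev _ _]/(qe b) phi_qe -iXV; apply: leq_trans (lenM3 (@llenP _) _ _ _) _.
rewrite !llen_iX (tlenV (@llenP _)) qe_of_word.
have h1 := llen_sd (~~ b) t; have h2 := llen_sd b t.
have h3 : llen (of_word [:: (None : option X, b)]) = 1%N by [].
by rewrite h3; lia.
Qed.

(** The distortion of K-components: each of n letters is acted upon by at most n letters of Theta,
    which add at most [rho * n] on either side. *)
Definition kb n : nat := n * (1 + (rho * n).*2).

Lemma kb_leq m n : m <= n -> kb m <= kb n.
Proof. by move=> h; rewrite /kb leq_mul // leq_add2l leq_double leq_mul2l h orbT. Qed.

Lemma mu_cons l (w : word M) : mu (l :: w) = lev (@gm X R) l * mu w.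
Proof. by []. Qed.

Lemma wb_mt g n : wb g n -> llen (mt g) <= n.
Proof.
move=> [w sw <-]; apply: leq_trans sw; elim: w => // -[a b] w IH.
rewrite mu_cons mtM; apply: leq_trans (llenM_gen _ _) _; rewrite [size _]/= -add1n;
  apply: leq_add IH.
case: a => [[x|al]|[]].
- by rewrite -[lev _ _]/(lev (@gm X R) (kgen R (Some x), b)) lev_gmK.
- by rewrite -[lev _ _]/(lev (@gm X R) (mtheta al, b)) lev_gmT; case: b => //;
  rewrite /lev /= -of_word_winv.
- by rewrite -[lev _ _]/(lev (@gm X R) (kgen R None, b)) lev_gmK.
Qed.

Lemma wb_mk g n : wb g n -> llen (mk g) <= kb n.
Proof.
move=> [w sw <-]; apply: leq_trans (kb_leq sw).
elim/last_ind: w {sw} => // w [a b] IH.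
rewrite -cats1 mu_cat mkM; apply: leq_trans (llenM_gen _ _) _.
have lt : llen (mt (mu w)) <= size w by apply: wb_mt; exists w.
have l1 : llen (phi (mt (mu w)) (mk (mu [:: (a, b)]))) <= 1 + (rho * size w).*2.
  apply: leq_trans (llen_phi _ _) _.
  rewrite -[X in _ <= X]mul1n leq_mul ?leq_add2l ?leq_double ?leq_mul2l ?lt ?orbT //.
  rewrite mu_cons [mu [::]]/(1 : mil R) mulg1; case: a => [[x|al]|[]].
  - rewrite -[lev _ _]/(lev (@gm X R) (kgen R (Some x), b)) lev_gmK [mk _]/=.
    by case: b => //; rewrite /lev /= -of_word_winv.
  - by rewrite -[lev _ _]/(lev (@gm X R) (mtheta al, b)) lev_gmT.
  - rewrite -[lev _ _]/(lev (@gm X R) (kgen R None, b)) lev_gmK [mk _]/=.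
    by case: b => //; rewrite /lev /= -of_word_winv.
apply: leq_trans (leq_add IH l1) _; rewrite size_cat addn1 /kb mulSn addnC leq_add //.
  by rewrite leq_add2l leq_double leq_mul2l leqnSn orbT.
by rewrite leq_mul2l leq_add2l leq_double leq_mul2l leqnSn !orbT.
Qed.

Lemma wb_csd e s n : llen s <= n -> wb (csd e s) (rho * n + n).
Proof.
move=> l; rewrite /csd mil_split; apply: wbM.
  apply: wb_leq (wbK _); rewrite llen_iX; apply: leq_trans (llen_sd _ _) _.
  by rewrite leq_mul2l l orbT.
exact: wb_leq l (wbT s).
Qed.

Lemma take_qlen (u : word (option X)) i : i <= wlenw wtq u ->
  exists j, wlenw wtq (take j u) = i.
Proof.
elim: u i => [|[o b] u IH] i; first by rewrite leqn0 => /eqP ->; exists 0%N.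
rewrite /wlenw /= -/(wlenw _ u); case: i => [|i]; first by exists 0%N; rewrite take0.
case: o => [x|] /=; rewrite ?add0n ?add1n ?ltnS => /IH[j ej].
  by exists j.+1; rewrite -[RHS]ej.
by exists j.+1; rewrite /= -/(wlenw wtq _) ej.
Qed.

Lemma mlen_conj0 g h : mlen h = 0%N -> mlen (h * g * h^-1) = mlen g.
Proof.
have le (g' h' : mil R) : mlen h' = 0%N -> mlen (h' * g' * h'^-1) <= mlen g'.
  move=> h0; apply: leq_trans (lenM3 (@mlenP X R) _ _ _) _.
  by rewrite (tlenV (@mlenP X R)) h0 addn0.
move=> h0; apply/eqP; rewrite eqn_leq le //=.
have := le (h * g * h^-1) h^-1; rewrite (tlenV (@mlenP X R)) => /(_ h0).
by gsimp.
Qed.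

(** The first term pays for moving to the axis or to a fixed vertex, the second for removing the
    coefficient before the first q of the new element, a word of length at most [n + 2 * kb n]. *)
Definition redb n := kb n + kb (n + (kb n).*2).

Lemma cyc_reduce g n : wb g n -> exists2 c, wb c (redb n) &
  (exists w, c * g * c^-1 = Mil (iX w) (mt g)) \/
  (exists bs, [/\ bs != [::], c * g * c^-1 = Mil (kval bs) (mt g) & tight_blocks bs (mt g)]).
Proof.
(* The conjugators are prefixes of the K-component, hence of length at most [kb n] and with trivial
   F(Theta)-component. *)
move=> hg; pose good p := exists j, p = Mil (of_word (take j (fgw (mk g)))) 1 :> mil R.
have [|p [j pE] cy] := @cyc_reduction _ _ (@mlenP X R) good g.
  move=> i ig; have [j ej] := take_qlen (u := fgw (mk g)) ig.
  have [e1 e2 e3] := fg_split wtq (mk g) j.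
  exists (Mil (of_word (take j (fgw (mk g)))) 1); first by exists j.
  have l1 : qlen (of_word (take j (fgw (mk g)))) = i by rewrite /qlen /wlen e1.
  by split; [exact: l1 | rewrite /mlen mil_invK mkM [mk _]/= [mt _]/= phi_1; exact: e3].
have wp : wb p (kb n).
  have [e1 e2 e3] := fg_split (fun=> 1%N) (mk g) j.
  rewrite pE; apply: wb_leq (wbK _); rewrite !wlen_llen in e3.
  by have := wb_mk hg; lia.
set g1 := p^-1 * g * p in cy; have mt1 : mt g1 = mt g.
  by rewrite /g1 pE !mtM /= invg1 mul1g mulg1.
have wg1 : wb g1 (n + (kb n).*2).
  by have := wb_conj (wbV wp) hg; rewrite invgK.
have g1E : g1 = p^-1 * g * p by [].
clearbody g1.
have [w0 [bs [kE np lE fE]]] := kvalP (mk g1).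
have lw : llen w0 <= kb (n + (kb n).*2).
  by have := wb_mk wg1; rewrite {1}/llen fE size_cat size_map; apply: leq_trans; exact: leq_addr.
have [bs0|bs0] := eqVneq bs [::].
  exists p^-1; first by apply: wb_leq (wbV wp); exact: leq_addr.
  left; exists w0; rewrite invgK -g1E.
  by case: g1 kE mt1 {cy wg1 fE lE g1E} => k t /= -> ->; rewrite bs0 /kval /= mulg1.
have [bs2 [k2 s2 _]] := kval_mulr w0 bs0.
pose h : mil R := Mil (iX w0)^-1 1.
have h0 : mlen h = 0%N by rewrite /mlen (tlenV (@qlenP X)) qlen_iX.
have eq2 : h * g1 * h^-1 = Mil (kval bs2) (mt g).
  rewrite mil_invK invgK !milM /= !mul1g mulg1 mt1 phi_1 kE mulKg phi_iX.
  by rewrite k2.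
exists (h * p^-1).
  rewrite /redb addnC; apply: wbM (wbV wp); rewrite /h -iXV.
  by apply: wb_leq lw _; rewrite -llen_iX -(tlenV (@llenP _)) -iXV; exact: wbK.
right; exists bs2; have eq3 : h * p^-1 * g * (h * p^-1)^-1 = Mil (kval bs2) (mt g).
  by rewrite -eq2 g1E; gsimp.
split=> //; first by rewrite -size_eq0 s2 size_eq0.
split.
  have := congr1 (@mlen X R) eq2; rewrite mlen_conj0 // {2}/mlen /= => <-.
  by rewrite s2 -lE.
rewrite -eq2 /cyc_len.
have -> : h * g1 * h^-1 * (h * g1 * h^-1) = h * (g1 * g1) * h^-1 by gsimp.
by rewrite (@mlen_conj0 (g1 * g1) h h0) (@mlen_conj0 g1 h h0).
Qed.

End Bounds.

(** * Conjugators of computably bounded length *)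

Section Completeness.
Variables (X : finType) (R : {fset word X}).
Local Notation FX := (fg X).
Local Notation FT := (fg (X + R)%type).
Local Notation M := (miller_gen R).
Local Notation rho := (rho R).
Local Notation kb := (kb R).
Implicit Types (s t : FT) (e : bool) (w : FX) (bs : seq (bool * FX)) (g h : mil R).

Lemma llen_coef bs i d : no_pinch bs -> i < size bs -> llen (nth d bs i).2 <= llen (kval bs).
Proof.
move=> np; rewrite {2}/llen fgw_kval //; elim: bs i {np} => // -[e w] bs IH [_|i lt] /=.
  by rewrite size_cat size_map leqW // leq_addr.
by apply: leq_trans (IH i lt) _; rewrite size_cat leqW // leq_addl.
Qed.

Lemma size_le_llen bs : no_pinch bs -> size bs <= llen (kval bs).
Proof.
move=> np; rewrite /llen fgw_kval //; elim: bs {np} => // -[e w] bs IH /=.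
by rewrite ltnS size_cat; apply: leq_trans IH _; exact: leq_addl.
Qed.

Lemma llen_kval_take j bs : no_pinch bs -> llen (kval (take j bs)) <= llen (kval bs).
Proof.
move=> np; have npt : no_pinch (take j bs) by exact: take_sorted.
rewrite /llen !fgw_kval // -{2}(cat_take_drop j bs).
by elim: (take j bs) => //= -[e w] r IH; rewrite ltnS !size_cat leq_add2l.
Qed.

Lemma size_bword bs C : (forall d i, i < size bs -> llen (nth d bs i).2 <= C) ->
  size (bword bs) <= size bs * C.+1.
Proof.
elim: bs => // -[e w] bs IH h; have -> : size (bword ((e, w) :: bs)) =
  (size (fgw w) + size (bword bs)).+1.
  by rewrite /= size_cat size_map.
rewrite [size (_ :: _)]/= mulSn addSn ltnS.
apply: leq_add; first exact: (h (true, 1) 0%N).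
by apply: IH => d i lt; exact: (h d i.+1).
Qed.

(** Padding by [None] embeds the words of length at most D into the D-tuples over [option B]. *)
Lemma bounded_inj_words (B : finType) (D m : nat) (f : nat -> seq B) :
  (forall k, k <= m -> size (f k) <= D) ->
  (forall i j, i < j -> j <= m -> f i <> f j) -> m < (#|B|.+1) ^ D.
Proof.
move=> fD fi; pose pad (w : seq B) : D.-tuple (option B) := [tuple nth None (map Some w) i | i < D].
have pad_inj (w v : seq B) : size w <= D -> size v <= D -> pad w = pad v -> w = v.
  move=> sw sv e; have n i : i < D -> nth None (map Some w) i = nth None (map Some v) i.
    move=> lt; have := congr1 (fun c => tnth c (Ordinal lt)) e.
    by rewrite !tnth_mktuple.
  have ne i : nth None (map Some w) i = nth None (map Some v) i.
    have [|le] := ltnP i D; first exact: n.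
    by rewrite !nth_default ?size_map ?(leq_trans sw) ?(leq_trans sv).
  have sz : size w = size v.
    apply/eqP; rewrite eqn_leq; apply/andP; split; rewrite leqNgt; apply/negP => lt.
      by case: w ne lt {e n sw} => // b w ne lt; have := ne (size v);
        rewrite [RHS]nth_default ?size_map // (nth_map b).
    by case: v ne lt {e n sv} => // b v ne lt; have := ne (size w);
        rewrite [LHS]nth_default ?size_map // (nth_map b).
  by apply: (inj_map Some_inj); apply: (@eq_from_nth _ None); rewrite ?size_map.
pose F (k : 'I_m.+1) := pad (f k).
have Finj : injective F.
  move=> i j /pad_inj; rewrite !fD -1?ltnS // => /(_ isT isT) e.
  apply: val_inj => /=; case: (ltngtP i j) => // lt; case: (fi _ _ lt); rewrite -1?ltnS //.
by have := leq_card F Finj; rewrite card_ord card_tuple card_option.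
Qed.

Definition coefb n nl nr : nat := kb nl + kb nr + (rho * n + rho * n).*2.
Definition powb n nl nr : nat := (#|{: option X * bool}|.+1) ^ (kb nl * (coefb n nl nr).+1).

(** Convexity confines the intermediate coefficients to a ball, so that a minimal
    exponent is bounded by the number of words in this ball. *)
Lemma bounded_twist t e bs bs' m n nl nr :
  no_pinch bs -> no_pinch bs' -> llen (kval bs) <= kb nl -> llen (kval bs') <= kb nr ->
  llen t <= n -> twist (t ^+ m) e bs = bs' ->
  exists2 m', m' <= powb n nl nr & twist (t ^+ m') e bs = bs'.
Proof.
move=> np np' lb lb' lt tm.
have ex : exists k, twist (t ^+ k) e bs == bs' by exists m; apply/eqP.
case: (ex_minnP ex) => {tm} {}m /eqP tm mmin; exists m => //; apply: ltnW.
apply: (@bounded_inj_words _ _ _ (fun k => bword (twist (t ^+ k) e bs))) => [k km|i j ij jm].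
  have szb : size bs <= kb nl by apply: leq_trans lb; exact: size_le_llen.
  apply: leq_trans (@size_bword _ (coefb n nl nr) _) _;
    last by rewrite size_twist leq_mul2r szb orbT.
  move=> d i; rewrite size_twist => iB; rewrite nth_twist //.
  set e' := ~~ _; case E: (nth d bs i) => [e1 w] /=; rewrite !sdX.
  have := pow_conj_bound (@llenP X) (sd e1 t) (sd e' t) w (@llen_prefix X) km.
    have -> : sd e1 t ^+ m * w * sd e' t ^- m = (nth d bs' i).2.
    by rewrite -tm nth_twist // E /= !sdX.
  have h1 : llen w <= kb nl by have := llen_coef d np iB; rewrite E; move/leq_trans; apply.
  have iB' : i < size bs' by rewrite -tm size_twist.
  have h2 := leq_trans (llen_coef d np' iB') lb'.
  have sdb b : llen (sd b t) <= rho * n.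
    by apply: leq_trans (llen_sd _ _) _; rewrite leq_mul2l lt orbT.
  have h3 := sdb e1; have h4 := sdb e'; move=> h; apply: leq_trans h _; rewrite /coefb.
  apply: leq_add; last by rewrite leq_double leq_add.
  by rewrite geq_max (leq_trans h1 (leq_addr _ _)) (leq_trans h2 (leq_addl _ _)).
(* If the exponents i < j give the same blocks, removing this loop reaches [bs'] with exponent m -
   (j - i), against minimality. *)
move=> /bword_inj eij.
have := mmin (m - (j - i))%N; have -> : m - (j - i) = (m - j) + i by lia.
rewrite expgnDr -twistM eij twistM -expgnDr subnK // tm eqxx => /(_ isT).
by lia.
Qed.

(** The summands pay for the rotation, for the short part [s0] of the F(Theta)-conjugator, and for a
    power of t with exponent at most [powb]. *)
Definition hypb n : nat :=
  kb n + ((rho * (n + n) + (n + n)) + powb n (n + (kb n).*2) (n + (rho * (n + n) + (n + n)).*2) * (rho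
    * n + n)).

Lemma bounded_hyperbolic n bs bs' t t' g :
  bs != [::] -> bs' != [::] -> tight_blocks bs t -> tight_blocks bs' t' -> t != 1 ->
  wb (Mil (kval bs) t) n -> wb (Mil (kval bs') t') n ->
  g * Mil (kval bs) t * g^-1 = Mil (kval bs') t' ->
  exists2 h, wb h (hypb n) & h * Mil (kval bs) t * h^-1 = Mil (kval bs') t'.
Proof.
move=> bs0 bs0' tb tb' t1 wU wV eq.
have [j [s [bs1 [[js eP bs10 _] [tE sE]]]]] := hyperbolic_conj bs0 bs0' tb tb' eq.
set P := Mil (kval (take j bs)) 1 in eP.
have np : no_pinch bs by case: tb => /qlen_no_pinch.
have np' : no_pinch bs' by case: tb' => /qlen_no_pinch.
have wP : wb P (kb n).
  by apply: wb_leq (wbK _ _); apply: leq_trans (wb_mk wU); exact: llen_kval_take.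
have wU1 : wb (Mil (kval bs1) t) (n + (kb n).*2).
  by rewrite -eP; have := wb_conj (wbV wP) wU; rewrite invgK.
set e := hsign true bs1 in tE.
have [s0 [m1 [m2 [s0E s0T s0l]]]] := conj_split t1 sE.
have ls0 : llen s0 <= n + n.
  by apply: leq_trans s0l _; apply: leq_add; [exact: wb_mt wU | exact: wb_mt wV].
have lt : llen t <= n by exact: wb_mt wU.
(* Passing to the inverse of t if necessary makes the exponent a natural number. *)
have [t0 [m [t0E lt0 s0E']]] : exists t0 m, [/\ t0 * t = t * t0, llen t0 <= n & s = s0 * t0 ^+ m].
  have [le|/ltnW le] := leqP m2 m1.
    by exists t, (m1 - m2)%N; split; rewrite // expgnFr // mulgA.
  exists t^-1, (m2 - m1)%N; split; first by rewrite mulVg mulgV.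
    by rewrite (tlenV (@llenP _)).
  by rewrite s0E expVgn -{1}(subnK le) expgnDr invgM mulgA mulgK.
pose c0 : mil R := csd (~~ e) s0.
(* Undoing [s0] on the right leaves a twist by a pure power of [t0]. *)
pose bs2 := twist s0^-1 e bs'.
have tm : twist (t0 ^+ m) e bs1 = bs2 by rewrite /bs2 -tE s0E' twistM mulKg.
have he' : hsign true bs' = e by rewrite -tE hsign_twist.
have sV : s0^-1 * t' * s0 = t by rewrite -s0T; gsimp.
have V1E : c0^-1 * Mil (kval bs') t' * c0 = Mil (kval bs2) t.
  have := csd_conj s0^-1 t' bs'; rewrite he' csdV !invgK sV -/bs2.
  exact.
have wc0 : wb c0 (rho * (n + n) + (n + n)) by exact: wb_csd.
have wV1 : wb (Mil (kval bs2) t) (n + (rho * (n + n) + (n + n)).*2).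
  by rewrite -V1E; have := wb_conj (wbV wc0) wV; rewrite invgK.
have np1 : no_pinch bs1.
  apply: qlen_no_pinch.
  have sz : size bs1 = size bs' by rewrite -tE size_twist.
  have := csd_conj s t bs1; rewrite -/e tE => /(congr1 (@mlen X R)).
  by rewrite mlen_conj0 ?/mlen /= ?qlen_iX // => ->; rewrite sz; case: tb'.
have np2 : no_pinch bs2.
  apply: qlen_no_pinch; rewrite size_twist; have := congr1 (@mlen X R) V1E.
  rewrite -[c0 in X in _ * X]invgK mlen_conj0; last by rewrite (tlenV (@mlenP X R)) /mlen qlen_iX.
  by rewrite /mlen /= => <-; case: tb'.
have [m' lm' tm'] := bounded_twist np1 np2 (wb_mk wU1) (wb_mk wV1) lt0 tm.
exists (c0 * csd (~~ e) (t0 ^+ m') * P^-1).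
  rewrite /hypb addnC; apply: wbM (wbV wP); apply: wbM => //.
  rewrite csdX; apply: wb_leq (wbX _ (wb_csd _ lt0)).
  by rewrite leq_mul2r lm' orbT.
have tc : t0 ^+ m' * t * (t0 ^+ m')^-1 = t.
  by rewrite (commute_sym (commuteX m' (esym t0E : commute t t0))) mulgK.
have := csd_conj (t0 ^+ m') t bs1; rewrite -/e tm' tc -eP => e1.
apply: (mulgI c0^-1); apply: (mulIg c0); rewrite V1E -e1.
by gsimp.
Qed.

Definition conjF w w' := exists y, y * w * y^-1 = w'.

Lemma conjF_sym w w' : conjF w w' -> conjF w' w.
Proof. by move=> [y <-]; exists y^-1; gsimp. Qed.
Lemma conjF_trans w w' w'' : conjF w w' -> conjF w' w'' -> conjF w w''.
Proof. by move=> [y <-] [z <-]; exists (z * y); gsimp. Qed.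
Lemma conjF_sd e s t : conjF (sd e t) (sd e (s * t * s^-1)).
Proof. by exists (sd e s); rewrite !sdM sdV. Qed.

(** The element fixes the base vertex and its image by g^-1, hence the segment between them.
    Crossing a q there forces the coefficient to be [sd e] of the F(Theta)-component, so that up to
    conjugacy only [sd true t] and [sd false t] occur on the way. *)
Lemma elliptic_conj g w w' t t' : g * Mil (iX w) t * g^-1 = Mil (iX w') t' ->
  conjF w w' \/ exists e e', conjF w (sd e t) /\ conjF w' (sd e' t).
Proof.
have [n] := ubnP (mlen g); elim: n => // n IH in g w' t' * => lg eq.
have sE : mt g * t * (mt g)^-1 = t' by have := congr1 (@mt X R) eq.
have [y [bs [kE np lE _]]] := kvalP (mk g).
case: bs kE np lE => [|[e v] bs] kE np lE.
  left; exists y; apply: iX_inj; have := congr1 (@mk X R) eq.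
  case: g kE {lg sE eq lE IH np} => k s /= ->; rewrite /kval /= mulg1 => <-.
  by rewrite -iXV !phi_iX -!iXM.
right.
pose h : mil R := Mil (iX y * qe e) 1.
pose g1 : mil R := Mil (iX v * kval bs) (mt g).
have gE : g = h * g1.
  rewrite milM /= phi_1 mul1g; case: (g) kE => k s /= ->.
  by rewrite [kval (_ :: _)]/(qe e * iX v * kval bs) !mulgA.
have lh : mlen h <= 1.
  by rewrite /mlen; apply: leq_trans (lenM (@qlenP X) _ _) _; rewrite qlen_iX qlen_qe.
have lg1 : mlen g1 <= size bs.
  by rewrite /mlen; apply: leq_trans (lenM (@qlenP X) _ _) _; rewrite qlen_iX qlen_kval_le.
have lgE : mlen g = (size bs).+1 by [].
set U := Mil (iX w) t in eq.
have U0 : mlen U = 0%N by rewrite /mlen qlen_iX.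
have V0 : mlen (g * U * g^-1) = 0%N by rewrite eq /mlen qlen_iX.
(* The vertex of g1^-1 precedes that of g^-1 on the fixed segment, so it is fixed too. *)
have W0 : mlen (g1 * U * g1^-1) = 0%N.
  have [+ _ _] := four_point (@mlenP X R) g1^-1 (U * g1^-1) 1 g^-1.
  have -> : gdist (@mlen X R) g1^-1 (U * g1^-1) = mlen (g1 * U * g1^-1).
    by rewrite /gdist; gsimp.
  have -> : gdist (@mlen X R) 1 g^-1 = mlen g by rewrite (gdist1 _) (tlenV (@mlenP X R)).
  have -> : gdist (@mlen X R) g1^-1 1 = mlen g1.
    by rewrite (gdist_1 (@mlenP X R)) (tlenV (@mlenP X R)).
  have -> : gdist (@mlen X R) (U * g1^-1) 1 = mlen g1.
    rewrite (gdist_1 (@mlenP X R)); apply/eqP; rewrite eqn_leq; apply/andP; split.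
      by apply: leq_trans (lenM (@mlenP X R) _ _) _; rewrite U0 (tlenV (@mlenP X R)).
    have := lenM (@mlenP X R) U^-1 (U * g1^-1); rewrite mulKg !(tlenV (@mlenP X R)) U0.
    exact.
  have hg : g * g1^-1 = h by rewrite gE mulgK.
  have -> : gdist (@mlen X R) g1^-1 g^-1 = mlen h.
    by rewrite /gdist invgK -(tlenV (@mlenP X R)) invgM invgK hg.
  have l2 : gdist (@mlen X R) (U * g1^-1) g^-1 <= 1.
    rewrite (gdistC (@mlenP X R)) /gdist invgK.
    have -> : g * (U * g1^-1) = g * U * g^-1 * h by rewrite -hg; gsimp.
    by apply: leq_trans (lenM (@mlenP X R) _ _) _; rewrite V0.
  rewrite lgE; move: lh lg1 l2; move: (mlen h) (mlen g1) (gdist _ _ _) (mlen _) => *; lia.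
have [w1 [t1 e1]] := mlen0P W0.
have lt1 : mlen g1 < n by apply: leq_ltn_trans lg1 _; rewrite -ltnS -lgE.
have rel := IH g1 w1 t1 lt1 e1.
have t1E : t1 = t' by have := congr1 (@mt X R) e1; rewrite /= sE.
have hE : h * Mil (iX w1) t1 * h^-1 = Mil (iX w') t' by rewrite -eq -e1 gE; gsimp.
pose Y : mil R := Mil (iX y) 1.
have hY : h = Y * stab R e by rewrite milM /= phi_1 mul1g.
have E2 : stab R e * Mil (iX w1) t1 * stab R (~~ e) = Y^-1 * Mil (iX w') t' * Y.
  by rewrite -hE hY stabN; gsimp.
have z0 : mlen (stab R (~~ ~~ e) * Mil (iX w1) t1 * stab R (~~ e)) = 0%N.
  rewrite negbK E2 -[Y in X in _ * X]invgK mlen_conj0; first by rewrite /mlen qlen_iX.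
  by rewrite (tlenV (@mlenP X R)) /mlen qlen_iX.
have [_ w1E] := q_pinch z0; rewrite negbK in w1E.
have w'E : conjF w' (sd (~~ e) t').
  have : Mil (iX w') t' = Y * csd (~~ e) t1 * Y^-1.
    apply: (mulgI Y^-1); apply: (mulIg Y); rewrite -E2 w1E -/(csd e t1) -csd_q stabN.
    by gsimp.
  move=> /(congr1 (@mk X R)) /=; rewrite -iXV !phi_iX -!iXM => /iX_inj ->.
  by apply: conjF_sym; exists y; rewrite t1E.
have c1 b : conjF (sd b t') (sd b t).
  by apply: conjF_sym; rewrite -sE; exact: conjF_sd.
case: rel => [ww1|[b [b' [h1 h2]]]].
  exists e, (~~ e); split; last exact: conjF_trans w'E (c1 _).
  by apply: conjF_trans ww1 _; rewrite w1E t1E; exact: c1.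
by exists b, (~~ e); split=> //; exact: conjF_trans w'E (c1 _).
Qed.

Definition ellb n : nat := ((kb n + rho * n) + (kb n + kb n)).*2 + (n + n) + 1.

(** F(X) and F(Theta) commute, so both components are conjugated independently by short elements;
    one letter q passes between [sd true t] and [sd false t]. *)
Lemma bounded_elliptic n g w w' t t' :
  wb (Mil (iX w) t : mil R) n -> wb (Mil (iX w') t' : mil R) n ->
  g * Mil (iX w) t * g^-1 = Mil (iX w') t' ->
  exists2 h, wb h (ellb n) & h * Mil (iX w) t * h^-1 = Mil (iX w') t'.
Proof.
move=> wU wV eq.
have sE : mt g * t * (mt g)^-1 = t' by have := congr1 (@mt X R) eq.
have [s ls s0] := short_conj sE.
have {}ls : llen s <= n + n.
  by apply: leq_trans ls _; apply: leq_add; [exact: wb_mt wU | exact: wb_mt wV].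
have lw : llen w <= kb n by have := wb_mk wU; rewrite /= llen_iX.
have lw' : llen w' <= kb n by have := wb_mk wV; rewrite /= llen_iX.
have lsd e : llen (sd e t) <= rho * n.
  by apply: leq_trans (llen_sd _ _) _; rewrite leq_mul2l (wb_mt wU) orbT.
have cY y v u : Mil (iX y) 1 * Mil (iX v) u * (Mil (iX y) 1)^-1 =
  Mil (iX (y * v * y^-1)) u :> mil R.
  by rewrite mil_invK !milM /= mul1g mulg1 phi_1 -!iXV phi_iX -!iXM.
have cS v : Mil 1 s * Mil (iX v) t * (Mil 1 s)^-1 = Mil (iX v) t' :> mil R.
  by rewrite mil_invT !milM /= mul1g phi_iX phi1 mulg1 s0.
have wY y m : llen y <= m -> wb (Mil (iX y) 1 : mil R) m.
  by move=> l; apply: wb_leq (wbK _ _); rewrite llen_iX.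
have wS : wb (Mil 1 s) (n + n) by exact: wb_leq ls (wbT s).
case: (elliptic_conj eq) => [[y0 /short_conj[y ly e]]|[b [b' [[y0 /short_conj[y ly e]] [z0 /short_conj[z
  lz e']]]]]].
  exists (Mil 1 s * Mil (iX y) 1).
    apply: wb_leq (wbM wS (wY y (kb n + kb n) _)); first by rewrite /ellb; lia.
    by apply: leq_trans ly _; exact: leq_add.
  by rewrite -(cS w') -e -cY; gsimp.
have QE : exists Q : mil R, wb Q 1 /\ Q * Mil (iX (sd b t)) t * Q^-1 = Mil (iX (sd b' t)) t.
  have [<-|ne] := eqVneq b b'.
    by exists 1; split; [exists [::] | gsimp].
  have nb (x1 x2 : bool) : x1 != x2 -> x2 = ~~ x1 by case: x1; case: x2.
  rewrite (nb _ _ ne).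
  exists (stab R b); split; first by apply: wb_leq (wbK R (qe b)); rewrite qe_of_word.
  by have := csd_q b t; rewrite /csd => <-; rewrite mulgK.
case: QE => {}Q [wQ QE].
exists (Mil (iX z^-1) 1 * (Mil 1 s * (Q * Mil (iX y) 1))).
  have h1 : llen y <= kb n + rho * n by apply: leq_trans ly _; rewrite leq_add.
  have h2 : llen z^-1 <= kb n + rho * n.
    by rewrite (tlenV (@llenP X)); apply: leq_trans lz _; rewrite leq_add.
  by apply: wb_leq (wbM (wY _ _ h2) (wbM wS (wbM wQ (wY _ _ h1)))); rewrite /ellb; lia.
have -> : w' = z^-1 * sd b' t * z^-1^-1 by rewrite -e'; gsimp.
by rewrite -cY -cS -QE -e -cY; gsimp.
Qed.

Lemma no_pinch_mixok b bs bs' : no_pinch (bs ++ b :: bs') -> mixok b.1 bs.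
Proof.
elim: bs => // -[e w] bs IH /= h; rewrite IH ?andbT; last exact: path_sorted h.
case: bs h {IH} => [|[e' w'] bs] /= /andP[h _]; move: h;
  [case: b => b v /= |]; rewrite negb_and => /orP[] h; rewrite ?h ?orbT // orbC; apply/orP; right.
- by move: h; case: b; case: e.
- by move: h; case: e'; case: e.
Qed.

(** The square of the product keeps its full q-length, so there is no pinch where the last block
    meets the first. *)
Lemma tight_mixok bs : bs != [::] -> tight_blocks (R := R) bs 1 -> mixok (hsign true bs) bs.
Proof.
case: bs => // b bs _ [l]; rewrite /cyc_len milM /= phi_1 mulg1 -kval_cat /mlen /= l => c.
apply: (@no_pinch_mixok b (b :: bs) bs); apply: qlen_no_pinch.
by rewrite c size_cat addnn.
Qed.

Definition confb n : nat :=
  redb R n + redb R n + kb (n + (redb R n).*2) + hypb (n + (redb R n).*2) + ellb (n + (redb R n).*2).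
    

(** Translation lengths keep elements fixing a vertex apart from those with an axis. In the second
    alternative the rotation is moved into c, while the twisting element is left unbounded: what
    remains is list conjugacy. *)
Theorem bounded_conj n (g g' h : mil R) : wb g n -> wb g' n -> h * g * h^-1 = g' ->
  (exists2 c, wb c (confb n) & c * g * c^-1 = g') \/
  [/\ mt g = 1, mt g' = 1 & exists c c' bs bs',
    [/\ wb c (confb n), wb c' (confb n), c * g * c^-1 = Mil (kval bs) 1 & c' * g' * c'^-1 =
      Mil (kval bs') 1] /\
    [/\ bs != [::], bs' != [::], mixok (hsign true bs) bs, mixok (hsign true bs') bs' &
      iso_blocks R bs bs']].
Proof.
move=> wg wg' eq.
have [c wc cE] := cyc_reduce wg; have [c' wc' cE'] := cyc_reduce wg'.
set n1 := (n + (redb R n).*2)%N.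
have w1 : wb (c * g * c^-1) n1 by exact: wb_conj.
have w1' : wb (c' * g' * c'^-1) n1 by exact: wb_conj.
pose f := c' * h * c^-1.
have eq1 : f * (c * g * c^-1) * f^-1 = c' * g' * c'^-1 by rewrite /f -eq; gsimp.
have glue m k : wb k m -> k * (c * g * c^-1) * k^-1 = c' * g' * c'^-1 ->
    redb R n + redb R n + m <= confb n -> exists2 c, wb c (confb n) & c * g * c^-1 = g'.
  move=> wk ke le; exists (c'^-1 * k * c).
    by apply: wb_leq (wbM (wbM (wbV wc') wk) wc); lia.
  by apply: (mulgI c'); apply: (mulIg c'^-1); rewrite -ke; gsimp.
have cyc0 (k : mil R) : mlen k = 0%N -> cyc_len (@mlen X R) k.
  by move=> k0; rewrite /cyc_len k0; have := lenM (@mlenP X R) k k; rewrite k0 leqn0 => /eqP.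
have mix (k a b : mil R) bs t : k * a * k^-1 = b -> mlen a = 0%N -> b = Mil (kval bs) t ->
    bs != [::] -> tight_blocks bs t -> False.
  move=> e a0 bE bs0 [l cb]; have := cyc_len_conj (@mlenP X R) (cyc0 _ a0) (g := k).
  rewrite e bE => /(_ cb); rewrite a0 /mlen /= l => /size0nil b0.
  by rewrite b0 in bs0.
case: cE => [[w gE]|[bs [bs0 gE tb]]]; case: cE' => [[w' gE']|[bs' [bs0' gE' tb']]].
- left; rewrite gE gE' in eq1; rewrite gE in w1; rewrite gE' in w1'.
  have [k wk kE] := bounded_elliptic w1 w1' eq1.
  by apply: (glue _ k wk); [rewrite gE gE' | rewrite /confb -/n1; lia].
- by case: (mix _ _ _ _ _ eq1 _ gE' bs0' tb'); rewrite gE /mlen qlen_iX.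
- case: (mix f^-1 (c' * g' * c'^-1) (c * g * c^-1) _ _ _ _ gE bs0 tb);
  last by rewrite gE' /mlen qlen_iX.
  by rewrite -eq1; gsimp.
have [t1|t1] := eqVneq (mt g) 1; last first.
  left; rewrite gE gE' in eq1; rewrite gE in w1; rewrite gE' in w1'.
  have [k wk kE] := bounded_hyperbolic bs0 bs0' tb tb' t1 w1 w1' eq1.
  by apply: (glue _ k wk); [rewrite gE gE' | rewrite /confb -/n1; lia].
right; have t1' : mt g' = 1 by rewrite -eq !mtM mtV t1 mulg1 mulgV.
rewrite t1 in gE tb; rewrite t1' in gE' tb'.
split=> //; rewrite gE gE' in eq1.
have [j [s [bs1 [[js eP bs10 /(_ erefl) bs1E] [tE _]]]]] := hyperbolic_conj bs0 bs0' tb tb' eq1.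
set P := Mil (kval (take j bs)) 1 in eP.
have np : no_pinch bs by case: tb => /qlen_no_pinch.
have wP : wb P (kb n1).
  apply: wb_leq (wbK _ _); apply: leq_trans (wb_mk w1); rewrite gE; exact: llen_kval_take.
exists (P^-1 * c), c', bs1, bs'; split.
  split=> //.
  - by apply: wb_leq (wbM (wbV wP) wc); rewrite /confb -/n1; lia.
  - by apply: wb_leq wc'; rewrite /confb; lia.
  - by rewrite -eP -gE; gsimp.
have tb1 : tight_blocks (R := R) bs1 1.
  have e2 : csd (~~ hsign true bs1) s * Mil (kval bs1) 1 * (csd (~~ hsign true bs1) s)^-1 =
    Mil (kval bs') 1.
    by rewrite csd_conj tE mulg1 mulgV.
  have c0 : mlen (csd (~~ hsign true bs1) s) = 0%N by rewrite /mlen qlen_iX.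
  have l1 : mlen (Mil (kval bs1) 1 : mil R) = mlen (Mil (kval bs') 1 : mil R).
    by rewrite -e2 mlen_conj0.
  case: tb' => l' cy'; split.
    by move: l1; rewrite /mlen /= => ->; rewrite l' -tE size_twist.
  rewrite /cyc_len -(@mlen_conj0 _ _ (Mil (kval bs1) 1 * Mil (kval bs1) 1) _ c0).
  have -> (a k : mil R) : k * (a * a) * k^-1 = k * a * k^-1 * (k * a * k^-1) by gsimp.
  by rewrite e2 cy' l1.
split=> //; first exact: tight_mixok.
  exact: tight_mixok.
by exists s.
Qed.

End Completeness.

(** * Computable functions *)

Record etype := EType { ety :> Type; een : ety -> tree }.

Canonical Ebool := EType enc_bool.
Canonical Enat := EType enc_nat.
Canonical Eunit := @EType unit (fun _ => Leaf).
Canonical Eseq (E : etype) := @EType (seq E) (enc_seq (@een E)).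
Canonical Eprod (E F : etype) := @EType (E * F) (fun p => Node (een p.1) (een p.2)).
Canonical Efin (A : finType) := @EType A (fun a => enc_nat (enum_rank a)).
(** Encoded through the enumeration of the whole finite type, as [enc_word] does with its
    letters. *)
Canonical Eoption (A : finType) := @EType (option A) (@een (Efin (option A : finType))).
Canonical Esum (A B : finType) := @EType (A + B) (@een (Efin (A + B : finType)%type)).

Definition computable (E F : etype) (f : E -> F) : Prop :=
  exists p, forall x, eval p (een x) (een (f x)).

Fixpoint prog_const (t : tree) : prog :=
  if t is Node l r then PNode (prog_const l) (prog_const r) else PLeaf.

Lemma eval_const t u : eval (prog_const t) u t.
Proof. by elim: t => [|l IHl r IHr] /=; constructor. Qed.

Fixpoint prog_eqc (t : tree) : prog :=
  if t is Node l r then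
    PIf PId (PIf (PSeq PHd (prog_eqc l)) (PSeq PTl (prog_eqc r)) PLeaf) PLeaf
  else PIf PId PLeaf (prog_const (enc_bool true)).

Fixpoint tree_eqb (t u : tree) : bool :=
  match t, u with
  | Leaf, Leaf => true
  | Node a b, Node c d => tree_eqb a c && tree_eqb b d
  | _, _ => false
  end.

Lemma tree_eqbP t u : tree_eqb t u -> t = u.
Proof. by elim: t u => [|a IHa b IHb] [|c d] //= /andP[/IHa -> /IHb ->]. Qed.
Lemma tree_eqb_refl t : tree_eqb t t.
Proof. by elim: t => //= a -> b ->. Qed.

Lemma eval_eqc t u : eval (prog_eqc t) u (enc_bool (tree_eqb t u)).
Proof.
elim: t u => [|a IHa b IHb] [|c d] /=.
- apply: EIfFalse; [exact: EId | exact: (eval_const (enc_bool true))].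
- by apply: EIfTrue; [exact: EId | exact: ELeaf].
- by apply: EIfFalse; [exact: EId | exact: ELeaf].
apply: EIfTrue; first exact: EId.
have := IHa c; case: (tree_eqb a c) => /= h.
  apply: EIfTrue; first exact: (ESeq (EHd (Node c d)) h).
  exact: (ESeq (ETl (Node c d)) (IHb d)).
by apply: EIfFalse; [exact: (ESeq (EHd (Node c d)) h) | exact: ELeaf].
Qed.

Section Combinators.
Implicit Types E F G H P S A : etype.

Lemma c_ext E F (f g : E -> F) : f =1 g -> computable g -> computable f.
Proof. by move=> fg [p h]; exists p => x; rewrite fg. Qed.

Lemma c_id E : computable (fun x : E => x).
Proof. by exists PId => x; constructor. Qed.

Lemma c_comp E F G (g : F -> G) (f : E -> F) :
  computable g -> computable f -> computable (fun x => g (f x)).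
Proof. by move=> [q hq] [p hp]; exists (PSeq p q) => x; apply: ESeq (hp x) (hq _). Qed.

Lemma c_cst E F (y : F) : computable (fun _ : E => y).
Proof. by exists (prog_const (een y)) => x; exact: eval_const. Qed.

Lemma c_pair E F G (f : E -> F) (g : E -> G) :
  computable f -> computable g -> computable (fun x => (f x, g x)).
Proof. by move=> [p hp] [q hq]; exists (PNode p q) => x; constructor. Qed.

Lemma c_fst E F G (f : E -> F * G) : computable f -> computable (fun x => (f x).1).
Proof.
by move=> [p hp]; exists (PSeq p PHd) => x; apply: ESeq (hp x) _; exact: (EHd (Node _ _)).
Qed.

Lemma c_snd E F G (f : E -> F * G) : computable f -> computable (fun x => (f x).2).
Proof.
by move=> [p hp]; exists (PSeq p PTl) => x; apply: ESeq (hp x) _; exact: (ETl (Node _ _)).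
Qed.

(* The program for f may be incorrect outside b: this allows calls to a partial oracle. *)
Lemma c_if_partial E F (b : E -> bool) (f g : E -> F) :
  computable b -> (exists p, forall x, b x -> eval p (een x) (een (f x))) -> computable g ->
  computable (fun x => if b x then f x else g x).
Proof.
move=> [pb hb] [p hp] [q hq]; exists (PIf pb p q) => x; have := hb x.
case: (b x) (hp x) => h hbx.
  by apply: EIfTrue hbx _; exact: h.
by apply: EIfFalse hbx _.
Qed.

Lemma c_if E F (b : E -> bool) (f g : E -> F) :
  computable b -> computable f -> computable g ->
  computable (fun x => if b x then f x else g x).
Proof. by move=> hb [p hp]; apply: c_if_partial => //; exists p => x _. Qed.

Lemma c_negb E (b : E -> bool) : computable b -> computable (fun x => ~~ b x).
Proof.
move=> h; apply: (c_ext (g := fun x => if b x then false else true)) => [x|]; first by case: (b x).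
by apply: c_if => //; exact: c_cst.
Qed.
Lemma c_andb E (b c : E -> bool) : computable b -> computable c -> computable (fun x => b x && c x).
Proof. by move=> h1 h2; apply: (c_if h1 h2); exact: c_cst. Qed.
Lemma c_orb E (b c : E -> bool) : computable b -> computable c -> computable (fun x => b x || c x).
Proof. by move=> h1 h2; apply: (c_if h1) => //; exact: c_cst. Qed.
Lemma c_eqb E (b c : E -> bool) : computable b -> computable c -> computable (fun x => b x == c x).
Proof.
move=> h1 h2; apply: (c_ext (g := fun x => if b x then c x else ~~ c x)).
  by move=> x; case: (b x); case: (c x).
by apply: c_if => //; exact: c_negb.
Qed.

Lemma c_cons E F (f : E -> F) (g : E -> seq F) :
  computable f -> computable g -> computable (fun x => f x :: g x).
Proof. by move=> [p hp] [q hq]; exists (PNode p q) => x; constructor. Qed.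

Lemma c_match E F G (s : E -> seq F) (f : E -> G) (g : E -> F -> seq F -> G) :
  computable s -> computable f -> computable (fun y => g y.1 y.2.1 y.2.2) ->
  computable (fun x => match s x with [::] => f x | a :: t => g x a t end).
Proof.
move=> [ps hs] [p hp] [q hq].
exists (PIf ps (PSeq (PNode PId ps) q) p) => x; have := hs x; case E0: (s x) => [|a t] h.
  by apply: EIfFalse h _.
apply: EIfTrue (h) _; apply: ESeq (hq (x, (a, t))).
by apply: ENode h; exact: EId.
Qed.

Lemma c_S E (f : E -> nat) : computable f -> computable (fun x => (f x).+1).
Proof. by move=> [p hp]; exists (PNode PLeaf p) => x; constructor=> //; exact: ELeaf. Qed.

(** The only while loop of the development, to which all later recursion reduces. *)
Lemma c_foldl P S A (step : P * (S * A) -> S) :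
  computable step ->
  computable (fun x : P * (S * seq A) => foldl (fun acc a => step (x.1, (acc, a))) x.2.1 x.2.2).
Proof.
move=> [q hq].
pose arg := PNode PHd (PNode (PSeq PTl PHd) (PSeq PTl (PSeq PTl PHd))).
pose body := PNode PHd (PNode (PSeq arg q) (PSeq PTl (PSeq PTl PTl))).
exists (PSeq (PWhile (PSeq PTl PTl) body) (PSeq PTl PHd)) => -[p [acc s]] /=.
suff h : eval (PWhile (PSeq PTl PTl) body) (een (p, (acc, s)))
    (een (p, (foldl (fun acc a => step (p, (acc, a))) acc s, [::] : seq A))).
  exact: (ESeq h (ESeq (ETl (Node _ _)) (EHd (Node _ _)))).
have pt (t1 t2 t3 : tree) : eval (PSeq PTl PTl) (Node t1 (Node t2 t3)) t3.
  exact: (ESeq (ETl (Node _ _)) (ETl (Node _ _))).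
elim: s acc => [|a s IH] acc; first by apply: EWhileFalse; exact: pt.
apply: EWhileTrue (IH _); first exact: pt.
have ph (t1 t2 : tree) : eval PHd (Node t1 t2) t1 by exact: (EHd (Node _ _)).
apply: ENode; first exact: ph.
apply: ENode; last first.
  exact: (ESeq (ETl (Node _ _)) (ESeq (ETl (Node _ _)) (ETl (Node _ _)))).
apply: ESeq (hq (p, (acc, a))).
apply: ENode; first exact: ph.
apply: ENode; first exact: (ESeq (ETl (Node _ _)) (EHd (Node _ _))).
exact: (ESeq (ETl (Node _ _)) (ESeq (ETl (Node _ _)) (EHd (Node _ _)))).
Qed.

Lemma c_rev E F (s : E -> seq F) : computable s -> computable (fun x => rev (s x)).
Proof.
move=> hs; pose step (y : unit * (seq F * F)) := y.2.2 :: y.2.1.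
have h : computable step by apply: c_cons; [exact/c_snd/c_snd/c_id | exact/c_fst/c_snd/c_id].
have := c_comp (c_foldl h) (c_pair (c_cst E tt) (c_pair (c_cst E ([::] : seq F)) hs)).
apply: c_ext => x; rewrite /= /rev -[RHS]/(foldl _ _ _); move: [::].
by elim: (s x) => //= a t IH acc; rewrite IH.
Qed.

(** A left fold over the reversed list; the accumulator also rebuilds the suffix, which [step] may
    inspect. *)
Lemma c_seqrec E A S (z : E -> S) (step : E * (A * (seq A * S)) -> S) (f : E -> seq A -> S)
    (p : E -> seq A) :
  (forall x, f x [::] = z x) -> (forall x a s, f x (a :: s) = step (x, (a, (s, f x s)))) ->
  computable z -> computable step -> computable p -> computable (fun x => f x (p x)).
Proof.
move=> f0 fS hz hs hp.
pose st (y : E * ((seq A * S) * A)) := (y.2.2 :: y.2.1.1, step (y.1, (y.2.2, (y.2.1.1, y.2.1.2)))).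
have id1 := c_id (Eprod E (Eprod (Eprod (Eseq A) S) A)).
have h : computable st.
  apply: c_pair; first by apply: c_cons; [exact/c_snd/c_snd | exact/c_fst/c_fst/c_snd].
  apply: (c_comp hs); apply: c_pair; first exact: c_fst.
  apply: c_pair; first exact/c_snd/c_snd.
  by apply: c_pair; [exact/c_fst/c_fst/c_snd | exact/c_snd/c_fst/c_snd].
have := c_comp (c_foldl h) (c_pair (c_id E) (c_pair (c_pair (c_cst E ([::] : seq A)) hz) (c_rev hp))).
  
move=> /c_snd; apply: c_ext => x /=.
suff -> : forall s, foldl (fun acc a => st (x, (acc, a))) ([::], z x) (rev s) = (s, f x s) by [].
elim=> [|a s IH] /=; first by rewrite f0.
by rewrite rev_cons -cats1 foldl_cat IH /= /st /= fS.
Qed.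

(** The encoding of n is that of a list of n units, so this is recursion on lists. *)
Lemma c_natrec E S (z : E -> S) (step : E * (nat * S) -> S) (f : E -> nat -> S) (n : E -> nat) :
  (forall x, f x 0 = z x) -> (forall x k, f x k.+1 = step (x, (k, f x k))) ->
  computable z -> computable step -> computable n -> computable (fun x => f x (n x)).
Proof.
move=> f0 fS hz hs [p hp].
have encN k : een (nseq k tt) = een k by elim: k => //= k ->.
have hn : computable (fun x => nseq (n x) tt).
  by exists p => x; rewrite encN.
have hsz : computable (fun s : seq unit => size s).
  exists PId => s; have -> : een (size s) = een s by elim: s => // -[] s /= ->.
  exact: EId.
have := @c_seqrec E Eunit S z (fun y => step (y.1, (size y.2.2.1,
  y.2.2.2))) (fun x s => f x (size s)) (fun x => nseq (n x) tt).
have id1 := c_id (Eprod E (Eprod Eunit (Eprod (Eseq Eunit) S))).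
move=> h; apply: (c_ext (g := fun x => f x (size (nseq (n x) tt)))); first by move=> x;
  rewrite size_nseq.
apply: h => // [x a s|]; first exact: fS.
apply: (c_comp hs); apply: c_pair; first exact: c_fst.
by apply: c_pair; [apply: (c_comp hsz); exact/c_fst/c_snd/c_snd | exact/c_snd/c_snd/c_snd].
Qed.

End Combinators.

Definition fin_etype (E : etype) : Prop := injective (@een E) /\ exists s : seq E, forall x,
  List.In x s.

(** The case analysis is compiled into a chain of equality tests against constant trees. *)
Lemma c_fincase (E F G : etype) (f : E -> F -> G) : fin_etype E ->
  (forall x, computable (f x)) -> computable (fun y : E * F => f y.1 y.2).
Proof.
move=> [einj [s sall]] hf.
suff [p hp] : exists p, forall x y, List.In x s -> eval p (een (x, y)) (een (f x y)).
  by exists p => -[x y]; exact: hp.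
elim: s {sall} => [|a s [p hp]]; first by exists PId.
have [q hq] := hf a.
exists (PIf (PSeq PHd (prog_eqc (een a))) (PSeq PTl q) p) => x y xin.
have he : eval (PSeq PHd (prog_eqc (een a))) (een (x, y)) (enc_bool (tree_eqb (een a) (een x))).
  exact: (ESeq (EHd (Node _ _)) (eval_eqc _ _)).
case E0: (tree_eqb (een a) (een x)) he => he.
  rewrite -(einj _ _ (tree_eqbP E0)) in he *.
  exact: (EIfTrue _ he (ESeq (ETl (Node _ _)) (hq y))).
have {}xin : List.In x s by case: xin => // ax; rewrite ax tree_eqb_refl in E0.
exact: (EIfFalse _ he (hp x y xin)).
Qed.

Lemma c_table (E F : etype) (f : E -> F) : fin_etype E -> computable f.
Proof.
move=> fE; have h := @c_fincase E Eunit F (fun x _ => f x) fE (fun x => c_cst _ _).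
exact: (c_comp h (c_pair (c_id E) (c_cst E tt))).
Qed.

Lemma enc_nat_inj : injective enc_nat.
Proof. by elim=> [|m IH] [|n] //= [] /IH ->. Qed.

Lemma fin_Efin (A : finType) : fin_etype (Efin A).
Proof.
split=> [x y /enc_nat_inj/val_inj/enum_rank_inj //|]; exists (enum A) => x.
have : x \in enum A by rewrite mem_enum.
by elim: (enum A) => //= y s IH; rewrite inE => /orP[/eqP ->|/IH]; [left | right].
Qed.
Lemma fin_Eoption (A : finType) : fin_etype (Eoption A).
Proof. exact: (fin_Efin (option A : finType)). Qed.
Lemma fin_Ebool : fin_etype Ebool.
Proof.
by split=> [[] []|] //; exists [:: true; false] => -[]; [left | right; left].
Qed.
Lemma fin_Eprod (E F : etype) : fin_etype E -> fin_etype F -> fin_etype (Eprod E F).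
Proof.
move=> [i1 [s h1]] [i2 [t h2]]; split=> [[a b] [c d] /= [] /i1 -> /i2 -> //|].
exists (List.list_prod s t) => -[x y]; exact/List.in_prod.
Qed.

Ltac computable_step := first [assumption | lazymatch goal with
  | |- computable fst => exact: (c_fst (c_id _))
  | |- computable snd => exact: (c_snd (c_id _))
  | |- computable (fun x => x) => exact: c_id
  | |- computable (fun _ => ?y) => exact: c_cst
  | |- computable (fun x => (_, _)) => apply: c_pair
  | |- computable (fun x => fst _) => apply: c_fst
  | |- computable (fun x => snd _) => apply: c_snd
  | |- computable (fun x => _ :: _) => apply: c_cons
  | |- computable (fun x => if _ then _ else _) => apply: c_if
  | |- computable (fun x => match _ with [::] => _ | _ => _ end) => apply: c_match
  | |- computable (fun x => ~~ _) => apply: c_negb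
  | |- computable (fun x => _ && _) => apply: c_andb
  | |- computable (fun x => _ || _) => apply: c_orb
  | |- computable (fun x => _.+1) => apply: c_S
  | |- computable (fun x => rev _) => apply: c_rev
  end].
Ltac comp := repeat computable_step.

Section ListFunctions.
Local Open Scope nat_scope.
Implicit Types E F G S A B : etype.

Lemma c_cat E A (s t : E -> seq A) : computable s -> computable t ->
  computable (fun x => s x ++ t x).
Proof.
move=> hs ht; apply: (@c_seqrec E A (Eseq A) t (fun y => y.2.1 :: y.2.2.2) (fun x u => u ++ t x)) =>
  //.
by comp.
Qed.

Lemma c_map E A B (f : E -> A -> B) (s : E -> seq A) :
  computable (fun y => f y.1 y.2) -> computable s -> computable (fun x => map (f x) (s x)).
Proof.
move=> hf hs.
apply: (@c_seqrec E A (Eseq B) (fun=> [::]) (fun y => f y.1 y.2.1 :: y.2.2.2) (fun x u => map (f x)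
  u)) => //.
  by comp.
apply: c_cons; last by comp.
by apply: (c_comp hf (f := fun y => (y.1, y.2.1))); comp.
Qed.

Lemma c_filter E A (b : E -> A -> bool) (s : E -> seq A) :
  computable (fun y => b y.1 y.2) -> computable s -> computable (fun x => filter (b x) (s x)).
Proof.
move=> hb hs.
apply: (@c_seqrec E A (Eseq A) (fun=> [::]) (fun y => if b y.1 y.2.1 then y.2.1 :: y.2.2.2 else y.2.2.2)
  
  (fun x u => filter (b x) u)) => //; first by comp.
apply: c_if; [|by comp|by comp].
by apply: (c_comp hb (f := fun y => (y.1, y.2.1))); comp.
Qed.

Lemma c_has E A (b : E -> A -> bool) (s : E -> seq A) :
  computable (fun y => b y.1 y.2) -> computable s -> computable (fun x => has (b x) (s x)).
Proof.
move=> hb hs.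
apply: (@c_seqrec E A Ebool (fun=> false) (fun y => b y.1 y.2.1 || y.2.2.2) (fun x u => has (b x) u))
  => //.
  by comp.
apply: c_orb; last by comp.
by apply: (c_comp hb (f := fun y => (y.1, y.2.1))); comp.
Qed.

Lemma c_all E A (b : E -> A -> bool) (s : E -> seq A) :
  computable (fun y => b y.1 y.2) -> computable s -> computable (fun x => all (b x) (s x)).
Proof.
move=> hb hs.
apply: (@c_seqrec E A Ebool (fun=> true) (fun y => b y.1 y.2.1 && y.2.2.2) (fun x u => all (b x) u))
  => //.
  by comp.
apply: c_andb; last by comp.
by apply: (c_comp hb (f := fun y => (y.1, y.2.1))); comp.
Qed.

Lemma c_flatten E A (s : E -> seq (seq A)) : computable s -> computable (fun x => flatten (s x)).
Proof.
move=> hs.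
apply: (@c_seqrec E (Eseq A) (Eseq A) (fun=> [::]) (fun y => y.2.1 ++ y.2.2.2) (fun x u => flatten u))
  => //.
  by comp.
by apply: c_cat; comp.
Qed.

Lemma c_size E A (s : E -> seq A) : computable s -> computable (fun x => size (s x)).
Proof.
move=> hs; apply: (@c_seqrec E A Enat (fun=> 0) (fun y => y.2.2.2.+1) (fun x u => size u)) => //.
  by comp.
by comp.
Qed.

Lemma c_addn E (m n : E -> nat) : computable m -> computable n -> computable (fun x => m x + n x).
Proof.
move=> hm hn; apply: (@c_natrec E Enat n (fun y => y.2.2.+1) (fun x k => k + n x)) => //.
by comp.
Qed.

Lemma c_muln E (m n : E -> nat) : computable m -> computable n -> computable (fun x => m x * n x).
Proof.
move=> hm hn; apply: (@c_natrec E Enat (fun=> 0) (fun y => n y.1 + y.2.2) (fun x k => k * n x)) => //.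
  
  by comp.
by apply: c_addn; [apply: (c_comp hn); comp | comp].
Qed.

Lemma c_expn E (m n : E -> nat) : computable m -> computable n -> computable (fun x => m x ^ n x).
Proof.
move=> hm hn.
apply: (@c_natrec E Enat (fun=> 1) (fun y => m y.1 * y.2.2) (fun x k => m x ^ k)) => // [x k||].
- by rewrite expnS.
- by comp.
by apply: c_muln; [apply: (c_comp hm); comp | comp].
Qed.

Lemma c_subn E (m n : E -> nat) : computable m -> computable n -> computable (fun x => m x - n x).
Proof.
move=> hm hn.
have hp : computable (fun k : nat => k.-1).
  by apply: (@c_natrec Enat Enat (fun=> 0) (fun y => y.2.1) (fun _ k => k.-1)) => //; comp.
apply: (@c_natrec E Enat m (fun y => y.2.2.-1) (fun x k => m x - k)) => // [x|x k|].
- by rewrite subn0.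
- by rewrite subnS.
by apply: (c_comp hp); comp.
Qed.

Lemma c_eqn E (m n : E -> nat) : computable m -> computable n -> computable (fun x => m x == n x).
Proof.
move=> hm hn.
have h0 : computable (fun k : nat => k == 0).
  by apply: (@c_natrec Enat Ebool (fun=> true) (fun y => false) (fun _ k => k == 0)) => //; comp.
apply: (c_ext (g := fun x => (m x - n x == 0) && (n x - m x == 0))).
  by move=> x; rewrite !subn_eq0 eqn_leq.
by apply: c_andb; apply: (c_comp h0); apply: c_subn.
Qed.

Lemma c_sumn E (s : E -> seq nat) : computable s -> computable (fun x => sumn (s x)).
Proof.
move=> hs; apply: (@c_seqrec E Enat Enat (fun=> 0) (fun y => y.2.1 + y.2.2.2) (fun x u => sumn u)) =>
  //.
  by comp.
by apply: c_addn; comp.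
Qed.

Lemma c_zip E A B (s : E -> seq A) (t : E -> seq B) :
  computable s -> computable t -> computable (fun x => zip (s x) (t x)).
Proof.
move=> hs ht.
pose st (y : unit * ((seq B * seq (A * B)) * A)) : seq B * seq (A * B) :=
  match y.2.1.1 with [::] => ([::], y.2.1.2) | b :: r => (r, (y.2.2, b) :: y.2.1.2) end.
have hst : computable st by rewrite /st; comp.
have := c_comp (c_foldl hst) (c_pair (c_cst E tt) (c_pair (c_pair ht (c_cst E ([::] : seq (A * B))))
  hs)).
move=> /c_snd/c_rev; apply: c_ext => x /=.
suff h : forall u v acc, rev (foldl (fun acc a => st (tt, (acc, a))) (v, acc) u).2 =
  rev acc ++ zip u v.
  by rewrite h.
elim=> [|a u IH] [|b v] acc /=; rewrite ?cats0 //=.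
  by rewrite /st /= IH; case: (u) => [|? ?]; rewrite /= cats0.
by rewrite /st /= IH rev_cons cat_rcons.
Qed.

End ListFunctions.

(** * The two reductions are computable *)

Section WordFunctions.
Variable A : finType.
Notation L := (Eprod (Efin A) Ebool).
Implicit Types E : etype.

Lemma fin_letter : fin_etype L.
Proof. exact: fin_Eprod (fin_Efin A) fin_Ebool. Qed.

Lemma c_push : computable (fun y : L * seq L => push y.1 y.2 : seq L).
Proof.
have h : computable (fun y : L * L => y.2 == linv y.1).
  exact: c_table (fin_Eprod fin_letter fin_letter).
rewrite /push; apply: c_match; [by comp | by comp |].
apply: c_if; [|by comp|by comp].
by apply: (c_comp h (f := fun y => (y.1.1, y.2.1))); comp.
Qed.

Lemma c_red E (w : E -> seq L) : computable w -> computable (fun x => red (w x) : seq L).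
Proof.
move=> hw; apply: (@c_seqrec E L (Eseq L) (fun=> [::]) (fun y => push y.2.1 y.2.2.2) (fun x u => red
  u)) => //.
  by comp.
by apply: (c_comp c_push (f := fun y => (y.2.1, y.2.2.2))); comp.
Qed.

Lemma c_winv E (w : E -> seq L) : computable w -> computable (fun x => winv (w x) : seq L).
Proof.
move=> hw; apply: (c_ext (g := fun x => map (fun l => linv l) (rev (w x)) : seq L)) => //.
apply: (@c_map E L L (fun _ l => linv l)); last by comp.
by apply: (c_comp (c_table (fun l : L => linv l : L) fin_letter)); comp.
Qed.

(** Equality becomes a test for emptiness, which avoids comparing encoded lists. *)
Lemma red_eq_nil (u v : word A) : (red u == red v) = nilp (red (u ++ winv v)).
Proof.
have -> : (red u == red v) = (of_word u == of_word v) by rewrite -(inj_eq val_inj).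
by rewrite -divg_eq1 -of_word_winv -of_word_cat fg_eq1 /nilp size_eq0.
Qed.

Lemma c_red_eq E (u v : E -> seq L) : computable u -> computable v ->
  computable (fun x => red (u x) == red (v x)).
Proof.
move=> hu hv; apply: (c_ext (g := fun x => if red (u x ++ winv (v x)) is [::] then true else false)).
  
  by move=> x; rewrite red_eq_nil; case: (red _).
apply: c_match; [|by comp|by comp].
by apply: c_red; apply: c_cat => //; exact: c_winv.
Qed.

Definition words_upto n : seq (seq L) :=
  iter n (fun ws => [::] :: flatten [seq [seq l :: w | w <- ws] | l <- enum {: A * bool}]) [:: [::]].
    

Lemma words_uptoP n (w : word A) : size w <= n -> w \in words_upto n.
Proof.
elim: n w => [|n IH] [|l w] //= sw; rewrite inE; apply/orP; right.
apply/flattenP; exists [seq l :: v | v <- words_upto n].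
  by apply/mapP; exists l; rewrite ?mem_enum.
by apply/mapP; exists w => //; exact: IH.
Qed.

Lemma c_words_upto E (n : E -> nat) : computable n -> computable (fun x => words_upto (n x)).
Proof.
move=> hn.
apply: (@c_natrec E (Eseq (Eseq L)) (fun=> [:: [::]])
  (fun y => [::] :: flatten [seq [seq l :: w | w <- y.2.2] | l <- enum {: A * bool}]) (fun x k => words_upto
    k)) => //.
  by comp.
apply: c_cons; first exact: c_cst.
apply: c_flatten; apply: (@c_map _ L (Eseq (Eseq L)) (fun y l => [seq l :: w | w <- y.2.2]));
  last exact: c_cst.
by apply: (@c_map _ (Eseq L) (Eseq L) (fun y w => y.2 :: w)); comp.
Qed.

End WordFunctions.

(** * A program for list conjugacy from one for M(G) *)

Section Forward.
Variables (X : finType) (R : {fset word X}).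
Notation L := (Eprod (Efin X) Ebool).
Notation row := (bool * (word X * word X))%type.
Implicit Types E : etype.
Notation Erow := (Eprod Ebool (Eprod (Eseq L) (Eseq L))).
Notation Eblock := (Eprod Ebool (Eseq L)).

Lemma c_eqw E (u v : E -> seq L) : computable u -> computable v ->
  computable (fun x => eqw (u x : word X) (v x)).
Proof. exact: c_red_eq. Qed.

Lemma c_head E (F : etype) (d : E -> bool) (s : E -> seq (bool * F)) :
  computable d -> computable s -> computable (fun x => head (d x) (map fst (s x))).
Proof.
move=> hd hs; apply: (c_ext (g := fun x => if s x is b :: t then b.1 else d x)).
  by move=> x; case: (s x).
by comp.
Qed.

Lemma c_rsign E (s : E -> seq Erow) : computable s -> computable (fun x => rsign (s x : seq row)).
Proof. by move=> hs; apply: (c_head (F := Eprod (Eseq L) (Eseq L))) => //; exact: c_cst. Qed.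

Lemma c_lrows E (s : E -> seq Erow) : computable s ->
  computable (fun x => lrows (s x : seq row) : seq Eblock).
Proof. by move=> hs; apply: (@c_map E Erow Eblock (fun _ r => (r.1, r.2.1))); comp. Qed.

Lemma c_rrows E (s : E -> seq Erow) : computable s ->
  computable (fun x => rrows (s x : seq row) : seq Eblock).
Proof. by move=> hs; apply: (@c_map E Erow Eblock (fun _ r => (r.1, r.2.2))); comp. Qed.

Lemma c_adm E (d : E -> bool) (s : E -> seq Erow) :
  computable d -> computable s -> computable (fun x => adm (d x) (s x : seq row)).
Proof.
move=> hd hs.
apply: (@c_seqrec E Erow Ebool (fun=> true) (fun y =>
  [|| head (d y.1) (map fst y.2.2.1) == y.2.1.1,
    ~~ eqw (y.2.1.2.1 : word X) [::] | ~~ eqw (y.2.1.2.2 : word X) [::]]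
  && y.2.2.2) (fun x u => adm (d x) (u : seq row))) => //.
- by move=> x [e [u v]] r; rewrite /= !eqwE of_word_nil.
- by comp.
apply: c_andb; last by comp.
apply: c_orb.
  apply: c_eqb; last by comp.
  by apply: (c_head (F := Eprod (Eseq L) (Eseq L))); [apply: (c_comp hd) |]; comp.
by apply: c_orb; apply: c_negb; apply: c_eqw; comp.
Qed.

Lemma c_good_rows E (d : E -> bool) (s : E -> seq Erow) :
  computable d -> computable s -> computable (fun x => good_rows (d x) (s x : seq row)).
Proof.
move=> hd hs.
apply: (@c_seqrec E Erow Ebool (fun=> true) (fun y =>
  ((head (d y.1) (map fst y.2.2.1) == y.2.1.1) || ~~ eqw (y.2.1.2.1 : word X) [::] && ~~ eqw (y.2.1.2.2
    : word X) [::])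
  && y.2.2.2) (fun x u => good_rows (d x) (u : seq row))) => //.
- by move=> x [e [u v]] r.
- by comp.
apply: c_andb; last by comp.
apply: c_orb.
  apply: c_eqb; last by comp.
  by apply: (c_head (F := Eprod (Eseq L) (Eseq L))); [apply: (c_comp hd) |]; comp.
by apply: c_andb; apply: c_negb; apply: c_eqw; comp.
Qed.

Lemma c_wpow E (N : E -> nat) (w : E -> seq L) :
  computable N -> computable w -> computable (fun x => wpow (N x) (w x : word X) : seq L).
Proof.
move=> hN hw.
apply: (@c_natrec E (Eseq L) (fun=> [::]) (fun y => w y.1 ++ y.2.2) (fun x k => wpow k (w x : word X)))
  => //.
  by comp.
by apply: c_cat; [apply: (c_comp hw) |]; comp.
Qed.

Lemma c_wpow_mixed E (N : E -> nat) (d : E -> bool) (s : E -> seq Eblock) :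
  computable N -> computable d -> computable s ->
  computable (fun x => wpow_mixed (N x) (d x) (s x : seq (bool * word X)) : seq Eblock).
Proof.
move=> hN hd hs.
apply: (@c_seqrec E Eblock (Eseq Eblock) (fun=> [::]) (fun y =>
  if ~~ (head (d y.1) (map fst y.2.2.1) == y.2.1.1) then
    (y.2.1.1, wpow (N y.1) (y.2.1.2 : word X)) :: y.2.2.1 else (y.2.1.1, y.2.1.2) :: y.2.2.2)
  (fun x u => wpow_mixed (N x) (d x) (u : seq (bool * word X)))) => //.
- by move=> x [e w] r.
- by comp.
apply: c_if; [|apply: c_cons|]; [|apply: c_pair| |]; try by comp.
  apply: c_negb; apply: c_eqb; last by comp.
  by apply: (c_head (F := Eseq L)); [apply: (c_comp hd) |]; comp.
by apply: c_wpow; [apply: (c_comp hN) |]; comp.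
Qed.

Lemma c_block_word E (s : E -> seq Eblock) :
  computable s -> computable (fun x => block_word R (s x : seq (bool * word X))).
Proof.
move=> hs; apply: c_flatten.
apply: (@c_map E Eblock (Eseq (Eprod (Efin (miller_gen R)) Ebool))
  (fun _ b => (mq R, b.1) :: miller_word R (b.2 : word X))); last by [].
apply: c_cons; first by apply: c_pair; comp.
apply: (@c_map _ L (Eprod (Efin (miller_gen R)) Ebool) (fun _ l => (mx R l.1, l.2))); last by comp.
exact: (c_comp (c_table (fun l : L => (mx R l.1,
  l.2) : Eprod (Efin (miller_gen R)) Ebool) (fin_letter X)) (c_snd (c_id _))).
Qed.

Lemma c_ext_rows E (s : E -> seq Erow) :
  computable s -> computable (fun x => ext_rows (s x : seq row) : seq Erow).
Proof.
move=> hs.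
pose cond (y : Erow * Erow) : bool := ~~ (eqw (y.2.2.1 : word X) y.1.2.1 && eqw (y.2.2.2 : word X) y.1.2.2).
  
pose F (y : (seq Erow * Erow)) : seq Erow :=
  match [seq r <- y.1 | cond (y.2, r)] with
  | [::] => [:: (y.2.1, (y.2.2.1, y.2.2.2))]
  | r :: _ => y.1 ++ [:: (y.2.1, (y.2.2.1 ++ winv (r.2.1 : word X),
    y.2.2.2 ++ winv (r.2.2 : word X)));
      (~~ y.2.1, (winv (y.2.2.1 : word X) ++ r.2.1, winv (y.2.2.2 : word X) ++ r.2.2))]
  end.
have hF : computable F.
  rewrite /F; apply: c_match; [|by comp|].
    apply: (@c_filter _ Erow (fun y r => cond (y.2, r))); last by comp.
    by rewrite /cond; apply: c_negb; apply: c_andb; apply: c_eqw; comp.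
  apply: c_cat; first by comp.
  apply: c_cons; [apply: c_pair; [by comp|apply: c_pair] | apply: c_cons; [apply: c_pair;
    [by comp|apply: c_pair]|by comp]];
    by apply: c_cat; try apply: c_winv; comp.
apply: (c_ext (g := fun x => match s x with [::] => [::] | r :: _ =>
   if all (fun b => b.1 == r.1) (s x) then F (s x, r) else s x end)).
  move=> x; case: (s x) => // -[e [u v]] t; rewrite /ext_rows.
  rewrite -[all (pred1 e) _]/(all (pred1 e) _) all_map; congr (if _ then _ else _).
  rewrite /F /cond; cbn [fst snd].
  by case: [seq r <- _ | _] => // -[e' [u' v']] r.
apply: c_match => //; first exact: c_cst.
apply: c_if.
- apply: (@c_all _ Erow (fun y b => b.1 == y.2.1.1)); last by apply: (c_comp hs); comp.
  by apply: c_eqb; comp.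
- by apply: (c_comp hF); apply: c_pair; [apply: (c_comp hs)|]; comp.
- by apply: (c_comp hs); comp.
Qed.

Lemma c_query : computable (fun s : seq Erow => query R (s : seq row)).
Proof.
rewrite /query.
have h2 : computable (fun s : seq Erow => ext_rows (s : seq row) : seq Erow) by apply: c_ext_rows;
  comp.
have hh : computable (fun s : seq Erow => rsign (ext_rows (s : seq row))) by exact: c_rsign h2.
have hN : computable (fun s : seq Erow => (sumn [seq size r.2.1 | r <- ext_rows (s : seq row)]).+1).
  apply: c_S; apply: c_sumn; apply: (@c_map _ Erow Enat (fun _ r => size r.2.1)) => //.
  by apply: c_size; comp.
apply: c_if; [exact: c_good_rows| |exact: c_cst].
apply: c_pair; apply: c_block_word; (apply: c_cat; last apply: c_wpow_mixed => //);
  by [exact: c_lrows | exact: c_rrows].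
Qed.

Theorem list_decidable : conjugacy_problem_decidable (@miller_rel X R) -> iso_list_conj_decidable R.
Proof.
move=> [p hp].
have hrows : computable (fun y : (seq (seq L) * (seq (seq L) * seq bool)) => zip y.2.2 (zip y.1 y.2.1)
  : seq Erow).
  by apply: c_zip; [|apply: c_zip]; comp.
have [pq hq] := c_comp c_query hrows.
exists (PSeq pq p) => I /list_admissibleP [n0 ad].
have [b [ev bE]] := hp (query R (rows_of I)) Logic.I.
(* An instance and the triple of its underlying lists have the same encoding. *)
exists b; split; first by apply: ESeq ev; exact: (hq (tval (li_u I), (tval (li_v I),
  tval (li_sigma I)))).
rewrite bE iso_list_conjP; apply: iff_sym; apply: queryP => //.
by rewrite -size_eq0 -lt0n.
Qed.

End Forward.

(** * A program for M(G) from one for list conjugacy *)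

Section Backward.
Variables (X : finType) (R : {fset word X}).
Local Notation M := (miller_gen R).
Local Notation Th := (X + R)%type.
Notation LX := (Eprod (Efin X) Ebool).
Notation LK := (Eprod (Eoption X) Ebool).
Notation LT := (Eprod (Esum X R) Ebool).
Notation LM := (Eprod (Efin M) Ebool).
Notation row := (bool * (word X * word X))%type.
Notation block := (bool * word X)%type.
Notation Eblock := (Eprod Ebool (Eseq LX)).
Notation Erow := (Eprod Ebool (Eprod (Eseq LX) (Eseq LX))).
Implicit Types E : etype.

(** As in the semidirect product, a letter of Theta acts on the K-component of everything to its
    right. *)
Definition kstep (l : M * bool) (v : word (option X)) : word (option X) :=
  match l.1 with
  | inl (inl x) => (Some x, l.2) :: v
  | inl (inr al) => psubst (al, l.2) v
  | inr _ => (None, l.2) :: v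
  end.
Definition kpart (w : word M) : word (option X) := foldr kstep [::] w.

Definition tstep (l : M * bool) (v : word Th) : word Th :=
  if l.1 is inl (inr al) then (al, l.2) :: v else v.
Definition tpart (w : word M) : word Th := foldr tstep [::] w.

Lemma mu_parts w : mu w = Mil (of_word (kpart w)) (of_word (tpart w)).
Proof.
elim: w => // -[[[x|al]|[]] b] w IH; rewrite mu_cons IH.
- by rewrite -[lev _ _]/(lev (@gm X R) (kgen R (Some x),
  b)) lev_gmK milM [mk _]/= [mt _]/= phi_1 mul1g of_word_cons.
- by rewrite -[lev _ _]/(lev (@gm X R) (mtheta al,
  b)) lev_gmT milM [mk _]/= [mt _]/= mul1g of_word_psubst of_word_cons.
- by rewrite -[lev _ _]/(lev (@gm X R) (kgen R None,
  b)) lev_gmK milM [mk _]/= [mt _]/= phi_1 mul1g of_word_cons.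
Qed.

Definition mu_eqb (u v : word M) : bool :=
  (red (kpart u) == red (kpart v)) && (red (tpart u) == red (tpart v)).

Lemma mu_eqbP u v : reflect (mu u = mu v) (mu_eqb u v).
Proof.
rewrite /mu_eqb !mu_parts; apply: (iffP andP) => [[/eqP e1 /eqP e2]|[e1 e2]].
  by congr Mil; apply: val_inj.
by rewrite e1 e2.
Qed.

Definition pstep (l : option X * bool) (st : word X * seq block) : word X * seq block :=
  if l.1 is Some x then ((x, l.2) :: st.1, st.2) else ([::], (l.2, st.1) :: st.2).
Definition parse (v : word (option X)) : word X * seq block := foldr pstep ([::], [::]) v.

Lemma of_word_parse v : of_word v = iX (of_word (parse v).1) * kval (gblocks (parse v).2).
Proof.
elim: v => [|[[x|] b] v IH]; first by rewrite iX1 mul1g.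
  by rewrite of_word_cons IH lev_Some /= of_word_cons iXM mulgA.
transitivity (qe b * iX (of_word (parse v).1) * kval (gblocks (parse v).2)).
  by rewrite of_word_cons IH mulgA.
by rewrite -[RHS]/(iX 1 * (qe b * iX (of_word (parse v).1) * kval (gblocks (parse v).2))) iX1 mul1g.
Qed.

Lemma parse_bword (u : word X) (bs : seq (bool * fg X)) :
  parse (sword u ++ bword bs) = (u, [seq (b.1, fgw b.2) | b <- bs]).
Proof.
elim: bs u => [|[e w] bs IH] u.
  by rewrite cats0; elim: u => //= -[x b] u; rewrite /parse /= => ->.
elim: u => [|[x b] u IHu]; last by rewrite /parse /= -/(parse _) IHu.
by rewrite [parse _]/(pstep (None, e) (parse (sword (fgw w) ++ bword bs))) IH.
Qed.

Definition zip_rows (bs bs' : seq block) : seq row :=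
  [seq (p.1.1, (p.1.2, p.2.2)) | p <- zip bs bs'].

Lemma zip_rowsK bs bs' : map fst bs = map fst bs' ->
  lrows (zip_rows bs bs') = bs /\ rrows (zip_rows bs bs') = bs'.
Proof.
by elim: bs bs' => [|[e u] bs IH] [|[e' v] bs'] //= [-> /IH [h1 h2]]; rewrite /zip_rows /= h1 h2.
Qed.

(* O is an oracle for list conjugacy; u and v are words for elements of the kernel of the
   projection to F(Theta). *)
Definition query_test (O : seq row -> bool) (u v : word (option X)) : bool :=
  let pu := parse (red u) in let pv := parse (red v) in
  let rows := zip_rows pu.2 pv.2 in
  [&& nilp pu.1, nilp pv.1, size pu.2 == size pv.2,
      all (fun p => p.1.1 == p.2.1) (zip pu.2 pv.2) & O rows].

Definition conj_test (O : seq row -> bool) (uv : word M * word M) : bool :=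
  let ws := words_upto M (confb R (size uv.1 + size uv.2)) in
  has (fun c => mu_eqb (c ++ uv.1 ++ winv c) uv.2) ws ||
  [&& red (tpart uv.1) == red [::], red (tpart uv.2) == red [::] &
    has (fun c => has (fun c' =>
      query_test O (kpart (c ++ uv.1 ++ winv c)) (kpart (c' ++ uv.2 ++ winv c'))) ws) ws].

Definition oracle_spec (O : seq row -> bool) : Prop :=
  forall rows, O rows <-> [/\ rows != [::], adm (rsign rows) rows & iso_rows R rows].

Lemma mu_conj (c u : word M) : mu (c ++ u ++ winv c) = mu c * mu u * (mu c)^-1.
Proof. by rewrite !mu_cat mu_winv mulgA. Qed.

Lemma same_signs (bs bs' : seq block) : size bs = size bs' ->
  all (fun p => p.1.1 == p.2.1) (zip bs bs') = (map fst bs == map fst bs').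
Proof.
elim: bs bs' => [|b bs IH] [|b' bs'] //= [/IH ->].
by rewrite eqseq_cons.
Qed.

Lemma mixok_adm e0 (rows : seq row) : mixok e0 (gblocks (lrows rows)) -> adm e0 rows.
Proof.
elim: rows => //= -[e [u v]] rows IH /= /andP[h /IH ->]; rewrite andbT.
by move: h; rewrite hsignE nth0 signs_gblocks signs_lrows => /orP[->|->]; rewrite ?orbT.
Qed.

Lemma mu_conj_kernel (c u : word M) (b : mil R) : mt b = 1 -> mu u = b ->
  mt (mu (c ++ u ++ winv c)) = 1.
Proof. by move=> b1 e; rewrite mu_conj e !mtM mtV b1 mulg1 mulgV. Qed.

(** A successful search exhibits a conjugator, whatever words it tried; that a conjugate pair is
    always found is [bounded_conj], used with the total length of both words. The lists it provides
    satisfy [mixok], so the query is admissible. *)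
Lemma conj_testP O uv : oracle_spec O -> conj_test O uv <-> pres_conj (@miller_rel X R) uv.1 uv.2.
Proof.
case: uv => u v OP; rewrite miller_conjP /conj_test /=; set n := size u + size v.
have tE w : (red (tpart w) == red [::]) = (mt (mu w) == 1).
  by rewrite mu_parts -(inj_eq val_inj).
split=> [/orP[/hasP[c _ /mu_eqbP e]|/and3P[tu tv /hasP[c _ /hasP[c' _ q]]]]|[h eq]].
- by exists (mu c); rewrite -e mu_conj.
- rewrite !tE in tu tv.
  move: q; rewrite /query_test /=.
  set pu := parse (red (kpart (c ++ _))); set pv := parse (red (kpart (c' ++ _))).
  case/and5P=> /nilP p1 /nilP p2 /eqP sz al /OP[r0 ad iso].
  have [h1 h2] : lrows (zip_rows pu.2 pv.2) = pu.2 /\ rrows (zip_rows pu.2 pv.2) = pv.2.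
    by apply: zip_rowsK; apply/eqP; rewrite -same_signs.
  have kE w (a : word M) : (parse (red (kpart a))).1 = [::] -> mt (mu w) = 1 ->
      a = w -> mu a = Mil (kval (gblocks (parse (red (kpart a))).2)) 1.
    move=> pa tw aw; have := of_word_parse (red (kpart a)); rewrite pa iX1 mul1g => <-.
    rewrite -[of_word (red _)]/(of_word (of_word (kpart a))) of_wordK.
    by move: tw; rewrite -aw mu_parts /= => ->.
  have eu := kE _ _ p1 (mu_conj_kernel c (eqP tu) erefl) erefl.
  have ev := kE _ _ p2 (mu_conj_kernel c' (eqP tv) erefl) erefl.
  case: iso => s; rewrite h1 h2; set bu := gblocks _ in eu *; set bv := gblocks _ in ev * => tE'.
  have := csd_conj s 1 bu; rewrite tE' mulg1 mulgV -eu -ev !mu_conj => e.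
  exists ((mu c')^-1 * csd (~~ hsign true bu) s * mu c).
  apply: (mulgI (mu c')); apply: (mulIg (mu c')^-1); rewrite -e.
  by gsimp.
have wbu : wb (mu u) n by exists u => //; exact: leq_addr.
have wbv : wb (mu v) n by exists v => //; exact: leq_addl.
have inw (c : word M) : size c <= confb R n -> c \in words_upto M (confb R n).
  exact: words_uptoP.
apply/orP; case: (bounded_conj wbu wbv eq) => [[g [c sc gE] e]|[tu tv [g [g' [bs [bs' [gs [b0 b0' ok
  ok' iso]]]]]]]].
  by left; apply/hasP; exists c; [exact: inw | apply/mu_eqbP; rewrite mu_conj gE].
case: gs => -[c sc gE] [c' sc' gE'] eu ev; rewrite -{}gE in eu; rewrite -{}gE' in ev.
right; rewrite !tE tu tv eqxx /=; apply/hasP; exists c; first exact: inw.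
apply/hasP; exists c'; first exact: inw.
have pE (a : word M) (d : seq (bool * fg X)) : mixok (hsign true d) d -> mu a = Mil (kval d) 1 ->
    parse (red (kpart a)) = ([::], [seq (b.1, fgw b.2) | b <- d]).
  move=> okd; rewrite mu_parts => -[/(congr1 (@fgw _)) /= -> _].
  by rewrite -/(red _) fgw_kval ?(mixok_no_pinch okd) // -[bword d]/(sword [::] ++ bword d) parse_bword.
    
rewrite -mu_conj in eu; rewrite -mu_conj in ev.
rewrite /query_test (pE _ _ ok eu) (pE _ _ ok' ev) /= !size_map.
have sg : map fst bs = map fst bs' by case: iso => s <-; rewrite signs_twist.
have szb : size bs = size bs' by rewrite -(size_map fst) sg size_map.
rewrite szb eqxx same_signs ?size_map // -!map_comp /=.
have -> : (map (fst \o (fun b : bool * fg X => (b.1, fgw b.2))) bs ==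
   map (fst \o (fun b : bool * fg X => (b.1, fgw b.2))) bs') = true by apply/eqP.
set rows := zip_rows _ _; have [|h1 h2] := @zip_rowsK [seq (b.1, fgw b.2) | b <- bs] [seq (b.1,
  fgw b.2) | b <- bs'].
  by rewrite -!map_comp.
have gK (d : seq (bool * fg X)) : gblocks [seq (b.1, fgw b.2) | b <- d] = d.
  by rewrite /gblocks -map_comp map_id_in // => -[e w] _ /=; rewrite of_wordK.
apply/OP; rewrite -/rows in h1 h2; split.
- by apply: contraNneq b0 => r0; move: h1; rewrite r0 /=; case: (bs).
- have rs : rsign rows = hsign true bs.
    by rewrite /rsign -signs_lrows h1 -hsign_gblocks gK.
  by apply: mixok_adm; rewrite h1 gK rs.
- by rewrite /iso_rows h1 h2 !gK.
Qed.

Lemma c_kpart E (w : E -> seq LM) : computable w -> computable (fun x => kpart (w x) : seq LK).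
Proof.
move=> hw.
apply: (@c_seqrec E LM (Eseq LK) (fun=> [::]) (fun y => kstep y.2.1 y.2.2.2) (fun x u => kpart u)) =>
  //.
  by comp.
have h : computable (fun y : LM * seq LK => kstep y.1 y.2 : seq LK).
  apply: (@c_fincase LM (Eseq LK) (Eseq LK) kstep) => [|[[[x|al]|[]] b]].
  - exact: fin_letter.
  - by rewrite /kstep /=; comp.
  - rewrite /kstep /psubst /=; apply: c_flatten;
    apply: (@c_map _ LK (Eseq LK) (fun _ m => psub (al, b) m)); last by comp.
    apply: (@c_comp _ LK (Eseq LK) (psub (al, b)) snd); last by comp.
    by apply: c_table; apply: fin_Eprod fin_Ebool; exact: fin_Eoption.
  - by rewrite /kstep /=; comp.
by apply: (c_comp h (f := fun y => (y.2.1, y.2.2.2))); comp.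
Qed.

Lemma c_tpart E (w : E -> seq LM) : computable w -> computable (fun x => tpart (w x) : seq LT).
Proof.
move=> hw.
apply: (@c_seqrec E LM (Eseq LT) (fun=> [::]) (fun y => tstep y.2.1 y.2.2.2) (fun x u => tpart u)) =>
  //.
  by comp.
have h : computable (fun y : LM * seq LT => tstep y.1 y.2 : seq LT).
  apply: (@c_fincase LM (Eseq LT) (Eseq LT) tstep) => [|[[[x|al]|[]] b]]; first exact: fin_letter.
  - exact: (c_id (Eseq LT)).
  - exact: (c_cons (c_cst (Eseq LT) ((al, b) : LT)) (c_id _)).
  - exact: (c_id (Eseq LT)).
by apply: (c_comp h (f := fun y => (y.2.1, y.2.2.2))); comp.
Qed.

Lemma c_redK_eq E (u v : E -> seq LK) : computable u -> computable v ->
  computable (fun x => red (u x) == red (v x)).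
Proof. exact: (@c_red_eq (option X : finType) E). Qed.

Lemma c_redT_eq E (u v : E -> seq LT) : computable u -> computable v ->
  computable (fun x => red (u x) == red (v x)).
Proof. exact: (@c_red_eq (Th : finType) E). Qed.

Lemma c_parse E (v : E -> seq LK) : computable v ->
  computable (fun x => parse (red (v x)) : Eprod (Eseq LX) (Eseq Eblock)).
Proof.
move=> hv; have hr : computable (fun x => red (v x) : seq LK) by exact: (@c_red (option X : finType)
  E).
apply: (@c_seqrec E LK (Eprod (Eseq LX) (Eseq Eblock)) (fun=> ([::],
  [::])) (fun y => pstep y.2.1 y.2.2.2)
  (fun x u => parse u) (fun x => red (v x))) => //.
  by comp.
have h : computable (fun y : LK * Eprod (Eseq LX) (Eseq Eblock) => pstep y.1 y.2 : Eprod (Eseq LX) (Eseq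
  Eblock)).
  apply: (@c_fincase LK _ _ pstep) => [|[[x|] b]].
  - by apply: fin_Eprod fin_Ebool; exact: fin_Eoption.
  - by rewrite /pstep /=; comp.
  - by rewrite /pstep /=; comp.
by apply: (c_comp h (f := fun y => (y.2.1, y.2.2.2))); comp.
Qed.

Lemma c_nilp E (F : etype) (s : E -> seq F) : computable s -> computable (fun x => nilp (s x)).
Proof.
move=> hs; apply: (c_ext (g := fun x => if s x is [::] then true else false)).
  by move=> x; case: (s x).
by comp.
Qed.

Lemma c_query_test O E (u v : E -> seq LK) : computable (O : seq Erow -> bool) ->
  computable u -> computable v -> computable (fun x => query_test O (u x) (v x)).
Proof.
move=> hO hu hv; have pu := c_parse hu; have pv := c_parse hv.
rewrite /query_test; apply: c_andb; first by apply: c_nilp; comp.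
apply: c_andb; first by apply: c_nilp; comp.
apply: c_andb; first by apply: c_eqn; apply: c_size; comp.
have hz : computable (fun x => zip (parse (red (u x))).2 (parse (red (v x))).2 : seq (Eprod Eblock Eblock)).
  
  by apply: c_zip; comp.
apply: c_andb.
  apply: (@c_all E (Eprod Eblock Eblock) (fun _ p => p.1.1 == p.2.1)) => //.
  by apply: c_eqb; comp.
apply: (c_comp hO); apply: (@c_map E (Eprod Eblock Eblock) Erow (fun _ p => (p.1.1, (p.1.2,
  p.2.2)))) => //.
by comp.
Qed.

Lemma c_confb E (n : E -> nat) : computable n -> computable (fun x => confb R (n x)).
Proof.
have mono (f : nat -> nat) : computable (fun m : nat => f m) ->
    forall (F : etype) (k : F -> nat), computable k -> computable (fun x => f (k x)).
  by move=> hf F k hk; exact: (c_comp hf).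
have c_dbl (F : etype) (k : F -> nat) : computable k -> computable (fun x => (k x).*2).
  move=> hk; apply: (c_ext (g := fun x => (k x + k x)%N)); first by move=> x; rewrite addnn.
  exact: c_addn.
have hkb : forall (F : etype) (k : F -> nat), computable k -> computable (fun x => kb R (k x)).
  apply: (mono); rewrite /kb; apply: c_muln; first by comp.
  apply: c_addn; first by comp.
  by apply: (c_dbl); apply: c_muln; comp.
have hredb : forall (F : etype) (k : F -> nat), computable k -> computable (fun x => redb R (k x)).
  apply: (mono); rewrite /redb; apply: c_addn; first by apply: (hkb); comp.
  by apply: (hkb); apply: c_addn; [comp | apply: (c_dbl); apply: (hkb); comp].
have hs (F : etype) (k : F -> nat) : computable k ->
  computable (fun x => (rho R * (k x + k x) + (k x + k x))%N).
  by move=> hk; apply: c_addn; [apply: c_muln; [comp | apply: c_addn] | apply: c_addn].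
have hr (F : etype) (k : F -> nat) : computable k -> computable (fun x => (rho R * k x)%N).
  by move=> hk; apply: c_muln; comp.
have hpow (F : etype) (k l m : F -> nat) : computable k -> computable l -> computable m ->
    computable (fun x => powb R (k x) (l x) (m x)).
  move=> hk hl hm; rewrite /powb; apply: c_expn; first exact: c_cst.
  apply: c_muln; first exact: hkb.
  apply: c_S; rewrite /coefb; apply: c_addn; first by apply: c_addn; exact: hkb.
  by apply: (c_dbl); apply: c_addn; exact: hr.
have hhyp : forall (F : etype) (k : F -> nat), computable k -> computable (fun x => hypb R (k x)).
  apply: (mono); rewrite /hypb; apply: c_addn; first by apply: (hkb); comp.
  apply: c_addn; first by apply: (hs); comp.
  apply: c_muln; last by apply: c_addn; [apply: (hr)|]; comp.
  apply: (hpow); first by comp.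
    by apply: c_addn; [comp | apply: (c_dbl); apply: (hkb); comp].
  by apply: c_addn; [comp | apply: (c_dbl); apply: (hs); comp].
have hell : forall (F : etype) (k : F -> nat), computable k -> computable (fun x => ellb R (k x)).
  apply: (mono); rewrite /ellb; apply: c_addn; last by comp.
  apply: c_addn; last by apply: c_addn; comp.
  apply: (c_dbl); apply: c_addn; apply: c_addn; try (by apply: (hkb); comp).
  by apply: (hr); comp.
apply: (mono); rewrite /confb.
have h1 : computable (fun m : nat => (m + (redb R m).*2)%N).
  by apply: c_addn; [comp | apply: (c_dbl); apply: (hredb); comp].
apply: c_addn; last by apply: (hell).
apply: c_addn; last by apply: (hhyp).
apply: c_addn; last by apply: (hkb).
by apply: c_addn; apply: (hredb); comp.
Qed.

Lemma c_conj_test O : computable (O : seq Erow -> bool) ->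
  computable (fun uv : seq LM * seq LM => conj_test O uv).
Proof.
move=> hO; rewrite /conj_test.
have hw : computable (fun uv : seq LM * seq LM => words_upto M (confb R (size uv.1 + size uv.2)) : seq
  (seq LM)).
  by apply: c_words_upto; apply: c_confb; apply: c_addn; apply: c_size; comp.
have cnj (E : etype) (c u : E -> seq LM) : computable c -> computable u ->
    computable (fun x => c x ++ u x ++ winv (c x) : seq LM).
  by move=> hc hu; apply: c_cat => //; apply: c_cat => //; exact: c_winv.
apply: c_orb.
  apply: (@c_has _ (Eseq LM) (fun uv c => mu_eqb (c ++ uv.1 ++ winv c) uv.2)) => //.
  rewrite /mu_eqb; apply: c_andb.
    by apply: c_redK_eq; apply: c_kpart; [apply: (cnj)|]; comp.
  by apply: c_redT_eq; apply: c_tpart; [apply: (cnj)|]; comp.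
have ht (f : seq LM * seq LM -> seq LM) : computable f ->
    computable (fun uv => red (tpart (f uv)) == red [::]).
  by move=> hf; apply: c_redT_eq; [exact: c_tpart | comp].
apply: c_andb; first by apply: (ht); comp.
apply: c_andb; first by apply: (ht); comp.
apply: (@c_has _ (Eseq LM) (fun uv c => has (fun c' =>
      query_test O (kpart (c ++ uv.1 ++ winv c)) (kpart (c' ++ uv.2 ++ winv c')))
      (words_upto M (confb R (size uv.1 + size uv.2))))) => //.
apply: (@c_has _ (Eseq LM) (fun y c' =>
      query_test O (kpart (y.2 ++ y.1.1 ++ winv y.2)) (kpart (c' ++ y.1.2 ++ winv c')))).
  by apply: c_query_test => //; apply: c_kpart; apply: (cnj); comp.
by apply: (c_comp hw); comp.
Qed.

(** The given program is reliable on admissible instances only, so admissibility, which is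
    computable, is tested first. Excluded middle merely names the boolean that the program
    returns. *)
Lemma oracle_exists : iso_list_conj_decidable R ->
  exists2 O : seq Erow -> bool, computable O & oracle_spec O.
Proof.
move=> [p hp].
pose yes (rows : seq row) : bool := if excluded_middle_informative (iso_rows R rows) then true else
  false.
pose valid (rows : seq row) : bool := ~~ nilp rows && adm (rsign rows) rows.
exists (fun rows => if valid rows then yes rows else false).
  apply: c_if_partial; last exact: c_cst.
    apply: c_andb; first by apply: c_negb; apply: c_nilp; comp.
    by apply: c_adm; [apply: c_rsign|]; comp.
  have [pe he] : computable (fun rows : seq Erow =>
      ([seq r.2.1 | r <- rows], ([seq r.2.2 | r <- rows], [seq r.1 | r <- rows])) :
      Eprod (Eseq (Eseq LX)) (Eprod (Eseq (Eseq LX)) (Eseq Ebool))).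
    apply: c_pair; [|apply: c_pair].
    - by apply: (@c_map _ Erow (Eseq LX) (fun _ r => r.2.1)); comp.
    - by apply: (@c_map _ Erow (Eseq LX) (fun _ r => r.2.2)); comp.
    - by apply: (@c_map _ Erow Ebool (fun _ r => r.1)); comp.
  exists (PSeq pe p) => rows /andP[r0 ad].
  have [|b [ev bE]] := hp (list_of rows).
    by apply/list_admissibleP; rewrite list_ofK; split=> //; rewrite lt0n.
  have -> : yes rows = b.
    rewrite iso_list_conjP list_ofK in bE; rewrite /yes.
    case: excluded_middle_informative => h; first by rewrite (bE.2 h).
    by case: b bE {ev} => // bE; case: h; apply: bE.1.
  exact: (ESeq (he rows) ev).
move=> rows; rewrite /valid /yes /nilp size_eq0; split.
  case: ifP => // /andP[r0 ad]; case: excluded_middle_informative => // h _; by split.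
by case=> -> -> h; case: excluded_middle_informative.
Qed.

Theorem conj_decidable : iso_list_conj_decidable R -> conjugacy_problem_decidable (@miller_rel X R).
Proof.
move=> /oracle_exists [O cO OP]; have [p hp] := c_conj_test cO.
exists p => uv _; exists (conj_test O uv); split; first exact: hp.
exact: conj_testP.
Qed.

End Backward.

Theorem theoremA (X : finType) (R : {fset word X})
    (R_nonempty : R <> fset0)
    (X_R_disjoint : forall x : X, [:: gen x] \notin R) :
  conjugacy_problem_decidable (@miller_rel X R) <-> iso_list_conj_decidable R.
Proof. by split; [exact: list_decidable | exact: conj_decidable]. Qed.
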